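(* Let $d\ge1$ be an integer, $D=d(d+1)/2$, and let $r_d$ be as defined in the context. Let $q_1,\dots,q_n$ be primes (not necessarily distinct), put $q=q_1\cdots q_n$, and for each $i$ let $\chi_i$ be a nontrivial Dirichlet character modulo $q_i$. Let $F$ be a polynomial of degree $d$ in $n$ variables with real coefficients and let $$\mathcal{B}=\{(h_1,\dots,h_n)\in\mathbb{Z}^n : M_i<h_i\le M_i+H_i\}$$ for integers $M_i,H_i$. Let $r\ge r_d$ be an integer. If for each $i$ we have $q_i>q^{1/(2(r-D))}$ and $q^{1/(2(r-D))}\le H_i\le q_i^{1/2+1/(4(r-D))}$, then $$\left|\sum_{\mathbf{x}\in\mathcal{B}}\chi_1(x_1)\cdots\chi_n(x_n)e^{2\pi iF(\mathbf{x})}\right|\le (\#\mathcal{B})^{1-1/r}\,q^{\frac{r-D+n}{4r(r-D)}+o(1)}.$$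
   Context: For integers $r,d,V\ge 1$, $J_{r,d}(V)$ denotes the number of integer solutions $(v_1,\dots,v_{2r})$ of the system $v_1^{i}+\dots+v_r^{i}=v_{r+1}^{i}+\dots+v_{2r}^{i}$ for $1\le i\le d$, with $1\le v_j\le V$. $r_d$ denotes the smallest integer such that for every integer $r\ge r_d$ one has $J_{r,d}(V)\le V^{2r-d(d+1)/2+o(1)}$ as $V\to\infty$. The factor $q^{o(1)}$ denotes a quantity bounded by $C(\varepsilon)q^{\varepsilon}$ for every $\varepsilon>0$, where $C(\varepsilon)$ depends only on $\varepsilon$ and the fixed parameters ($d,r,n$). *)

(* Defs.v *)
From mathcomp Require Import all_boot all_algebra.
From mathcomp Require Import all_classical all_reals all_analysis.
From mathcomp Require Import Rstruct Rstruct_topology.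
From mathcomp Require Import complex.
From mathcomp Require mpoly.
Set Implicit Arguments. Unset Strict Implicit. Unset Printing Implicit Defensive.
Import GRing.Theory Num.Theory.
Local Open Scope ring_scope.

Notation RR := Rdefinitions.R.

Definition Dd (d : nat) : nat := ((d * d.+1) %/ 2)%N.

(* J_{r,d}(V): number of (v_1,..,v_{2r}) in [1,V]^{2r} with
   v_1^i+..+v_r^i = v_{r+1}^i+..+v_{2r}^i for 1 <= i <= d.
   An entry w : 'I_V encodes the integer v = w+1 in [1,V]. *)
Definition Jrd (r d V : nat) : nat :=
  #|[set v : {ffun 'I_(r + r) -> 'I_V} |
      [forall i : 'I_d,
         (\sum_(j < r) (v (lshift r j)).+1 ^ i.+1 ==
          \sum_(j < r) (v (rshift r j)).+1 ^ i.+1)%N]]|.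

(* J_{r,d}(V) <= V^{2r - D + o(1)} as V -> oo, i.e. for every eps > 0 there
   is C(eps) with J_{r,d}(V) <= C(eps) V^{2r-D+eps} for all V >= 1. *)
Definition vinogradov_ok (d r : nat) : Prop :=
  forall eps : RR, 0 < eps -> exists C : RR, forall V : nat, (0 < V)%N ->
    (Jrd r d V)%:R <= C * (V%:R `^ ((2 * r)%:R - (Dd d)%:R + eps)).

Definition is_r_d (d k : nat) : Prop :=
  (forall r, (k <= r)%N -> vinogradov_ok d r) /\
  (forall k', (forall r, (k' <= r)%N -> vinogradov_ok d r) -> (k <= k')%N).

Definition dirichlet_char (m : nat) (chi : int -> RR[i]) : Prop :=
  [/\ forall a b : int, chi (a * b) = chi a * chi b,
      forall a : int, chi (a + m%:Z) = chi a
    & forall a : int, chi a != 0 <-> coprimez a m%:Z].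

Definition nontrivial_dirichlet_char (m : nat) (chi : int -> RR[i]) : Prop :=
  dirichlet_char m chi /\ exists a : int, coprimez a m%:Z /\ chi a != 1.

(* total degree of a multivariate polynomial (0 for the zero polynomial);
   this is (msize p).-1 written out *)
Definition mtdeg n (R : ringType) (p : mpoly.mpoly n R) : nat :=
  (\max_(m <- mpoly.msupp p) mpoly.mdeg m)%N.

Definition e_ (t : RR) : RR[i] := (cos (2 * pi * t) +i* sin (2 * pi * t))%C.

(* The box B = {h in Z^n : M_i < h_i <= M_i + H_i}.  It is parametrized by
   j with 0 <= j_i < H_i, via h_i = M_i + 1 + j_i. *)
Definition box_bound n (H : 'I_n -> int) : nat := (\max_(i < n) `|H i|%N).+1.

Definition box_idx n (H : 'I_n -> int) : {set {ffun 'I_n -> 'I_(box_bound H)}} :=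
  [set j : {ffun 'I_n -> 'I_(box_bound H)} | [forall i, (j i)%:Z < H i]].

Definition box_pt n (M : 'I_n -> int) (H : 'I_n -> int)
  (j : {ffun 'I_n -> 'I_(box_bound H)}) : 'I_n -> int :=
  fun i => M i + (j i)%:Z + 1.

Definition box_card n (H : 'I_n -> int) : nat := #|box_idx H|.

Definition char_exp_sum n (chi : 'I_n -> int -> RR[i]) (F : mpoly.mpoly n RR)
  (M H : 'I_n -> int) : RR[i] :=
  \sum_(j in box_idx H)
     (\prod_(i < n) chi i (box_pt M j i)) *
     e_ (mpoly.meval (fun i => (box_pt M j i)%:~R) F).

(* Main.v *)
(* Burgess's method in the style of Kerr. Put k = r - D and V ~ q^(1/(2k)), and
   average the sum over the shifts x -> x + u v with v <= V and u_i <= H_i / V.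
   In the variable v the phase F(x + u v) is a polynomial of degree d; rounding
   its j-th coefficient to the grid Z / (r V^j) changes it by a phase of bounded
   variation, which is absorbed by Fourier completion modulo V, because adding a
   multiple of 1/V to the linear coefficient preserves the grid. The inner sums
   depend on x and u only through the residues x_i / u_i mod q_i; Hölder's
   inequality, the second moment of the number of representations of a residue
   and the 2r-th moment of the inner sums finish the proof. In that moment the
   sum over the grid detects exactly the Vinogradov system of size V. A solution
   in which some value occurs exactly once leads to complete character sums,
   estimated by the Weil bound; the other solutions number at most r^(2r) V^r.

   The Weil bound is needed only for rational functions with a simple zero at a
   point outside their other zeros and poles. For these the L-function of the
   sum is a polynomial by a direct translation argument, and Newton's identities
   turn the bounds for the power sums of its roots, which Stepanov's method gives
   over the extensions of even degree, into a bound for the roots. *)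

Require Import Defs.
From mathcomp Require Import all_boot all_order all_algebra all_field.
From mathcomp Require Import all_classical all_reals all_analysis.
From mathcomp Require Import Rstruct Rstruct_topology.
From mathcomp Require Import complex.
From mathcomp Require mpoly.
From mathcomp Require Import ring lra zify.
Set Implicit Arguments. Unset Strict Implicit. Unset Printing Implicit Defensive.
Import Order.TTheory GRing.Theory Num.Theory.
Local Open Scope ring_scope.

(** * Stepanov's method *)

(** The coefficients of the phase along a shift depend on [x] and [u] themselves, while the
    characters see only residues, so the two cannot be counted together. The inner sum is therefore
    bounded uniformly over a fixed finite set of phases, the grid, and this maximum by a sum of
    2r-th powers over the whole grid. The price is the size r^d V^D of the grid; it is recovered
    because the Vinogradov system has about V^(2r-D) solutions. The factor r in the mesh 1/(r V^j)
    turns a congruence between two sums of r j-th powers into an equality. After multiplication by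
    V^D, the solutions with a unique value contribute V^(2r) q^(1/2) and the others V^(D+r) q; these
    agree when V^(r-D) = q^(1/2), which dictates V. The averaging over shifts is exact: the base
    point x runs over a range twice as long as the side of the box, and only the v with x + u v in
    the box are kept. These v form an interval, whose cut-off is absorbed together with the phase of
    bounded variation, so there are no boundary terms and no induction on the size of the box. *)

Lemma kernel_vector (K : fieldType) (I J : finType) (a : I -> J -> K) :
  (#|J| < #|I|)%N ->
  exists v : I -> K, (exists i, v i != 0) /\
    forall j, \sum_i v i * a i j = 0.
Proof.
move=> ltJI.
pose A := \matrix_(i < #|I|, j < #|J|) a (enum_val i) (enum_val j).
have kA : kermx A != 0.
  rewrite kermx_eq0 /row_free neq_ltn (leq_ltn_trans (rank_leq_col A)) //.
have [i0 ri0] : exists i, row i (kermx A) != 0.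
  apply/existsP; apply: contraNT kA; rewrite negb_exists => /forallP h.
  by apply/eqP/row_matrixP => i; rewrite row0; apply/eqP/negPn/h.
pose w := row i0 (kermx A).
have wA : w *m A = 0 by rewrite /w -row_mul mulmx_ker row0.
exists (fun i => w 0 (enum_rank i)); split.
  have [j wj] : exists j, w 0 j != 0.
    apply/existsP; apply: contraNT ri0; rewrite negb_exists => /forallP h.
    by apply/eqP/rowP => j; rewrite [RHS]mxE; apply/eqP/negPn/h.
  by exists (enum_val j); rewrite enum_valK.
move=> j; have /matrixP/(_ 0 (enum_rank j)) := wA.
rewrite !mxE => wAj; apply: etrans wAj.
transitivity (\sum_(i in I) w 0 (enum_rank i) * a i j); first exact: eq_bigl.
rewrite big_enum_val /=.
by apply: eq_bigr => i _; rewrite !mxE enum_valK enum_rankK.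
Qed.

Lemma nderivnM (R : comNzRingType) (p q : {poly R}) n :
  (p * q)^`N(n) = \sum_(i < n.+1) p^`N(i) * q^`N(n - i).
Proof.
have XM a b : ('X^a * 'X^b : {poly R})^`N(n) =
    \sum_(i < n.+1) ('X^a)^`N(i) * ('X^b)^`N(n - i).
  rewrite -exprD nderivnXn -(binomial.Vandermonde a b n) -sumrMnr.
  apply: eq_bigr => i _; rewrite !nderivnXn mulrnAl mulrnAr -mulrnA -exprD.
  have [la|la] := ltnP a i; first by rewrite (bin_small la) !mul0n !mulr0n ?muln0.
  have [lb|lb] := ltnP b (n - i); first by rewrite (bin_small lb) ?muln0 ?mul0n !mulr0n.
  by rewrite mulnC; congr ('X^_ *+ _); have := ltn_ord i; lia.
have XpM a (r : {poly R}) : ('X^a * r)^`N(n) =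
    \sum_(i < n.+1) ('X^a)^`N(i) * r^`N(n - i).
  rewrite -[r]coefK poly_def mulr_sumr linear_sum /=.
  under [RHS]eq_bigr do rewrite linear_sum mulr_sumr.
  rewrite exchange_big /=; apply: eq_bigr => j _.
  rewrite -scalerAr linearZ /= XM scaler_sumr; apply: eq_bigr => i _.
  by rewrite linearZ /= scalerAr.
rewrite -[p]coefK poly_def mulr_suml linear_sum /=.
under [RHS]eq_bigr do rewrite linear_sum mulr_suml.
rewrite exchange_big /=; apply: eq_bigr => j _.
rewrite -scalerAl linearZ /= XpM scaler_sumr; apply: eq_bigr => i _.
by rewrite linearZ /= scalerAl.
Qed.

Lemma dvdp_sum (K : fieldType) (I : Type) (r : seq I) (P : pred I)
    (d : {poly K}) (G : I -> {poly K}) :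
  (forall i, P i -> d %| G i) -> d %| \sum_(i <- r | P i) G i.
Proof.
move=> dG; apply: (big_ind (fun u => d %| u)) => // u v du dv.
exact: dvdp_add.
Qed.

Lemma dvdp_exp_nderivn (K : fieldType) (F k : {poly K}) t h :
  F ^+ (t - h) %| (F ^+ t * k)^`N(h).
Proof.
elim: t h => [|t IHt] h; first by rewrite sub0n expr0 dvd1p.
rewrite exprS -mulrA nderivnM; apply: dvdp_sum => i _.
have [->|i0] := posnP i; rewrite ?subn0.
  rewrite nderivn0; have [lth|lth] := leqP h t.
    by rewrite subSn // exprS dvdp_mul.
  have -> : (t.+1 - h = 0)%N by lia.
  by rewrite expr0 dvd1p.
apply/dvdp_mull/(dvdp_trans _ (IHt _))/dvdp_exp2l.
by have := ltn_ord i; lia.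
Qed.

(** Taylor's formula at [x] with Hasse derivatives, valid in every characteristic. Ordinary
    derivatives of order at least p vanish identically in characteristic p, and the orders used
    below go up to p ^ n. *)
Lemma root_nderivn_dvd (K : fieldType) (p : {poly K}) x m :
  (forall h, (h < m)%N -> root p^`N(h) x) -> ('X - x%:P) ^+ m %| p.
Proof.
move=> hroot.
pose q := p^:P.
have -> : p = \sum_(i < size p) (p^`N(i).[x])%:P * ('X - x%:P) ^+ i.
  have := @nderiv_taylor _ q x%:P ('X - x%:P) (mulrC _ _).
  rewrite addrC subrK -/(p \Po 'X) comp_polyXr /q size_map_polyC => {1}->.
  by apply: eq_bigr => i _; rewrite nderivn_map /= horner_map.
apply: dvdp_sum => i _.
have [lim|lim] := ltnP i m; first by rewrite (eqP (hroot _ lim)) polyC0 mul0r dvdp0.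
by apply/dvdp_mull/dvdp_exp2l.
Qed.

Lemma prod_XsubC_exp_dvd (K : fieldType) (A : seq K) m (R : {poly K}) :
  uniq A -> (forall x, x \in A -> ('X - x%:P) ^+ m %| R) ->
  \prod_(x <- A) ('X - x%:P) ^+ m %| R.
Proof.
elim: A => [|x A IHA] /=; first by rewrite big_nil dvd1p.
move=> /andP[xA uA] dR; rewrite big_cons Gauss_dvdp; last first.
  rewrite big_seq; apply: (big_ind (fun u => coprimep (('X - x%:P) ^+ m) u)).
  - exact: coprimep1.
  - by move=> u v cu cv; rewrite coprimepMr cu cv.
  move=> y yA; apply/coprimep_expl/coprimep_expr.
  by rewrite coprimep_XsubC root_XsubC; apply: contraNneq xA => <-.
rewrite dR ?mem_head //= IHA // => y yA.
by apply: dR; rewrite inE yA orbT.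
Qed.

Lemma size_prod_XsubC_exp (K : fieldType) (A : seq K) m :
  size (\prod_(x <- A) ('X - x%:P) ^+ m) = (size A * m).+1.
Proof.
elim: A => [|x A IHA]; first by rewrite big_nil size_poly1.
rewrite big_cons size_monicM ?monic_exp ?monicXsubC //; last first.
  by rewrite -size_poly_eq0 IHA.
by rewrite IHA size_exp_XsubC /=; lia.
Qed.

Lemma XsubC_exp_pchar (K : fieldType) (p N : nat) (x : K) : p \in [pchar K] ->
  ('X - x%:P) ^+ (p ^ N) = 'X^(p ^ N) - (x ^+ (p ^ N))%:P.
Proof.
move=> cK; have cP : p \in [pchar {poly K}] by rewrite pchar_poly.
have nQ : [pchar {poly K}].-nat (p ^ N)%N.
  rewrite pnatX; apply/orP; left.
  by rewrite pnatE ?(pcharf_prime cK).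
by rewrite exprDn_pchar // exprNn_pchar // -rmorphXn.
Qed.

Section Stepanov.
Variables (K : fieldType) (p : nat).
Hypothesis charK : p \in [pchar K].
Variables (N : nat) (F0 : {poly K}) (e b M J s : nat) (A : seq K) (z : K).
Let Q := (p ^ N)%N.
Let F := 'X * F0.
Let dF := size F0.
Hypothesis F00 : F0.[0] != 0.
Hypothesis be : (b * e = Q.-1)%N.
Hypothesis sb : (s <= b)%N.
Hypothesis MQ : (M <= Q)%N.
(** Conditions against unknowns: each of the [M] Hasse derivatives becomes a polynomial with at most
    [s + M * dF + J] coefficients, and the unknowns are indexed by e x J x s. *)
Hypothesis count : (M * (s + M * dF + J) < e * J * s)%N.
Hypothesis uA : uniq A.
Hypothesis AP : forall x, x \in A -> x ^+ Q = x /\ F.[x] ^+ b = z.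

Let F0n0 : F0 != 0.
Proof. by apply: contraNneq F00 => ->; rewrite horner0. Qed.

Let Fn0 : F != 0. Proof. by rewrite /F mulf_neq0 ?polyX_eq0. Qed.

Let sF : size F = dF.+1. Proof. by rewrite /F mulrC size_mulX. Qed.

Let sFX T t : size (F ^+ T * 'X^t) = (T * dF + t).+1.
Proof.
rewrite size_Mmonic ?monicXn ?expf_neq0 // size_polyXn.
by rewrite addnS /= polySpred ?expf_neq0 // size_exp sF /= mulnC addSn.
Qed.

(** Dividing out the power of [F] is what makes the method work: the size of the quotient is bounded
    by [M * dF + s], independently of [i], whereas the derivative itself has degree of order
    [i * b * dF]. Here [dF] is the degree of [F]. *)
Let g (i h t : nat) := (F ^+ (i * b + M) * 'X^t)^`N(h) %/ F ^+ (i * b + M - h).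

Let gE i h t : (F ^+ (i * b + M) * 'X^t)^`N(h) = g i h t * F ^+ (i * b + M - h).
Proof. by rewrite divpK // dvdp_exp_nderivn. Qed.

Let sg i h t : (h < M)%N -> (t < s)%N -> (size (g i h t) <= M * dF + s)%N.
Proof.
move=> hM ts; rewrite size_divp ?expf_neq0 // size_exp sF /=.
rewrite leq_subLR (leq_trans (size_poly _ _)) // sFX.
apply: (leq_trans (leq_subr _ _)).
have : ((i * b + M) * dF <= dF * (i * b + M - h) + M * dF)%N by nia.
lia.
Qed.

Let I := ('I_e * 'I_J * 'I_s)%type.

Let pw (i : I) := (i.2 + i.1.1 * b + Q * i.1.2)%N.

Let be_lt : (b * e < Q)%N.
Proof. by rewrite be ltn_predL expn_gt0 prime_gt0 ?(pcharf_prime charK). Qed.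

(** A mixed radix expansion: the lowest digit is below [s <= b], and the two lower digits together
    stay below [b * e < Q]. *)
Let pw_inj i j : pw i = pw j -> i = j.
Proof.
move: i j => [[i l] t] [[i' l'] t']; rewrite /pw /=.
have Hi := ltn_ord i; have Hi' := ltn_ord i'.
have Ht := ltn_ord t; have Ht' := ltn_ord t'.
have e0 : (0 < e)%N := leq_ltn_trans (leq0n _) Hi.
have bQ := be_lt.
have tb : (t < b)%N := leq_trans Ht sb.
have tb' : (t' < b)%N := leq_trans Ht' sb.
have li : (i * b + t < Q)%N by apply: leq_ltn_trans bQ; nia.
have li' : (i' * b + t' < Q)%N by apply: leq_ltn_trans bQ; nia.
rewrite ![(_ + Q * _)%N]addnC ![(_ + _ * b)%N]addnC ![(Q * _)%N]mulnC => E.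
have El : l = l' :> nat.
  have : ((l * Q + (i * b + t)) %/ Q = (l' * Q + (i' * b + t')) %/ Q)%N by rewrite E.
  have Q0 : (0 < Q)%N by case: (Q) bQ.
  by rewrite !divnMDl // !divn_small ?addn0.
have {}E : (i * b + t = i' * b + t')%N by move: E; rewrite El => /addnI.
have Ei : i = i' :> nat.
  have : ((i * b + t) %/ b = (i' * b + t') %/ b)%N by rewrite E.
  have b0 : (0 < b)%N by case: (b) tb.
  by rewrite !divnMDl // !divn_small ?addn0.
have Et : t = t' :> nat by move: E; rewrite Ei => /addnI.
by congr (_, _, _); apply: val_inj.
Qed.

(* The auxiliary polynomial [R = F ^+ M * R1] vanishes to order [M] on [A]: for
   [x] in [A], replacing ['X^Q] by [x] and [F ^+ b] by [z] in its Hasse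
   derivatives is exact at [x], which leaves few linear conditions on [v]. It is
   nonzero since the exponents [pw i] are distinct and [F0] does not vanish at 0. *)
Lemma stepanov_bound : (size A * M <= Q * J + dF * (Q + M))%N.
Proof.
pose a (i : I) (j : 'I_M * 'I_(s + M * dF + J)) : K :=
  (z ^+ i.1.1 *: ('X^(i.1.2) * g i.1.1 j.1 i.2))`_(j.2).
have [|v [[i0 vi0] va]] := @kernel_vector K I _ a.
  by rewrite !card_prod !card_ord.
have e0 : (0 < e)%N := leq_ltn_trans (leq0n _) (ltn_ord i0.1.1).
pose R := \sum_(i : I) v i *: ('X^(i.2 + Q * i.1.2) * F ^+ (i.1.1 * b + M)).
pose R1 := \sum_(i : I) v i *: ('X^(pw i) * F0 ^+ (i.1.1 * b)).
have RE : R = F ^+ M * R1.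
  rewrite mulr_sumr; apply: eq_bigr => i _; rewrite -scalerAr; congr (_ *: _).
  have -> : F ^+ (i.1.1 * b + M) = 'X^(i.1.1 * b) * F0 ^+ (i.1.1 * b) * F ^+ M.
    by rewrite exprD -exprMn.
  by rewrite /pw !exprD; ring.
have R1n0 : R1 != 0.
  case: (@arg_minnP _ i0 (fun i => v i != 0) pw vi0) => i vi imin.
  apply: contraNneq vi => /(congr1 (fun q : {poly K} => q`_(pw i))).
  rewrite coef0 coef_sum (bigD1 i) //= big1 => [|j ji]; last first.
    rewrite coefZ coefXnM; case: ltngtP => [|lt_ji|/pw_inj E].
    - by rewrite mulr0.
    - have [->|vj] := eqVneq (v j) 0; first by rewrite mul0r.
      by have := imin j vj; rewrite leqNgt lt_ji.
    by rewrite E eqxx in ji.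
  rewrite addr0 coefZ coefXnM ltnn subnn -horner_coef0 horner_exp => /eqP.
  by rewrite mulf_eq0 expf_eq0 (negPf F00) andbF orbF.
have Rn0 : R != 0 by rewrite RE mulf_neq0 ?expf_neq0.
have dR x : x \in A -> ('X - x%:P) ^+ M %| R.
  move=> /AP[xQ Fxb].
  pose Rx := \sum_(i : I) (v i * x ^+ i.1.2) *: (F ^+ (i.1.1 * b + M) * 'X^(i.2)).
  have -> : R = Rx + (R - Rx) by rewrite addrC subrK.
  apply: dvdp_add; last first.
    rewrite -sumrB; apply: dvdp_sum => i _.
    have [->|vi] := eqVneq (v i) 0; first by rewrite mul0r !scale0r subrr dvdp0.
    rewrite -scalerA -scalerBr dvdpZr //.
    have -> : 'X^(i.2 + Q * i.1.2) * F ^+ (i.1.1 * b + M)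
              - x ^+ i.1.2 *: (F ^+ (i.1.1 * b + M) * 'X^(i.2))
            = ('X^Q ^+ i.1.2 - x%:P ^+ i.1.2) * (F ^+ (i.1.1 * b + M) * 'X^(i.2)).
      by rewrite exprD exprM -mul_polyC rmorphXn; ring.
    (* Replacing ['X^Q] by [x] costs a multiple of ['X^Q - x], which is the [Q]-th power of ['X - x]
       because x ^+ Q = x; and M <= Q. *)
    apply: dvdp_mulr; rewrite subrXX; apply: dvdp_mulr.
    rewrite -{2}xQ -XsubC_exp_pchar //; exact: dvdp_exp2l.
  apply: root_nderivn_dvd => h hM; apply/rootP.
  rewrite linear_sum horner_sum.
  transitivity (F.[x] ^+ (M - h) *
    (\sum_(i : I) v i *: (z ^+ i.1.1 *: ('X^(i.1.2) * g i.1.1 h i.2))).[x]).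
    rewrite horner_sum mulr_sumr; apply: eq_bigr => i _.
    have Fz : F.[x] ^+ (i.1.1 * b + M - h) = z ^+ i.1.1 * F.[x] ^+ (M - h).
      by rewrite -addnBA 1?ltnW // exprD mulnC exprM Fxb.
    rewrite linearZ /= gE 3!hornerZ (hornerM (g _ _ _)) (hornerM 'X^_).
    by rewrite hornerXn horner_exp Fz; ring.
  suff -> : \sum_(i : I) v i *: (z ^+ i.1.1 *: ('X^(i.1.2) * g i.1.1 h i.2)) = 0.
    by rewrite horner0 mulr0.
  apply/polyP => c; rewrite coef0 coef_sum.
  have [cB|cB] := ltnP c (s + M * dF + J).
    rewrite -[RHS](va (Ordinal hM, Ordinal cB)); apply: eq_bigr => i _.
    by rewrite coefZ.
  rewrite big1 // => i _; rewrite 2!coefZ coefXnM; case: ltnP => _; first by rewrite !mulr0.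
  have -> : (g i.1.1 h i.2)`_(c - i.1.2) = 0; last by rewrite !mulr0.
  apply: nth_default; apply: leq_trans (sg _ hM (ltn_ord _)) _.
  by have := ltn_ord i.1.2; lia.
have sR : (size R <= (Q * J + dF * (Q + M)).+1)%N.
  apply: leq_trans (size_sum _ _ _) _; apply/bigmax_leqP => i _.
  apply: leq_trans (size_scale_leq _ _) _; rewrite mulrC sFX ltnS.
  have Hi := ltn_ord i.1.1; have Hl := ltn_ord i.1.2; have Ht := ltn_ord i.2.
  have h1 : (i.1.1 * b <= Q)%N by apply: leq_trans (ltnW be_lt); nia.
  have h2 : (i.2 < Q)%N.
    by apply: leq_trans (leq_trans Ht sb) (leq_trans _ (ltnW be_lt)); nia.
  have h3 : (i.2 + Q * i.1.2 <= Q * J)%N by nia.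
  have h4 : ((i.1.1 * b + M) * dF <= dF * (Q + M))%N by rewrite mulnC leq_mul2l leq_add2r h1 orbT.
  by rewrite addnC leq_add.
have := dvdp_leq Rn0 (prod_XsubC_exp_dvd uA dR).
rewrite size_prod_XsubC_exp => /leq_trans lR.
by have := lR _ sR; rewrite ltnS.
Qed.
End Stepanov.

(** The exponent [n + n] makes M = p ^ n an exact square root of the order Q of the field. Vanishing
    to order M with [s = b] gives the main term Q / e; in the error, 3 d + 3 collects d + 3 from [J]
    and 2 d from [dF * (Q + M)]. *)
Lemma stepanov_count (K : fieldType) (p n e b : nat) (F0 : {poly K}) (A : seq K) (z : K) :
  p \in [pchar K] -> F0.[0] != 0 -> (0 < e)%N -> (b * e = (p ^ (n + n)).-1)%N ->
  (2 * size F0 + 7 <= p ^ n)%N -> uniq A ->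
  (forall x, x \in A -> x ^+ (p ^ (n + n)) = x /\ ('X * F0).[x] ^+ b = z) ->
  (e * size A <= p ^ (n + n) + e * (3 * size F0 + 3) * p ^ n)%N.
Proof.
move=> cK F00 e0 be Mbig uA AP.
set d := size F0 in Mbig *; set M := (p ^ n)%N in Mbig *.
have QM : (p ^ (n + n) = M * M)%N by rewrite expnD.
have M0 : (0 < M)%N by lia.
(* The part [M %/ e] balances the leading terms [M * b] and [e * J * b], and d pays for
   [M * (M * d)]. Each unit of the 3 is worth about M^2: one for the rounding in [M %/ e], one for
   [M * (M %/ e)], one for the lower order terms, where [2 * d + 7 <= M] enters. *)
pose J := (M %/ e + (d + 3))%N.
have eJ : (M < e * (M %/ e) + e)%N.
  by have := ltn_ceil M e0; rewrite mulnC mulnS addnC.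
have eJ' : (e * (M %/ e) <= M)%N by rewrite mulnC leq_trunc_div.
have Je : (M %/ e <= M)%N by rewrite leq_div.
have cnt : (M * (b + M * d + J) < e * J * b)%N.
  have eb : (b * e + 1 = M * M)%N by rewrite be QM addn1 prednK // muln_gt0 M0.
  rewrite /J; set m := (M %/ e)%N in eJ eJ' Je *.
  have h1 : (M * b <= e * m * b + e * b)%N by nia.
  have h2 : (e * (d + 3) * b + (d + 3) = (d + 3) * (M * M))%N by rewrite -eb; ring.
  have h3 : (M * (m + (d + 3)) <=
    M * M + M * (d + 3))%N by rewrite mulnDr leq_add2r leq_mul2l Je orbT.
  have h4 : (e * b < M * M)%N by rewrite -eb mulnC addn1.
  have h5 : (M * (d + 3) + (d + 3) < M * M)%N by nia.
  rewrite !mulnDr !mulnDl.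
  have : (e * (d + 3) * b = e * d * b + e * 3 * b)%N by ring.
  nia.
have := @stepanov_bound K p cK (n + n) F0 e b M J b A z F00 be (leqnn b) => bnd.
have MQ : (M <= p ^ (n + n))%N by rewrite QM leq_pmulr.
have := bnd MQ cnt uA AP; rewrite QM -/d.
rewrite /J => H.
rewrite -(leq_pmul2l M0).
have H1 : (e * (size A * M) <= e * (M * M * (M %/ e + (d + 3)) + d * (M * M + M)))%N.
  by rewrite leq_mul2l H orbT.
have -> : (M * (e * size A) = e * (size A * M))%N by ring.
apply: leq_trans H1 _; set m := (M %/ e)%N.
have -> : (e * (M * M * (m + (d + 3)) + d * (M * M + M)) = M * M * (e * m) +
  (e * (d + 3) * (M * M) + e * d * (M * M) + e * d * M))%N by ring.
have -> : (M * (M * M + e * (3 * d + 3) * M) = M * M * M +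
  (e * (d + 3) * (M * M) + e * d * (M * M) + e * d * (M * M)))%N by ring.
by do !apply: leq_add => //; rewrite leq_mul2l ?eJ' ?leq_pmulr ?orbT.
Qed.

(** * The fields of p^k elements inside an algebraic closure, and descent to F_p *)

Section ClosureOfFp.
Variables (p : nat).
Hypothesis pr_p : prime p.
Local Notation F := 'F_p.
Variables (K : closedFieldType) (iota : {rmorphism F -> K}).

Let charF : p \in [pchar F] := pchar_Fp pr_p.

Lemma pchar_closure : p \in [pchar K].
Proof. by rewrite (fmorph_pchar iota). Qed.
Let charK := pchar_closure.
Let p_gt1 := prime_gt1 pr_p.

Lemma exp_pow_pcharD N : {morph (fun x : K => x ^+ (p ^ N)) : x y / x + y}.
Proof.
move=> x y; rewrite exprDn_pchar // pnatX pnatE ?(pcharf_prime charK) //.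
by rewrite charK.
Qed.

Lemma frob_inj N : injective (fun x : K => x ^+ (p ^ N)).
Proof.
move=> x y /= E; apply/eqP; rewrite -subr_eq0.
have : (x - y) ^+ (p ^ N) == 0.
  have := exp_pow_pcharD N (x - y) y; rewrite /= subrK E => /eqP.
  by rewrite -subr_eq0 opprD addrCA subrr addr0 oppr_eq0.
by rewrite expf_eq0 => /andP[].
Qed.

Definition fqpoly k : {poly K} := 'X^(p ^ k) - 'X.
Definition fq k : seq K := projT1 (closed_field_poly_normal (fqpoly k)).

Let pk_gt1 k : (0 < k)%N -> (1 < p ^ k)%N.
Proof. by move=> k0; rewrite -[1%N](expn0 p) ltn_exp2l. Qed.

Lemma size_fqpoly k : (0 < k)%N -> size (fqpoly k) = (p ^ k).+1.
Proof.
move=> /pk_gt1 k0; rewrite size_polyDl size_polyXn // size_polyN size_polyX.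
by rewrite ltnS.
Qed.

Lemma fqpolyE k : (0 < k)%N -> fqpoly k = \prod_(x <- fq k) ('X - x%:P).
Proof.
move=> k0; rewrite /fq; case: (closed_field_poly_normal _) => r /= {1}->.
suff -> : lead_coef (fqpoly k) = 1 by rewrite scale1r.
rewrite lead_coefE size_fqpoly //= coefB coefXn eqxx coefX.
by rewrite gtn_eqF ?subr0 ?pk_gt1.
Qed.

Lemma size_fq k : (0 < k)%N -> size (fq k) = (p ^ k)%N.
Proof.
by move=> k0; apply: succn_inj; rewrite -size_fqpoly // fqpolyE // size_prod_XsubC.
Qed.

Lemma mem_fq k x : (0 < k)%N -> (x \in fq k) = (x ^+ (p ^ k) == x).
Proof.
move=> k0; rewrite -root_prod_XsubC -fqpolyE // rootE !hornerE.
by rewrite subr_eq0.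
Qed.

Lemma uniq_fq k : (0 < k)%N -> uniq (fq k).
Proof.
move=> k0; rewrite -separable_prod_XsubC -fqpolyE // separable_poly.unlock.
rewrite derivB derivX derivXn.
have -> : 'X^((p ^ k).-1) *+ (p ^ k) = 0 :> {poly K}.
  by rewrite -mulr_natr -polyC_natr natrX (pcharf0 charK) expr0n eqn0Ngt k0 polyC0 mulr0.
by rewrite sub0r -scaleN1r coprimepZr ?oppr_eq0 ?oner_eq0 // coprimep1.
Qed.

(** A left inverse of [iota]. Its default 0 does not matter: the lemmas on [dpoly] apply it to
    coefficients fixed by Frobenius, which lie in the image of [iota]. *)
Definition desc (y : K) : F := if [pick a | iota a == y] is Some a then a else 0.

Lemma iotaK : cancel iota desc.
Proof.
move=> a; rewrite /desc; case: pickP => [b /eqP/fmorph_inj //|/(_ a)].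
by rewrite eqxx.
Qed.

Lemma fix_frobP x : x ^+ p = x -> exists a, iota a = x.
Proof.
move=> xp; have : root (map_poly iota ('X^#|F| - 'X)) x.
  by rewrite rootE rmorphB /= map_polyXn map_polyX !hornerE card_Fp // xp subrr.
rewrite finField_genPoly rmorph_prod /= => rx.
have : root (\prod_(a <- [seq iota a | a <- enum F]) ('X - a%:P)) x.
  rewrite big_map big_enum /=; apply: etrans rx; congr (root _ _).
  by apply: eq_bigr => a _; rewrite rmorphB /= map_polyX map_polyC.
by rewrite root_prod_XsubC => /mapP[a _ ->]; exists a.
Qed.

Definition dpoly (P : {poly K}) : {poly F} := map_poly desc P.

Lemma map_dpoly (P : {poly K}) : (forall i, P`_i ^+ p = P`_i) ->
  map_poly iota (dpoly P) = P.
Proof.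
have d0 : desc 0 = 0 by rewrite -(rmorph0 iota) iotaK.
move=> Pi; apply/polyP => i; rewrite coef_map /= /dpoly coef_map_id0 //.
by have [a <-] := fix_frobP (Pi i); rewrite iotaK.
Qed.

(** For [x] in the field of p^k elements this is its characteristic polynomial over F_p, a power of
    the minimal polynomial; its value at [c] is the norm of [c - x]. *)
Definition conjpoly k (x : K) : {poly K} := \prod_(i < k) ('X - (x ^+ (p ^ i))%:P).

Lemma size_conjpoly k x : size (conjpoly k x) = k.+1.
Proof.
rewrite /conjpoly -(big_map (fun i : 'I_k => x ^+ (p ^ i)) xpredT (fun y => 'X - y%:P)).
by rewrite size_prod_XsubC size_map [index_enum _]unlock -enumT size_enum_ord.
Qed.

Lemma monic_conjpoly k x : conjpoly k x \is monic.
Proof. by apply: monic_prod => i _; apply: monicXsubC. Qed.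

Lemma conjpoly_frob k x : (0 < k)%N -> x ^+ (p ^ k) = x ->
  conjpoly k (x ^+ p) = conjpoly k x.
Proof.
case: k => // k _ xk; rewrite /conjpoly big_ord_recr [RHS]big_ord_recl mulrC /=.
rewrite -exprM -expnS xk expn0 expr1; congr (_ * _).
by apply: eq_bigr => i _; rewrite -exprM -expnS.
Qed.

Lemma conjpoly_coef k x i : (0 < k)%N -> x ^+ (p ^ k) = x ->
  (conjpoly k x)`_i ^+ p = (conjpoly k x)`_i.
Proof.
move=> k0 xk.
rewrite -[RHS](congr1 (fun q : {poly K} => q`_i) (conjpoly_frob k0 xk)).
rewrite -(pFrobenius_autE charK) -coef_map /= /conjpoly rmorph_prod.
congr (_`_i); rewrite (eq_bigr (fun j : 'I_k => 'X - (x ^+ p ^+ (p ^ j))%:P)) // => j _.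
by rewrite rmorphB /= map_polyX map_polyC /= pFrobenius_autE -!exprM mulnC.
Qed.

Lemma map_dpoly_conjpoly k x : (0 < k)%N -> x ^+ (p ^ k) = x ->
  map_poly iota (dpoly (conjpoly k x)) = conjpoly k x.
Proof. by move=> k0 xk; apply: map_dpoly => i; apply: conjpoly_coef. Qed.
End ClosureOfFp.

(** * The Weil bound *)

Lemma sum_multiples d m n : (0 < d)%N -> (m * d <= n)%N ->
  (\sum_(k < n) ((d %| k.+1) && (k.+1 %/ d <= m)) = m)%N.
Proof.
move=> d0 mdn; suff -> : (\sum_(k < n) ((d %| k.+1) && (k.+1 %/ d <= m)) = minn m (n %/ d))%N.
  by apply/minn_idPl; rewrite leq_divRL.
elim: n {mdn} => [|n IHn]; first by rewrite big_ord0 div0n minn0.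
rewrite big_ord_recr /= IHn divnS //; case: (d %| n.+1)%N => /=; last by rewrite addn0.
by case: leqP; lia.
Qed.

Lemma sum_count_undup (T : eqType) (r : seq T) :
  (\sum_(x <- undup r) count_mem x r = size r)%N.
Proof.
transitivity (\sum_(y <- r) \sum_(x <- undup r) (y == x : nat))%N.
  rewrite exchange_big; apply: eq_bigr => x _.
  by rewrite -sum1_count big_mkcond; apply: eq_bigr => y _; rewrite /=; case: eqP.
rewrite -sum1_size !big_seq; apply: eq_bigr => y yr.
transitivity (count_mem y (undup r)).
  rewrite -sum1_count [RHS]big_mkcond; apply: eq_bigr => x _.
  by rewrite /= eq_sym; case: eqP.
by rewrite count_uniq_mem ?undup_uniq // mem_undup yr.
Qed.

Section NewtonIdentity.
Variables (p : nat).
Hypothesis pr_p : prime p.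
Local Notation F := 'F_p.
Variables (K : closedFieldType) (iota : {rmorphism F -> K}).
Let charK := pchar_closure pr_p iota.

Local Notation conjpoly := (@conjpoly p K).
Local Notation dpoly := (dpoly iota).

Lemma conjpolyD k l x : conjpoly (k + l) x = conjpoly k x * conjpoly l (x ^+ (p ^ k)).
Proof.
rewrite /conjpoly big_split_ord; congr (_ * _).
by apply: eq_bigr => i _ /=; rewrite -exprM expnD.
Qed.

Lemma conjpoly_mul j d x : x ^+ (p ^ d) = x -> conjpoly (j * d) x = conjpoly d x ^+ j.
Proof.
move=> xd; elim: j => [|j IHj]; first by rewrite mul0n /conjpoly big_ord0 expr0.
by rewrite mulSn conjpolyD xd IHj exprS.
Qed.

Lemma root_conjpoly k x : (0 < k)%N -> root (conjpoly k x) x.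
Proof.
by case: k => // k _; rewrite /conjpoly big_ord_recl expn0 expr1 rootM root_XsubC eqxx.
Qed.

Lemma map_frob (g : {poly F}) :
  map_poly (pFrobenius_aut charK) (map_poly iota g) = map_poly iota g.
Proof.
apply/polyP => i; rewrite !coef_map /= pFrobenius_autE -rmorphXn /=.
by congr (iota _); rewrite -[in RHS](expf_card g`_i) card_Fp.
Qed.

Lemma dvd_frob (g : {poly F}) x j i :
  ('X - x%:P) ^+ j %| map_poly iota g ->
  ('X - (x ^+ (p ^ i))%:P) ^+ j %| map_poly iota g.
Proof.
move=> dx; elim: i => [|i IHi]; first by rewrite expn0 expr1.
rewrite -map_frob expnSr exprM.
have -> : ('X - (x ^+ (p ^ i) ^+ p)%:P) ^+ j =
   map_poly (pFrobenius_aut charK) (('X - (x ^+ (p ^ i))%:P) ^+ j).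
  by rewrite [RHS]rmorphXn /= rmorphB /= map_polyX map_polyC /= pFrobenius_autE.
by rewrite dvdp_map.
Qed.

(** Frobenius maps the finite set of roots of [g] to itself, so the orbit of [x] repeats;
    injectivity of Frobenius moves the repetition back to [x] itself. *)
Lemma root_periodic (g : {poly F}) x : g != 0 -> root (map_poly iota g) x ->
  exists d, (0 < d)%N /\ x ^+ (p ^ d) = x.
Proof.
move=> g0 rx; pose s := mkseq (fun i => x ^+ (p ^ i)) (size g).
have /uniqPn : ~~ uniq s.
  apply/negP => us; have /= := @max_poly_roots _ (map_poly iota g) s _ _ us.
  rewrite map_poly_eq0 g0 size_mkseq size_map_poly ltnn => /(_ isT) H.
  suff : false by []; apply: H.
  apply/allP => y /mapP[i _ ->]; rewrite -dvdp_XsubCl -[_ - _]expr1.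
  by apply: dvd_frob; rewrite expr1 dvdp_XsubCl.
move=> /(_ 0)[i [j [ij]]]; rewrite size_mkseq => jn.
rewrite !nth_mkseq ?(ltn_trans ij) // => E.
exists (j - i)%N; split; first by rewrite subn_gt0.
apply: (frob_inj pr_p iota (N := i)) => /=.
by rewrite -exprM -expnD subnK // ltnW.
Qed.

Lemma exp_pow_mod d k (x : K) : x ^+ (p ^ d) = x -> x ^+ (p ^ k) = x ^+ (p ^ (k %% d)).
Proof.
move=> xd; rewrite {1}(divn_eq k d); elim: (k %/ d)%N => [|j IHj].
  by rewrite mul0n add0n.
by rewrite mulSn -addnA expnD exprM xd IHj.
Qed.

Lemma count_conj_root (g : {poly F}) x n : size g = n.+1 ->
  root (map_poly iota g) x ->
  (\sum_(k < n) ((x ^+ (p ^ k.+1) == x)%R && (conjpoly k.+1 x %| map_poly iota g)%R))%N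
   = mup x (map_poly iota g).
Proof.
move=> sg rx; set G := map_poly iota g.
have g0 : g != 0 by rewrite -size_poly_eq0 sg.
have G0 : G != 0 by rewrite map_poly_eq0.
have exd : exists d, (0 < d)%N && (x ^+ (p ^ d) == x).
  by have [d [d0 xd]] := root_periodic g0 rx; exists d; rewrite d0 xd eqxx.
case: (ex_minnP exd) => d /andP[d0 /eqP xd] dmin.
have xk k : (x ^+ (p ^ k) == x) = (d %| k)%N.
  rewrite (exp_pow_mod k xd) /dvdn; apply/idP/idP => [E|/eqP->]; last by rewrite expn0.
  apply: contraTT (ltn_pmod k d0) => m0; rewrite -leqNgt dmin // lt0n m0 //.
have dG j : (conjpoly d x ^+ j %| G) = (j <= mup x G)%N.
  rewrite mup_geq //; apply/idP/idP => [|dj].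
    apply: dvdp_trans; apply: dvdp_exp2r.
    by rewrite dvdp_XsubCl root_conjpoly.
  rewrite /conjpoly -prodrXl -(big_map (fun i : 'I_d => x ^+ (p ^ i)) xpredT (fun y =>
    ('X - y%:P) ^+ j)).
  apply: prod_XsubC_exp_dvd => [|y /mapP[i _ ->]]; last exact: dvd_frob.
  rewrite map_inj_uniq ?index_enum_uniq // => a b.
  wlog ab : a b / (a <= b)%N.
    by move=> H E; have [/H->|/ltnW/H->] := leqP a b.
  move=> E; apply/val_inj/eqP; rewrite eqn_leq ab /= leqNgt.
  apply/negP => lt_ab.
  have := dmin (b - a)%N; rewrite subn_gt0 lt_ab /= leqNgt.
  rewrite (leq_ltn_trans (leq_subr _ _) (ltn_ord b)) => /(_ _)/notF; apply.
  apply/eqP/(frob_inj pr_p iota (N := a)) => /=.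
  by rewrite -exprM -expnD subnK // ltnW.
rewrite -[RHS](@sum_multiples d _ n) //.
  apply: eq_bigr => k _; rewrite xk; have [dk|//] := boolP (d %| k.+1)%N.
  by rewrite -{1}(divnK dk) conjpoly_mul // dG.
have : conjpoly d x ^+ mup x G %| G by rewrite dG.
move=> /(dvdp_leq G0); rewrite size_map_poly sg.
rewrite -(conjpoly_mul _ xd) size_conjpoly //.
Qed.

(* A root of [g] of multiplicity [mu] and degree [d] over F_p accounts for the
   pairs [(k, x)] with [k] in [d, 2 d, ..., mu d]. *)
Lemma count_conj (g : {poly F}) n : size g = n.+1 -> g \is monic ->
  (\sum_(k < n) \sum_(x <- fq p K k.+1 | (conjpoly k.+1 x %| map_poly iota g)%R) 1 = n)%N.
Proof.
move=> sg mg; set G := map_poly iota g.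
have [r Gr] := closed_field_poly_normal G.
have mG : G \is monic by rewrite map_monic.
rewrite (monicP mG) scale1r in Gr.
have sr : size r = n.
  by apply: succn_inj; rewrite -(size_prod_XsubC r id) -Gr size_map_poly sg.
transitivity (\sum_(k < n) \sum_(x <- undup r)
   ((x ^+ (p ^ k.+1) == x)%R && (conjpoly k.+1 x %| G)%R))%N.
  apply: eq_bigr => k _; rewrite -big_filter.
  transitivity (\sum_(x <- undup r | (x ^+ (p ^ k.+1) == x)%R && (conjpoly k.+1 x %| G)%R) 1)%N.
    rewrite -[RHS]big_filter; apply: perm_big; apply: uniq_perm.
    - by rewrite filter_uniq // uniq_fq // pr_p.
    - by rewrite filter_uniq // undup_uniq.
    move=> x; rewrite !mem_filter mem_fq // mem_undup andbC -andbA.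
    case: (x ^+ _ == x) => //=; case: (boolP (_ %| _)) => //= dx.
    apply/esym; rewrite -root_prod_XsubC -Gr -dvdp_XsubCl.
    by apply: dvdp_trans dx; rewrite dvdp_XsubCl root_conjpoly.
  by rewrite big_mkcond; apply: eq_bigr => x _; case: ifP.
rewrite exchange_big /= -[RHS]sr -sum_count_undup !big_seq.
apply: eq_bigr => x; rewrite mem_undup => xr.
rewrite count_conj_root // -?/G; last by rewrite Gr root_prod_XsubC.
by rewrite Gr mu_prod_XsubC.
Qed.
End NewtonIdentity.

(** * The L-function as a sum over monic polynomials *)

Section MonicSums.
Variables (F : finFieldType) (C : comNzRingType) (w : {poly F} -> C).
Hypothesis wM : {morph w : g h / g * h}.

Definition mon n (v : 'rV[F]_n) : {poly F} := 'X^n + rVpoly v.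

Lemma size_mon n (v : 'rV[F]_n) : size (mon v) = n.+1.
Proof. by rewrite size_polyDl size_polyXn // ltnS size_poly. Qed.

Lemma monic_mon n (v : 'rV[F]_n) : mon v \is monic.
Proof.
rewrite monicE lead_coefE size_mon /= coefD coefXn eqxx.
by rewrite nth_default ?addr0 // size_poly.
Qed.

Lemma mon_surj n (g : {poly F}) : g \is monic -> size g = n.+1 ->
  mon (poly_rV (g - 'X^n) : 'rV_n) = g.
Proof.
move=> mg sg; rewrite /mon poly_rV_K; first by rewrite addrC subrK.
apply/leq_sizeP => j; rewrite leq_eqVlt coefB coefXn => /orP[/eqP <-|nj].
  by move/monicP: mg; rewrite lead_coefE sg eqxx => /= ->; rewrite subrr.
by rewrite (nth_default _ (_ : size g <= j)%N) ?sg // gtn_eqF // subr0.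
Qed.

Lemma monK n (v : 'rV[F]_n) : poly_rV (mon v - 'X^n) = v.
Proof. by rewrite /mon addrC addKr rVpolyK. Qed.

(** The coefficient of T^n in the L-function of [w], the sum of w(g) T^(deg g) over all monic g. *)
Definition msum n : C := \sum_(v : 'rV[F]_n) w (mon v).

Lemma msum_dvd n k (h : {poly F}) : h \is monic -> size h = k.+1 -> (k <= n)%N ->
  \sum_(v : 'rV[F]_n | h %| mon v) w (mon v) = w h * msum (n - k).
Proof.
move=> mh sh kn; have h0 : h != 0 by apply: monic_neq0.
rewrite {1}/msum mulr_sumr.
pose to (u : 'rV[F]_(n - k)) : 'rV[F]_n := poly_rV (h * mon u - 'X^n).
pose from (v : 'rV[F]_n) : 'rV[F]_(n - k) := poly_rV (mon v %/ h - 'X^(n - k)).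
have toE u : mon (to u) = h * mon u.
  apply: mon_surj; first by rewrite monicMr ?monic_mon.
  by rewrite size_monicM ?monic_neq0 ?monic_mon // sh size_mon; lia.
rewrite (reindex_onto to from) => [|v hv].
  apply: eq_big => [u|u _]; last by rewrite toE wM.
  by rewrite toE dvdp_mulr //= /from toE mulKp // monK eqxx.
have E : mon v %/ h * h = mon v by rewrite divpK.
apply: etrans (monK v); congr poly_rV; congr (_ - _).
rewrite /from mon_surj; first by rewrite mulrC.
  by have := monic_mon v; rewrite -{1}E monicMr.
by rewrite size_divp // size_mon sh; lia.
Qed.
End MonicSums.

Section LSeries.
Variables (p : nat).
Hypothesis pr_p : prime p.
Local Notation F := 'F_p.
Variables (K : closedFieldType) (iota : {rmorphism F -> K}).
Variables (C : comNzRingType) (w : {poly F} -> C).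
Hypothesis wM : {morph w : g h / g * h}.

Definition point_sum k : C := \sum_(x <- fq p K k) w (dpoly iota (conjpoly p k x)).

(** The logarithmic derivative of the L-function, obtained without an Euler product: by [count_conj]
    every monic g of degree n has exactly n pairs (k, x) with [conjpoly p k x] dividing g, and for a
    fixed pair the cofactor runs over all monic polynomials of degree n - k. *)
Lemma msum_newton n :
  n%:R * msum w n = \sum_(k < n) point_sum k.+1 * msum w (n - k.+1).
Proof.
rewrite {1}/msum mulr_sumr.
transitivity (\sum_(v : 'rV[F]_n) \sum_(k < n)
   \sum_(x <- fq p K k.+1 | conjpoly p k.+1 x %| map_poly iota (mon v)) w (mon v)).
  apply: eq_bigr => v _.
  rewrite -{1}(count_conj pr_p iota (size_mon v) (monic_mon v)) natr_sum mulr_suml.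
  by apply: eq_bigr => k _; rewrite natr_sum mulr_suml; apply: eq_bigr => x _; rewrite mul1r.
rewrite exchange_big /=; apply: eq_bigr => k _.
under eq_bigr do rewrite big_mkcond.
rewrite exchange_big /= /point_sum mulr_suml !big_seq; apply: eq_bigr => x.
rewrite mem_fq // => /eqP xk.
have cE := map_dpoly_conjpoly pr_p iota (ltn0Sn k) xk.
rewrite -big_mkcond /= -(msum_dvd wM (n := n)).
- by apply: eq_bigl => v; rewrite -{1}cE dvdp_map.
- by rewrite -(map_monic iota) cE monic_conjpoly.
- by rewrite -(size_map_poly iota) cE size_conjpoly.
exact: ltn_ord.
Qed.
End LSeries.

(** * Power sums and the size of the inverse roots *)

Section PowerSums.
Variable C : numClosedFieldType.
Implicit Types (s : seq C) (c S : nat -> C).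

Definition rev_root_poly s : {poly C} := \prod_(a <- s) (1 - a *: 'X).

Lemma newton_power_sum s n :
  (\sum_(k < n) (\sum_(a <- s) a ^+ k.+1) * (rev_root_poly s)`_(n - k.+1)) =
  - (n%:R * (rev_root_poly s)`_n).
Proof.
elim: s n => [|a s IHs] n.
  rewrite big1 => [|k _]; last by rewrite big_nil mul0r.
  rewrite /rev_root_poly big_nil coef1; case: n => [|n]; rewrite ?mul0r ?mulr0 ?oppr0 //.
set P := rev_root_poly s in IHs *.
have cE j : (rev_root_poly (a :: s))`_j = P`_j - a * (if j is j'.+1 then P`_j' else 0).
  rewrite /rev_root_poly big_cons -/P mulrBl mul1r coefB -scalerAl coefZ coefXM.
  by case: j.
case: n => [|n]; first by rewrite big_ord0 mul0r oppr0.
transitivity (\sum_(k < n.+1) ((\sum_(b <- s) b ^+ k.+1) * P`_(n.+1 - k.+1))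
  - a * (\sum_(k < n) ((\sum_(b <- s) b ^+ k.+1) * P`_(n - k.+1)))
  + \sum_(k < n.+1) a ^+ k.+1 * (rev_root_poly (a :: s))`_(n.+1 - k.+1)).
  rewrite mulr_sumr [X in _ - X + _](_ : _ = \sum_(k < n.+1) a * ((\sum_(b <- s) b ^+ k.+1)
    * (if (n.+1 - k.+1)%N is j.+1 then P`_j else 0))); last first.
    rewrite big_ord_recr /= subnn !mulr0 addr0; apply: eq_bigr => k _.
    rewrite subSS subnS; case E: (n - k)%N => [|j] /=; last by [].
    by have := ltn_ord k; rewrite -subn_gt0 E.
  rewrite -sumrB -big_split; apply: eq_bigr => k _ /=.
  rewrite big_cons cE.
  by case: (n.+1 - k.+1)%N => [|j]; rewrite mulrDl !mulrBr ?mulr0 ?subr0; ring.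
rewrite !IHs.
have -> : \sum_(k < n.+1) a ^+ k.+1 * (rev_root_poly (a :: s))`_(n.+1 - k.+1) = a * P`_n.
  under eq_bigr => k _ do rewrite cE subSS mulrBr.
  rewrite sumrB [X in _ - X]big_ord_recr /= subnn !mulr0 addr0 big_ord_recl /= subn0 expr1.
  rewrite -addrA [X in _ + X](_ : _ = 0) ?addr0 //; apply/eqP; rewrite subr_eq0; apply/eqP.
  apply: eq_bigr => k _; rewrite /bump /= add1n subnS.
  case E: (n - k)%N => [|j] /=; first by have := ltn_ord k; rewrite -subn_gt0 E.
  by rewrite (exprSr a k.+1); ring.
by rewrite cE; ring.
Qed.
End PowerSums.

Section PowerSumBound.
Variable C : numClosedFieldType.
(** A [numClosedFieldType] need not be archimedean, and comparing growth rates of powers requires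
    it. *)
Hypothesis archC : forall x : C, exists n : nat, `|x| < n%:R.

Lemma bernoulli_ineq (h : C) n : 0 <= h -> 1 + n%:R * h <= (1 + h) ^+ n.
Proof.
move=> h0; elim: n => [|n IHn]; first by rewrite mul0r addr0 expr0.
have h1 : 0 <= 1 + h by rewrite addr_ge0.
rewrite exprS; apply: le_trans (ler_wpM2l h1 IHn).
rewrite -subr_ge0 [X in 0 <= X](_ : _ = n%:R * h ^+ 2); last by rewrite -natr1; ring.
by rewrite mulr_ge0 ?exprn_ge0.
Qed.

Lemma le_of_exp_bound (x R D : C) n0 : 0 < R -> 0 <= x ->
  (forall n, (n0 <= n)%N -> x ^+ n <= D * R ^+ n) -> x <= R.
Proof.
move=> R0 x0 H; have [//|Rx] := real_leP (ger0_real x0) (gtr0_real R0).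
pose h := x / R - 1.
have h0 : 0 < h by rewrite subr_gt0 ltr_pdivlMr // mul1r.
have [n nD] := archC (D / h).
have := H (maxn n0 n) (leq_maxl _ _); set N := maxn n0 n => HN.
have {HN} : (1 + h) ^+ N <= D.
  by rewrite addrC subrK expr_div_n ler_pdivrMr // exprn_gt0.
move=> /(le_trans (bernoulli_ineq N (ltW h0))) HD.
have D0 : 0 <= D by apply: le_trans HD; rewrite addr_ge0 // mulr_ge0 // ltW.
have : D < N%:R * h.
  rewrite -ltr_pdivrMr // -(ger0_norm (divr_ge0 D0 (ltW h0))).
  by apply: lt_le_trans nD _; rewrite ler_nat leq_maxr.
by move=> /(le_lt_trans HD); rewrite -ltrBrDr subrr ltr10.
Qed.

(* A polynomial [q] vanishing on [s] except at [a0] isolates [a0 ^+ n]. *)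
Lemma root_bound_of_power_sums (s : seq C) (R B : C) n0 : 0 < R ->
  (forall n, (n0 <= n)%N -> `|\sum_(a <- s) a ^+ n| <= B * R ^+ n) ->
  forall a, a \in s -> `|a| <= R.
Proof.
move=> R0 H a0 a0s.
pose q := \prod_(z <- rem a0 (undup s)) ('X - z%:P).
have urem : uniq (undup s) := undup_uniq s.
have q0 : q.[a0] != 0.
  by rewrite -[_ != 0]/(~~ root q a0) root_prod_XsubC mem_rem_uniq // inE eqxx.
have qa a : a \in s -> a != a0 -> q.[a] = 0.
  move=> sa aa0; apply/rootP; rewrite root_prod_XsubC mem_rem_uniq // inE aa0.
  by rewrite mem_undup.
have qsum n : \sum_(a <- s) a ^+ n * q.[a] = (a0 ^+ n * q.[a0]) *+ count_mem a0 s.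
  rewrite -sum1_count -sumrMnr [RHS]big_mkcond !big_seq; apply: eq_bigr => a sa /=.
  have [->|/qa->//] := eqVneq a a0; by rewrite ?mulr1n ?mulr0.
pose D := \sum_(j < size q) `|q`_j| * (B * R ^+ j).
have bnd n : (n0 <= n)%N -> `|a0| ^+ n <= (D / `|q.[a0]|) * R ^+ n.
  move=> nn0; rewrite mulrAC ler_pdivlMr ?normr_gt0 //.
  have c1 : (0 < count_mem a0 s)%N by rewrite -has_count has_pred1.
  apply: le_trans (_ : `|\sum_(a <- s) a ^+ n * q.[a]| <= _).
    by rewrite qsum normrMn normrM normrX -[X in _ <=
      X]mulr_natr ler_peMr ?ler1n // mulr_ge0 ?exprn_ge0.
  have -> : \sum_(a <- s) a ^+ n * q.[a] =
      \sum_(j < size q) q`_j * \sum_(a <- s) a ^+ (n + j).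
    under eq_bigr => a _ do rewrite horner_coef mulr_sumr.
    rewrite exchange_big; apply: eq_bigr => j _ /=; rewrite mulr_sumr.
    by apply: eq_bigr => a _; rewrite exprD; ring.
  apply: le_trans (ler_norm_sum _ _ _) _; rewrite mulr_suml; apply: ler_sum => j _.
  rewrite normrM -mulrA ler_wpM2l // -mulrA -exprD addnC.
  by rewrite H // (leq_trans nn0) ?leq_addl.
exact: le_of_exp_bound R0 (normr_ge0 a0) bnd.
Qed.
End PowerSumBound.

Section WeilBound.
Variables (p : nat).
Hypothesis pr_p : prime p.
Local Notation F := 'F_p.
Variable C : numClosedFieldType.
Hypothesis archC : forall x : C, exists n : nat, `|x| < n%:R.
Variable chi : F -> C.
Hypothesis chiM : {morph chi : x y / x * y}.
Hypothesis chi0 : chi 0 = 0.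
Hypothesis chi1 : chi 1 = 1.
Hypothesis chi_nontriv : exists2 y, y != 0 & chi y != 1.
Variable pts : seq (F * nat).
Hypothesis pts0 : all (fun a => a.1 != 0) pts.

Let p_gt0 := prime_gt0 pr_p.
Let p_gt1 := prime_gt1 pr_p.

Lemma norm_char y : y != 0 -> `|chi y| = 1.
Proof.
move=> y0; have chiX n : chi (y ^+ n) = chi y ^+ n.
  by elim: n => [|n IHn]; rewrite ?expr0 ?chi1 // !exprS chiM IHn.
have p1 : (0 < p.-1)%N by rewrite -subn1 subn_gt0.
have y1 : y ^+ p.-1 = 1.
  apply: (mulfI y0); rewrite -exprS prednK // mulr1.
  by rewrite -[in RHS](expf_card y) card_Fp.
apply/eqP; rewrite -(@pexpr_eq1 _ _ p.-1) // -normrX -chiX y1 chi1 normr1 //.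
Qed.

Lemma sum_char : \sum_y chi y = 0.
Proof.
have [z z0 z1] := chi_nontriv.
apply/eqP; have : chi z * \sum_y chi y == \sum_y chi y.
  rewrite mulr_sumr; apply/eqP.
  rewrite [RHS](reindex_inj (mulfI z0)); apply: eq_bigr => y _.
  by rewrite chiM.
by rewrite -subr_eq0 -[X in _ - X]mul1r -mulrBl mulf_eq0 subr_eq0 (negPf z1).
Qed.

(** For monic g this is the product over the roots x of g of - x times the (a - x)^m, so [w] is
    completely multiplicative and its sum over g of degree 1 is the sum to be bounded. The exponent
    1 of [g.[0]] is the simple zero: a translation of [g.[0]] alone then sums to the full sum of
    [chi], which is 0. *)
Definition pts_weight (g : {poly F}) : F := g.[0] * \prod_(a <- pts) g.[a.1] ^+ a.2.
Let w g := chi (pts_weight g).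

Lemma pts_weightM : {morph pts_weight : g h / g * h}.
Proof.
move=> g h; rewrite /pts_weight hornerM.
under eq_bigr do rewrite hornerM exprMn.
by rewrite big_split /=; ring.
Qed.

Let wM : {morph w : g h / g * h}.
Proof. by move=> g h; rewrite /w pts_weightM chiM. Qed.

(* Adding [u *: l] to [g] changes [g.[0]] but none of the [g.[a.1]]. *)
Lemma msum_eq0 n : (size pts < n)%N -> msum w n = 0.
Proof.
move=> mn; pose l : {poly F} := \prod_(a <- pts) ('X - a.1%:P).
have sl : (size l <= n)%N by rewrite /l size_prod_XsubC.
have l0 : l.[0] != 0.
  rewrite /l horner_prod prodf_seq_neq0; apply: sub_all pts0 => a a0 /=.
  by rewrite !hornerE oppr_eq0.
have la a : a \in pts -> l.[a.1] = 0.
  move=> ap; apply/rootP; rewrite /l -(big_map fst xpredT (fun y => 'X - y%:P)).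
  by rewrite root_prod_XsubC map_f.
have shift u : msum w n = \sum_(v : 'rV[F]_n) w (mon v + u *: l).
  rewrite /msum (reindex_inj (addIr (u *: poly_rV l))) /=.
  by apply: eq_bigr => v _; rewrite /mon linearD linearZ /= poly_rV_K // addrA.
have : \sum_(u : F) msum w n = 0.
  under eq_bigr => u _ do rewrite (shift u).
  rewrite exchange_big big1 //= => v _.
  under eq_bigr => u _.
    rewrite /w /pts_weight hornerD hornerZ chiM.
    have -> : \prod_(a <- pts) (mon v + u *: l).[a.1] ^+ a.2 = \prod_(a <- pts)
      (mon v).[a.1] ^+ a.2.
      rewrite !big_seq; apply: eq_bigr => a ap.
      by rewrite hornerD hornerZ la // mulr0 addr0.
    over.
  rewrite -mulr_suml [X in X * _](_ : _ = 0) ?mul0r // -[RHS]sum_char.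
  rewrite [RHS](reindex_inj (addrI (mon v).[0])) [RHS](reindex_inj (mulIf l0)).
  by [].
by rewrite sumr_const => /eqP; rewrite mulrn_eq0 card_Fp // eqn0Ngt p_gt0 => /eqP.
Qed.

Lemma msum0 : msum w 0 = 1.
Proof.
rewrite /msum (big_pred1 0) => [|v]; last by apply/esym/eqP/rowP; case.
have -> : mon (0 : 'rV[F]_0) = 1 by rewrite /mon expr0 linear0 addr0.
by rewrite /w /pts_weight hornerC big1 ?mulr1 ?chi1 // => a _; rewrite hornerC expr1n.
Qed.

Lemma msum1 : msum w 1 = \sum_y chi (y * \prod_(a <- pts) (a.1 + y) ^+ a.2).
Proof.
rewrite /msum (reindex (fun y : F => \row_(i < 1) y)) /=; last first.
  exists (fun v : 'rV[F]_1 => v 0 0) => [y _|v _]; first by rewrite mxE.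
  by apply/rowP => i; rewrite mxE ord1.
apply: eq_bigr => y _; congr chi; rewrite /pts_weight.
have E z : (mon (\row_(i < 1) y)).[z] = z + y.
  rewrite /mon expr1 !hornerE; congr (_ + _).
  rewrite /rVpoly poly_def big_ord_recl big_ord0 addr0 expr0 alg_polyC hornerC.
  by rewrite insubT mxE.
by rewrite E add0r; under eq_bigr do rewrite E.
Qed.

(** [msum_eq0] makes the L-function a polynomial, and its constant term 1 keeps its roots away from
    0, so their inverses can be listed in [s]. *)
Lemma L_polynomial : exists s : seq C, (size s <= size pts)%N /\
  forall n, (rev_root_poly s)`_n = msum w n.
Proof.
pose L := \poly_(i < (size pts).+1) msum w i.
have Lc n : L`_n = msum w n.
  by rewrite coef_poly ltnS; case: leqP => // /msum_eq0 ->.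
have [r Lr] := closed_field_poly_normal L.
have L0 : L != 0 by apply/negP => /eqP E; have := Lc 0%N; rewrite E coef0 msum0 => /eqP;
  rewrite eq_sym oner_eq0.
have sr : (size r <= size pts)%N.
  rewrite -ltnS -(size_prod_XsubC r id); apply: leq_trans (size_poly (size pts).+1 (msum w)).
  by rewrite -/L [X in (_ <= size (polyseq X))%N]Lr size_scale // lead_coef_eq0.
have rn0 z : z \in r -> z != 0.
  move=> zr; apply/negP => /eqP z0.
  have : root L 0 by rewrite Lr rootZ ?lead_coef_eq0 // root_prod_XsubC -z0.
  by rewrite rootE horner_coef0 Lc msum0 oner_eq0.
exists (map GRing.inv r); rewrite size_map; split=> // n; rewrite -Lc; congr (_`_n).
have E : L = (lead_coef L * \prod_(z <- r) (- z)) *: rev_root_poly (map GRing.inv r).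
  rewrite {1}Lr -scalerA; congr (_ *: _).
  rewrite /rev_root_poly big_map -scaler_prod !big_seq; apply: eq_bigr => z /rn0 z0.
  rewrite scalerBr scalerA mulNr divff // scaleN1r opprK addrC; congr (_ + _).
  by rewrite alg_polyC polyCN.
have : L`_0 = (lead_coef L * \prod_(z <- r) (- z)).
  rewrite {1}E coefZ -horner_coef0 /rev_root_poly horner_prod.
  rewrite [X in _ * X]big1 ?mulr1 // => z _.
  by rewrite !hornerE subr0.
by rewrite Lc msum0 => c1; rewrite {1}E -c1 scale1r.
Qed.

Section PointCount.
Variables (K : closedFieldType) (iota : {rmorphism F -> K}).

Let f0 : {poly F} := - \prod_(a <- pts) (a.1%:P - 'X) ^+ a.2.
Let W k x := pts_weight (dpoly iota (conjpoly p k x)).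

Lemma horner_dpoly_conj k x c : (0 < k)%N -> x ^+ (p ^ k) = x ->
  iota (dpoly iota (conjpoly p k x)).[c] = (iota c - x) ^+ (\sum_(i < k) p ^ i).
Proof.
move=> k0 xk; rewrite -horner_map /= (map_dpoly_conjpoly pr_p) //.
rewrite /conjpoly horner_prod -prodrXr; apply: eq_bigr => i _; rewrite !hornerE.
have cE : iota c ^+ (p ^ i) = iota c.
  elim: (i : nat) => [|j IHj]; first by rewrite expn0 expr1.
  by rewrite expnSr exprM IHj -rmorphXn /= -[in X in iota (_ ^+ X)](card_Fp pr_p) expf_card.
have := exp_pow_pcharD pr_p iota i (iota c - x) x.
by rewrite /= subrK cE => E; rewrite {1}E addrK.
Qed.

(** The exponent is that of the norm down to F_p. It equals (p^k - 1)/(p - 1), so the fibres of this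
    map are the sets that Stepanov's method counts with e = p - 1. The sign in [f0] absorbs the
    factor - x coming from the value at 0. *)
Lemma pts_weight_conj k x : (0 < k)%N -> x ^+ (p ^ k) = x ->
  iota (W k x) = ('X * map_poly iota f0).[x] ^+ (\sum_(i < k) p ^ i).
Proof.
move=> k0 xk; rewrite /W /pts_weight rmorphM rmorph_prod /= horner_dpoly_conj //.
set b := (\sum_(i < k) p ^ i)%N.
rewrite rmorph0 sub0r hornerM hornerX exprMn rmorphN hornerN rmorph_prod /= horner_prod.
rewrite -[in RHS]exprMn mulrN -mulNr exprMn; congr (_ * _).
rewrite -prodrXl; apply: eq_bigr => a _.
rewrite rmorphXn /= horner_dpoly_conj // -/b rmorphXn rmorphB /= map_polyC map_polyX.
by rewrite horner_exp !hornerE -!exprM mulnC.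
Qed.

(** Stepanov's method only bounds the fibres [N z] from above. Two-sided control is free: the fibres
    add up to [Q], so the sum of the excesses [E z] over nonzero z is known, and an excess bounded
    above by [B1] has absolute value at most [2 * B1 - E z]. The fibre over 0 consists of roots of a
    fixed polynomial. *)
Lemma point_sum_bound : exists B n0, forall n, (n0 <= n)%N ->
  `|point_sum iota w (n + n)| <= B * p%:R ^+ n :> C.
Proof.
set F0 := map_poly iota f0.
pose C1 := (p.-1 * (3 * size F0 + 3))%N.
exists (2 * C1 + size F0)%:R; exists (2 * size F0 + 7)%N => n nbig.
have Mbig : (2 * size F0 + 7 <= p ^ n)%N.
  by apply: leq_trans nbig (ltnW (ltn_expl n p_gt1)).
have n0 : (0 < n + n)%N by lia.
set k := (n + n)%N; pose Q := (p ^ k)%N; pose b := (\sum_(i < k) p ^ i)%N.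
have e0 : (0 < p.-1)%N by rewrite -subn1 subn_gt0.
have be : (b * p.-1 = Q.-1)%N by rewrite mulnC -predn_exp.
have F00 : F0.[0] != 0.
  rewrite /F0 -[X in _.[X]](rmorph0 iota) horner_map /= fmorph_eq0 hornerN oppr_eq0 horner_prod.
  rewrite prodf_seq_neq0; apply: sub_all pts0 => a a0 /=.
  by rewrite horner_exp !hornerE oppr0 addr0 expf_neq0.
pose N (z : F) := count (fun x => W k x == z) (fq p K k).
have Wfix x : x \in fq p K k -> x ^+ Q = x /\ iota (W k x) = ('X * F0).[x] ^+ b.
  by rewrite mem_fq // => /eqP xk; rewrite pts_weight_conj.
have N0 : (N 0%R <= size F0)%N.
  rewrite /N -size_filter.
  have XF0 : 'X * F0 != 0.
    by rewrite mulf_neq0 ?polyX_eq0 //; apply: contraNneq F00 => ->; rewrite horner0.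
  have := @max_poly_roots _ ('X * F0) [seq x <- fq p K k | W k x ==
    0] XF0 _ (filter_uniq _ (uniq_fq pr_p iota n0)).
  rewrite mulrC size_mulX -?size_poly_eq0 ?ltnS; first last.
    by apply: contraNneq F00 => /eqP; rewrite size_poly_eq0 => /eqP->; rewrite horner0.
  apply; apply/allP => x; rewrite mem_filter => /andP[/eqP W0 /Wfix[_]].
  rewrite W0 rmorph0 => /esym/eqP; rewrite expf_eq0 => /andP[_].
  by rewrite mulrC.
have Nz z : z != 0 -> (p.-1 * N z <= Q + C1 * p ^ n)%N.
  move=> z0; rewrite /N -size_filter.
  apply: (stepanov_count (pchar_closure pr_p iota) F00 e0 be Mbig).
    by rewrite filter_uniq // uniq_fq.
  by move=> x; rewrite mem_filter => /andP[/eqP Wz /Wfix[xQ <-]]; rewrite Wz.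
have sumN : (\sum_z N z = Q)%N.
  rewrite /Q -(size_fq pr_p K n0) -sum1_size.
  under eq_bigr do rewrite /N -sum1_count big_mkcond.
  rewrite exchange_big; apply: eq_bigr => x _ /=.
  by rewrite -big_mkcond /= (big_pred1 (W k x)) // => z; rewrite eq_sym.
have SE : point_sum iota w k = \sum_z chi z * (N z)%:R.
  rewrite /point_sum; transitivity (\sum_(x <- fq p K k) \sum_z (if W k x == z then chi z else 0)).
    apply: eq_bigr => x _; rewrite -big_mkcond /= (big_pred1 (W k x)) // => z /=; exact: eq_sym.
  rewrite exchange_big; apply: eq_bigr => z _ /=.
  by rewrite -big_mkcond big_const_seq iter_addr_0 mulr_natr.
pose E z : C := (p.-1 * N z)%:R - Q%:R.
have eS : p.-1%:R * point_sum iota w k = \sum_(z | z != 0) chi z * E z.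
  transitivity (\sum_z chi z * E z).
    under [RHS]eq_bigr do rewrite /E mulrBr natrM.
    rewrite sumrB -mulr_suml sum_char mul0r subr0 SE mulr_sumr.
    by apply: eq_bigr => z _; ring.
  by rewrite (bigD1 0) //= chi0 mul0r add0r.
have Ereal z : E z \is Num.real by rewrite realB ?realn.
pose B1 : C := (C1 * p ^ n)%:R.
have Eb z : z != 0 -> `|chi z * E z| <= 2 * B1 - E z.
  move=> z0; rewrite normrM norm_char // mul1r.
  have EB : E z <= B1 by rewrite lerBlDl -natrD ler_nat addnC addnC Nz.
  have B0 : 0 <= B1 by apply: ler0n.
  have [E0|E0] := real_leP (Ereal z) (real0 C).
    by rewrite ler0_norm // lerDr mulr_ge0.
  by rewrite gtr0_norm // mulr_natl mulr2n lerBrDr lerD.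
rewrite -(ler_pM2l (_ : 0 < p.-1%:R :> C)) ?ltr0n //.
rewrite -{1}[p.-1%:R]ger0_norm ?ler0n // -normrM eS.
apply: le_trans (ler_norm_sum _ _ _) _.
apply: le_trans (ler_sum _ Eb) _.
have cardF : #|[pred z : F | z != 0]| = p.-1.
  by have := cardC1 (0 : F); rewrite card_Fp.
rewrite sumrB sumr_const cardF.
have -> : \sum_(z | z != 0) E z = - (p.-1 * N 0%R)%:R.
  have QE : Q = (N 0%R + \sum_(z | z != 0%R) N z)%N by rewrite -sumN (bigD1 0%R).
  rewrite sumrB sumr_const cardF -natr_sum -big_distrr /= QE.
  move: (\sum_(z | _) N z)%N (N 0) => X Y.
  by rewrite -mulrnA mulnDl natrD ![(p.-1 * _)%N]mulnC opprD addrC -addrA addNr addr0.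
rewrite opprK -[_ *+ p.-1]mulr_natl natrM -mulrDr ler_wpM2l ?ler0n //.
rewrite [(2 * C1 + _)%:R]natrD [X in _ <= X]mulrDl lerD //.
  by rewrite /B1 !natrM natrX mulrA.
by apply: le_trans (_ : (size F0)%:R <= _);
  rewrite ?ler_nat // ler_peMr ?ler0n // exprn_ege1 // ler1n.
Qed.

Lemma weil_bound_closure :
  `|\sum_y chi (y * \prod_(a <- pts) (a.1 + y) ^+ a.2)| <= (size pts)%:R * sqrtC p%:R.
Proof.
have [s [ss Lc]] := L_polynomial.
have c0 : msum w 0 = 1 := msum0.
(* Both families satisfy the same recurrence up to sign, and the coefficient of its newest term is
   [msum w 0], which is 1; so the recurrence determines them. *)
have SE k : point_sum iota w k.+1 = - \sum_(a <- s) a ^+ k.+1.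
  elim/ltn_ind: k => k IHk.
  have := msum_newton pr_p iota wM k.+1; have := newton_power_sum s k.+1.
  rewrite Lc => E1 E2; have : (\sum_(i < k.+1) (point_sum iota w i.+1 + \sum_(a <- s) a ^+ i.+1)
    * msum w (k.+1 - i.+1)) = 0.
    under eq_bigr do rewrite mulrDl.
    rewrite big_split /= -E2.
    by under [X in _ + X]eq_bigr do rewrite -Lc; rewrite E1 subrr.
  rewrite big_ord_recr /= big1 => [|i _]; last by rewrite IHk // addNr mul0r.
  by rewrite add0r subnn c0 mulr1 => /eqP; rewrite addr_eq0 => /eqP.
have [B [n0 HB]] := point_sum_bound.
(* The point counts are controlled in even degrees only, so the root bound is applied to the
   squares, whose n-th power sum is the 2n-th power sum of [s]. *)
have sb a : a \in s -> `|a| <= sqrtC p%:R.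
  move=> sa; rewrite -(ler_pXn2r (_ : 0 < 2)%N) ?nnegrE ?sqrtC_ge0 ?ler0n // sqrtCK -normrX.
  apply: (@root_bound_of_power_sums C archC [seq a ^+ 2 | a <- s] p%:R B (maxn 1 n0));
    rewrite ?ltr0n //.
    move=> n; rewrite geq_max => /andP[n1 /HB]; rewrite big_map.
    have -> : (n + n = (n + n).-1.+1)%N by lia.
    rewrite SE normrN; congr (`|_| <= _); apply: eq_bigr => z _.
    by rewrite -exprM; congr (_ ^+ _); lia.
  exact: map_f.
have := msum_newton pr_p iota wM 1.
rewrite big_ord1 mul1r subnn c0 mulr1 SE -msum1 => ->; rewrite normrN.
apply: le_trans (ler_norm_sum _ _ _) _.
apply: le_trans (_ : \sum_(a <- s) sqrtC p%:R <= _).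
  by rewrite !big_seq; apply: ler_sum => a /sb; rewrite expr1.
rewrite big_const_seq count_predT iter_addr_0 -[_ *+ size s]mulr_natl.
by rewrite ler_wpM2r ?sqrtC_ge0 ?ler0n // ler_nat.
Qed.
End PointCount.

Lemma weil_bound :
  `|\sum_y chi (y * \prod_(a <- pts) (a.1 + y) ^+ a.2)| <= (size pts)%:R * sqrtC p%:R.
Proof.
have [K [iota _]] := countable_algebraic_closure ('F_p : countFieldType).
exact: (@weil_bound_closure K iota).
Qed.
End WeilBound.

Local Notation CC := (RR[i]).
Local Notation nm := (@ComplexField.Normc.normc RR).

(** * Exponentials and finite Fourier sums *)

Lemma normcE_nm (z : CC) : `|z| = ((nm z)%:C)%C. Proof. by []. Qed.

Lemma nmM x y : nm (x * y) = nm x * nm y.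
Proof. exact: ComplexField.Normc.normcM. Qed.

Lemma nm_ge0 x : 0 <= nm x.
Proof. by case: x => a b; rewrite /= sqrtr_ge0. Qed.

Lemma nm0 : nm 0 = 0. Proof. exact: ComplexField.Normc.normc0. Qed.

Lemma nm1 : nm 1 = 1. Proof. exact: ComplexField.Normc.normc1. Qed.

Lemma nmN x : nm (- x) = nm x.
Proof. by apply: complexI; rewrite -!normcE_nm normrN. Qed.

Lemma nmD x y : nm (x + y) <= nm x + nm y.
Proof. by rewrite -lecR rmorphD /= -!normcE_nm ler_normD. Qed.

Lemma nmB x y : nm (x - y) <= nm x + nm y.
Proof. by rewrite -[nm y]nmN nmD. Qed.

Lemma nmJ x : nm (x^*%C) = nm x.
Proof. by apply: complexI; rewrite -!normcE_nm normcJ. Qed.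

Lemma nm_real (x : RR) : nm (x%:C)%C = `|x|.
Proof. by rewrite /= expr0n /= addr0 sqrtr_sqr. Qed.

Lemma nm_sum (I : Type) (s : seq I) (P : pred I) (f : I -> CC) :
  nm (\sum_(i <- s | P i) f i) <= \sum_(i <- s | P i) nm (f i).
Proof.
elim/big_rec2: _ => [|i x y _ le_xy]; first by rewrite nm0.
by apply: le_trans (nmD _ _) _; rewrite lerD2l.
Qed.

Lemma nm_prod (I : Type) (s : seq I) (P : pred I) (f : I -> CC) :
  nm (\prod_(i <- s | P i) f i) = \prod_(i <- s | P i) nm (f i).
Proof. exact: (big_morph nm nmM nm1). Qed.

Lemma nmX x n : nm (x ^+ n) = nm x ^+ n.
Proof. by elim: n => [|n IHn]; rewrite ?expr0 ?nm1 // !exprS nmM IHn. Qed.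

Lemma nm_sqrE (z : CC) : ((nm z ^+ 2)%:C)%C = z * z^*%C.
Proof. by rewrite rmorphXn /= -normcE_nm sqr_normc. Qed.

Lemma e_D s t : e_ (s + t) = e_ s * e_ t.
Proof.
rewrite /e_ mulrDr trigo.cosD trigo.sinD; apply/eqP; rewrite eq_complex /= eqxx /=.
by apply/eqP; ring.
Qed.

Lemma e_0 : e_ 0 = 1.
Proof. by rewrite /e_ mulr0 cos0 sin0. Qed.

Lemma e_1 : e_ 1 = 1.
Proof. by rewrite /e_ mulr1 mulr_natl cos2pi sin2pi. Qed.

Lemma e_conj t : (e_ t)^*%C = e_ (- t).
Proof. by rewrite /e_ mulrN cosN sinN. Qed.

Lemma e_N t : e_ (- t) * e_ t = 1.
Proof. by rewrite -e_D addNr e_0. Qed.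

Lemma nm_e t : nm (e_ t) = 1.
Proof. by rewrite /= cos2Dsin2 sqrtr1. Qed.

Lemma e_nat n t : e_ (n%:R * t) = e_ t ^+ n.
Proof.
elim: n => [|n IHn]; first by rewrite mul0r e_0 expr0.
by rewrite -natr1 mulrDl mul1r e_D IHn exprSr.
Qed.

Lemma e_natr (n : nat) : e_ n%:R = 1.
Proof. by rewrite -[n%:R]mulr1 e_nat e_1 expr1n. Qed.

Lemma e_int (z : int) : e_ z%:~R = 1.
Proof.
case: z => n; first exact: e_natr.
rewrite NegzE mulrNz -[LHS]mulr1 -[X in _ * X = _](e_natr n.+1).
exact: e_N.
Qed.

Lemma e_Dint t (z : int) : e_ (t + z%:~R) = e_ t.
Proof. by rewrite e_D e_int mulr1. Qed.

Lemma nm_eB s t : nm (e_ s - e_ t) = 2 * `|sin (pi * (s - t))|.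
Proof.
have E u : nm (e_ u - 1) = 2 * `|sin (pi * u)|.
  rewrite /= oppr0 addr0.
  have -> : 2 * pi * u = (pi * u) *+ 2 by rewrite -mulr_natl; ring.
  rewrite cos_mulr2n sin_mulr2n.
  have -> : (cos (pi * u) ^+ 2 *+ 2 - 1 - 1) ^+ 2 + (cos (pi * u) * sin (pi * u) *+ 2) ^+ 2
     = (2 * sin (pi * u)) ^+ 2.
    have := cos2Dsin2 (pi * u); move: (cos _) (sin _) => c s' h.
    have -> : c ^+ 2 = 1 - s' ^+ 2 by rewrite -h addrK.
    have -> : (c * s' *+ 2) ^+ 2 = 4 * c ^+ 2 * s' ^+ 2 by ring.
    by have -> : c ^+ 2 = 1 - s' ^+ 2 by [rewrite -h addrK]; ring.
  by rewrite sqrtr_sqr normrM ger0_norm.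
rewrite -E -[RHS]mulr1 -[X in _ * X](nm_e t) -nmM mulrBl mul1r -e_D subrK //.
Qed.

Lemma sin_mvt (x : RR) : 0 < x -> exists2 c, 0 < c < x & sin x = cos c * x.
Proof.
move=> x0; have [|c c0 E] := @MVT RR (@sin RR) (@cos RR) 0 x x0 (fun y _ => is_derive_sin y).
  by apply: continuous_subspaceT; exact: continuous_sin.
by exists c; [move: c0; rewrite in_itv | move: E; rewrite sin0 !subr0].
Qed.

Lemma norm_sin_le (x : RR) : `|sin x| <= `|x|.
Proof.
wlog x0 : x / 0 <= x.
  move=> H; have [/H//|/ltW x0] := leP 0 x.
  by rewrite -normrN -sinN -[`|x|]normrN H // oppr_ge0.
move: x0; rewrite le_eqVlt => /orP[/eqP<-|x0]; first by rewrite sin0.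
have [c _ ->] := sin_mvt x0; rewrite normrM ler_piMl //; exact: cos_max.
Qed.

(** A form of Jordan's inequality with a weaker constant: sin x = 2 cos(x/2) sin(x/2), the mean
    value theorem gives sin(x/2) = cos(c) x/2, and both cosines are at least cos 1 since pi/2 <
    2. *)
Lemma sin_ge (x : RR) : 0 <= x <= pi / 2 -> cos 1 ^+ 2 * x <= sin x.
Proof.
move=> /andP[]; rewrite le_eqVlt => /orP[/eqP<- _|x0 xpi]; first by rewrite mulr0 sin0.
have x2 : x / 2 < 1.
  by rewrite ltr_pdivrMr // mul1r; apply: le_lt_trans xpi (pihalf_lt2 _).
have pi1 : 1 <= pi :> RR by apply: le_trans (pi_ge2 _); rewrite ler1n.
have cosb (y : RR) : 0 <= y <= 1 -> cos 1 <= cos y.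
  move=> /andP[y0 y1]; have [->//|ny] := eqVneq y 1.
  have y1' : y < 1 by rewrite lt_neqAle ny.
  have yI : y \in `[0, pi] by rewrite in_itv /= y0 (le_trans y1).
  have oI : (1 : RR) \in `[0, pi] by rewrite in_itv /=; apply/andP; split=> //; exact: ler01.
  by apply/ltW; rewrite ltr_cos.
have c0 : 0 <= cos 1 :> RR := ltW (cos1_gt0 _).
have [|c /andP[c1 c2] E] := @sin_mvt (x / 2); first by rewrite divr_gt0.
have -> : sin x = 2 * cos (x / 2) * sin (x / 2).
  have {1}-> : x = (x / 2) *+ 2 by rewrite -mulr_natr mulfVK.
  by rewrite sin_mulr2n; ring.
rewrite E; have -> : cos 1 ^+ 2 * x = x * (cos 1 * cos 1) :> RR by ring.
have -> : 2 * cos (x / 2) * (cos c * (x / 2)) = x * (cos (x / 2) * cos c) by field.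
rewrite ler_wpM2l ?(ltW x0) // ler_pM ?cosb //; first by rewrite divr_ge0 ?ltW.
by rewrite (ltW c1) ltW // (lt_trans c2).
Qed.

Lemma nm_1Be_ge (t : RR) : 0 < t < 1 ->
  (nm (1 - e_ t))^-1 <= (cos 1 ^+ 2)^-1 * (t^-1 + (1 - t)^-1).
Proof.
wlog th : t / t <= 1 / 2.
  move=> H /andP[t0 t1]; have [|h] := leP t (1 / 2); first by move=> /H; apply; rewrite t0.
  have := H (1 - t); rewrite subKr [(1 - t)^-1 + _]addrC.
  have -> : nm (1 - e_ (1 - t)) = nm (1 - e_ t).
    rewrite (_ : 1 - e_ (1 - t) = - (e_ (- t) * (1 - e_ t))).
      by rewrite nmN nmM nm_e mul1r.
    by rewrite mulrBr mulr1 e_N opprB e_D e_1 mul1r.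
  by apply; lra.
move=> /andP[t0 t1].
have k0 : 0 < cos 1 ^+ 2 :> RR by rewrite exprn_gt0 // cos1_gt0.
have tb : cos 1 ^+ 2 * t <= nm (1 - e_ t).
  rewrite -{1}e_0 nm_eB sub0r mulrN sinN normrN.
  have s1 : cos 1 ^+ 2 * (pi * t) <= sin (pi * t).
    by apply: sin_ge; rewrite mulr_ge0 ?pi_ge0 ?(ltW t0) //= ler_wpM2l ?pi_ge0 // -div1r.
  have s0 : 0 <= sin (pi * t).
    by apply: le_trans s1; rewrite mulr_ge0 ?(ltW k0) // mulr_ge0 ?pi_ge0 ?ltW.
  rewrite ger0_norm //; apply: le_trans (_ : 2 * (cos 1 ^+ 2 * (pi * t)) <= _);
    last by rewrite ler_pM2l.
  have -> : 2 * (cos 1 ^+ 2 * (pi * t)) = 2 * pi * (cos 1 ^+ 2 * t) by ring.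
  have kt : 0 <= cos 1 ^+ 2 * t by rewrite mulr_ge0 // ltW.
  by rewrite ler_peMl //; have := pi_ge2 RR; lra.
apply: le_trans (_ : (cos 1 ^+ 2 * t)^-1 <= _).
  have nmp : 0 < nm (1 - e_ t) by apply: lt_le_trans tb; rewrite mulr_gt0.
  have ktp : 0 < cos 1 ^+ 2 * t by rewrite mulr_gt0.
  by move: nmp ktp tb; move: (nm _) (cos 1 ^+ 2 * t) => a b a0 b0 ab; rewrite lef_pV2.
by rewrite invfM ler_pM2l ?invr_gt0 // lerDl invr_ge0 subr_ge0 ltW.
Qed.

Definition harmonic_sum (n : nat) : RR := \sum_(l < n) (l.+1)%:R^-1.

Lemma nm_nat n : nm n%:R = n%:R.
Proof. by apply: complexI; rewrite -normcE_nm normr_nat rmorph_nat. Qed.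

Lemma nm_1Be_gt0 (t : RR) : 0 < t < 1 -> 0 < nm (1 - e_ t).
Proof.
move=> /andP[t0 t1]; rewrite -{1}e_0 nm_eB sub0r mulrN sinN normrN.
rewrite mulr_gt0 // normr_gt0 gt_eqF // sin_gt0_pi // mulr_gt0 ?pi_gt0 //=.
by rewrite -[ltRHS]mulr1 ltr_pM2l ?pi_gt0.
Qed.

Lemma root_unity_sum (n : nat) (z : CC) : z ^+ n = 1 -> z != 1 ->
  \sum_(i < n) z ^+ i = 0.
Proof.
move=> zn z1; apply/eqP; have := subrX1 z n; rewrite zn subrr => /esym/eqP.
by rewrite mulf_eq0 subr_eq0 (negPf z1).
Qed.

Lemma e_frac_orthogonal (n : nat) (v v' : nat) : (v < n.+1)%N -> (v' < n.+1)%N ->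
  \sum_(l < n.+1) e_ (l%:R * (v%:R - v'%:R) / n.+1%:R) = ((v == v') * n.+1)%:R.
Proof.
move=> vn vn'; have n0 : (n.+1%:R : RR) != 0 by rewrite pnatr_eq0.
pose z := e_ ((v%:R - v'%:R) / n.+1%:R).
have -> : \sum_(l < n.+1) e_ (l%:R * (v%:R - v'%:R) / n.+1%:R) = \sum_(l < n.+1) z ^+ l.
  by apply: eq_bigr => l _; rewrite -e_nat mulrA.
have [E|nv] := eqVneq v v'.
  rewrite mul1n (eq_bigr (fun _ => 1)) ?sumr_const ?card_ord // => l _.
  have -> : z = 1 by rewrite /z E subrr mul0r e_0.
  by rewrite expr1n.
rewrite mul0n root_unity_sum //.
  rewrite -e_nat mulrC divfK //.
  have -> : v%:R - v'%:R = (v%:Z - v'%:Z)%:~R :> RR by rewrite rmorphB.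
  by rewrite e_int.
have gt0 t : 0 < t < 1 -> e_ t != 1.
  move=> /nm_1Be_gt0; apply: contraTneq => ->.
  by rewrite subrr nm0 ltxx.
have nR : 0 < n.+1%:R :> RR by rewrite ltr0n.
case: (ltngtP v v') nv => // [lt_vv|lt_vv] _.
  have -> : z = e_ ((v%:R - v'%:R) / n.+1%:R + 1%:~R) by rewrite e_Dint.
  rewrite -[X in _ + X](divff n0) -mulrDl; apply: gt0.
  have vv : v%:R < v'%:R :> RR by rewrite ltr_nat.
  have v'n : v'%:R < n.+1%:R :> RR by rewrite ltr_nat.
  have v0 : 0 <= v%:R :> RR by rewrite ler0n.
  by rewrite divr_gt0 //= ?ltr_pdivrMr //; lra.
apply: gt0.
have vv : v'%:R < v%:R :> RR by rewrite ltr_nat.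
have v'n : v%:R < n.+1%:R :> RR by rewrite ltr_nat.
have v0 : 0 <= v'%:R :> RR by rewrite ler0n.
by rewrite divr_gt0 //= ?ltr_pdivrMr //; lra.
Qed.

Lemma abel_summation (W : nat -> CC) (z : CC) n :
  (1 - z) * (\sum_(v < n.+1) W v * z ^+ v) =
  W 0%N - W n * z ^+ n.+1 + \sum_(v < n) (W v.+1 - W v) * z ^+ v.+1.
Proof.
elim: n => [|n IHn].
  by rewrite big_ord_recl !big_ord0 !addr0 expr0 expr1 mulr1 mulrBl mul1r mulrC.
rewrite big_ord_recr mulrDr IHn [in RHS]big_ord_recr /= [z ^+ n.+2]exprS.
by move: (\sum_(v < n) _) => S; ring.
Qed.

(** Abel summation bounds the l-th coefficient, l > 0, by (B + 2)/|1 - e(l/(n+1))| divided by n + 1;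
    the 2 is for the two boundary terms. By [nm_1Be_ge] these bounds add up to two harmonic sums,
    from l and from n + 1 - l. The coefficient l = 0 gives the leading 1. *)
Lemma dft_bound (n : nat) (W : nat -> CC) (B : RR) :
  (forall v, nm (W v) <= 1) ->
  \sum_(v < n) nm (W v.+1 - W v) <= B ->
  exists c : nat -> CC,
    (forall v, (v < n.+1)%N -> W v = \sum_(l < n.+1) c l * e_ (l%:R * v%:R / n.+1%:R)) /\
    \sum_(l < n.+1) nm (c l) <= 1 + 2 * (cos 1 ^+ 2)^-1 * (B + 2) * harmonic_sum n.
Proof.
move=> W1 WB; have n0 : (n.+1%:R : RR) != 0 by rewrite pnatr_eq0.
have nR : 0 < n.+1%:R :> RR by rewrite ltr0n.
have nC : (n.+1%:R : CC) != 0 by rewrite pnatr_eq0.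
pose G l := \sum_(v < n.+1) W v * e_ (- (l%:R / n.+1%:R)) ^+ v.
exists (fun l => G l / n.+1%:R); split=> [v vn|].
  transitivity ((\sum_(v' < n.+1) W v' * \sum_(l < n.+1) e_ (l%:R * (v%:R - v'%:R) / n.+1%:R))
    / n.+1%:R).
    under eq_bigr => v' _ do rewrite e_frac_orthogonal //.
    rewrite (bigD1 (Ordinal vn)) //= eqxx mul1n big1 ?addr0 ?mulfK // => i iv.
    rewrite (_ : (v == i) = false) ?mul0n ?mulr0 //.
    by apply/negbTE; apply: contra iv => /eqP E; apply/eqP/val_inj.
  rewrite mulr_suml; under eq_bigr do rewrite mulr_sumr mulr_suml.
  rewrite exchange_big; apply: eq_bigr => l _ /=.
  rewrite /G mulr_suml mulr_suml; apply: eq_bigr => v' _.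
  rewrite -e_nat.
  have -> : l%:R * (v%:R - v'%:R) / n.+1%:R = v'%:R * - (l%:R / n.+1%:R)
    + l%:R * v%:R / n.+1%:R :> RR by field.
  by rewrite e_D; ring.
have Gb l : nm (G l) <= n.+1%:R.
  apply: le_trans (nm_sum _ _ _) _.
  apply: le_trans (_ : \sum_(v < n.+1) 1 <= _); last by rewrite sumr_const card_ord.
  by apply: ler_sum => v _; rewrite nmM nmX nm_e expr1n mulr1.
have cE l : nm (G l / n.+1%:R) = nm (G l) / n.+1%:R.
  by rewrite nmM ComplexField.Normc.normcV nm_nat.
under eq_bigr do rewrite cE.
rewrite big_ord_recl lerD //; first by rewrite ler_pdivrMr // mul1r.
set k := (cos 1 ^+ 2)^-1.
have B0 : 0 <= B + 2.
  by rewrite addr_ge0 // (le_trans _ WB) // sumr_ge0 // => i _; apply: nm_ge0.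
have k0 : 0 < k by rewrite invr_gt0 exprn_gt0 // cos1_gt0.
have bl (l : 'I_n) : nm (G (lift ord0 l)) / n.+1%:R <= k * (B + 2) * ((l.+1)%:R^-1 + (n - l)%:R^-1).
  rewrite /lift /= /bump add1n.
  have ln : (l.+1 < n.+1)%N by rewrite ltnS.
  pose t : RR := l.+1%:R / n.+1%:R.
  have t01 : 0 < t < 1 by rewrite divr_gt0 ?ltr0n //= ltr_pdivrMr // mul1r ltr_nat.
  have Abl := abel_summation W (e_ (- t)) n.
  have bnd : nm (1 - e_ t) * nm (G l.+1) <= B + 2.
    have -> : nm (1 - e_ t) = nm (1 - e_ (- t)).
      rewrite -[RHS]mul1r -[X in X * _](nm_e t) -nmM mulrBr mulr1.
      by rewrite [e_ t * _]mulrC e_N -nmN opprB.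
    rewrite -nmM Abl addrC; apply: le_trans (nmD _ _) _; apply: lerD.
      apply: le_trans (nm_sum _ _ _) _; apply: le_trans WB.
      by apply: ler_sum => v _; rewrite nmM nmX nm_e expr1n mulr1.
    apply: le_trans (nmB _ _) _; rewrite nmM nmX nm_e expr1n mulr1.
    by apply: (lerD (W1 _) (W1 _)).
  have p0 := nm_1Be_gt0 t01.
  have {}bnd : nm (G l.+1) <= (B + 2) * (nm (1 - e_ t))^-1.
    by rewrite ler_pdivlMr // mulrC.
  rewrite ler_pdivrMr //; apply: le_trans bnd _.
  have := ler_wpM2l B0 (nm_1Be_ge t01); rewrite -/k => /le_trans; apply.
  have nl : (n - l)%:R = n.+1%:R - l.+1%:R :> RR by rewrite -natrB ?subSS // ltnW.
  have l0 : (l.+1%:R : RR) != 0 by rewrite pnatr_eq0.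
  have nl0 : n.+1%:R - l.+1%:R != 0 :> RR.
    by rewrite -nl pnatr_eq0 -lt0n subn_gt0.
  rewrite nl le_eqVlt; apply/orP; left; apply/eqP; rewrite /t.
  move: n0 l0 nl0; move: (n.+1%:R : RR) (l.+1%:R : RR) => N L N0 L0 NL0.
  by field; rewrite N0 L0 NL0.
apply: le_trans (ler_sum _ (fun l _ => bl l)) _.
rewrite -mulr_sumr big_split /=.
have -> : \sum_(l < n) ((n - l)%:R^-1 : RR) = harmonic_sum n.
  rewrite (reindex_inj rev_ord_inj); apply: eq_bigr => l _ /=.
  by rewrite subKn.
by rewrite -/(harmonic_sum n) le_eqVlt; apply/orP; left; apply/eqP; ring.
Qed.

(** The bound of [dft_bound] for variation 2 + 2 pi d: 2 for the ends of an interval, and at most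
    one full turn for each of d rounding errors. *)
Definition grid_const (d n : nat) : RR :=
  1 + 2 * (cos 1 ^+ 2)^-1 * (2 + 2 * pi * d%:R + 2) * harmonic_sum n.

Lemma interval_variation (W : nat -> CC) (g : nat -> RR) (lo hi n : nat) :
  (forall v, g v <= g v.+1) ->
  (forall v, W v = if (lo <= v < hi)%N then e_ (g v) else 0) ->
  \sum_(v < n) nm (W v.+1 - W v) <= 2 + 2 * pi * (g n - g 0%N).
Proof.
move=> gmono WE.
have step v : nm (W v.+1 - W v) <=
    ((v.+1 == lo) + (v.+1 == hi))%:R + 2 * pi * (g v.+1 - g v).
  have g0 : 0 <= 2 * pi * (g v.+1 - g v).
    by rewrite mulr_ge0 ?subr_ge0 // mulr_ge0 ?pi_ge0.
  have eb : nm (e_ (g v.+1) - e_ (g v)) <= 2 * pi * (g v.+1 - g v).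
    rewrite nm_eB -mulrA ler_pM2l //; apply: le_trans (norm_sin_le _) _.
    by rewrite ger0_norm // mulr_ge0 ?pi_ge0 ?subr_ge0.
  have jump : (lo <= v.+1 < hi)%N != (lo <= v < hi)%N ->
      (1 : RR) <= ((v.+1 == lo) + (v.+1 == hi))%:R.
    move=> h; rewrite ler1n lt0n addn_eq0 !eqb0.
    by apply: contra h => /andP[h1 h2]; apply/eqP; lia.
  rewrite !WE; case: ifP jump => h1; case: ifP => h2 // jump.
  - by apply: le_trans eb _; rewrite lerDr ler0n.
  - by rewrite subr0 nm_e (le_trans (jump isT)) // lerDl.
  - by rewrite sub0r nmN nm_e (le_trans (jump isT)) // lerDl.
  by rewrite subr0 nm0 addr_ge0 ?ler0n.
apply: le_trans (_ : \sum_(v < n) (((v.+1 == lo) + (v.+1 == hi))%:R +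
    2 * pi * (g v.+1 - g v)) <= _).
  by apply: ler_sum => v _; apply: step.
rewrite big_split /= -mulr_sumr; apply: lerD.
  have one m : (\sum_(v < n) (v.+1 == m) <= 1)%N.
    case: m => [|m]; first by rewrite big1.
    have [mn|mn] := ltnP m n.
      rewrite (bigD1 (Ordinal mn)) //= eqxx big1 // => i im.
      by rewrite eqSS; apply/eqP; rewrite eqb0; apply: contra im => /eqP E; apply/eqP/val_inj.
    by rewrite big1 // => i _; apply/eqP; rewrite eqb0 eqSS ltn_eqF // (leq_trans (ltn_ord i)).
  rewrite -natr_sum big_split /=; rewrite (ler_nat RR _ 2).
  exact: leq_add (one lo) (one hi).
by rewrite -(big_mkord xpredT (fun v => g v.+1 - g v)) telescope_sumr.
Qed.

Lemma grid_majorant (d r n lo hi : nat) (a : nat -> CC) (alpha : 'I_d.+1 -> RR) (T : RR) :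
  (0 < r)%N ->
  (forall b : 'I_d.+1 -> nat, nm (\sum_(v < n.+1) a v *
      e_ (\sum_(i < d.+1) (b i)%:R / (r * n.+1 ^ i.+1)%:R * v.+1%:R ^+ i.+1)) <= T) ->
  nm (\sum_(v < n.+1 | (lo <= v < hi)%N) a v * e_ (\sum_(i < d.+1) alpha i * v.+1%:R ^+ i.+1))
    <= grid_const d.+1 n * T.
Proof.
move=> r0 HT.
pose P (i : 'I_d.+1) : RR := (r * n.+1 ^ i.+1)%:R.
have P0 i : 0 < P i by rewrite ltr0n muln_gt0 r0 expn_gt0.
(* Integer parts do not affect the phase at integers; removing them makes the rounded numerators
   [b i] natural numbers. *)
pose al i : RR := alpha i - (Num.floor (alpha i))%:~R.
have al0 i : 0 <= al i by rewrite subr_ge0 floor_le_tmp.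
pose b i := Num.truncn (al i * P i).
pose ga i : RR := al i - (b i)%:R / P i.
have ga_itv i : 0 <= ga i <= (P i)^-1.
  have /andP[b1 b2] : (b i)%:R <= al i * P i < (b i).+1%:R.
    by apply: truncn_itv; rewrite mulr_ge0 // ltW.
  rewrite /ga subr_ge0 ler_pdivrMr // b1 /= lerBlDr -[X in X + _]div1r -mulrDl.
  by rewrite ler_pdivlMr // addrC natr1 ltW.
pose g (v : nat) : RR := \sum_(i < d.+1) ga i * v.+1%:R ^+ i.+1.
pose W (v : nat) := if (lo <= v < hi)%N then e_ (g v) else 0.
(* Rounding down leaves nonnegative errors [ga i], so the residual phase is monotone and its
   variation is its total increase. *)
have gmono v : g v <= g v.+1.
  apply: ler_sum => i _; apply: ler_wpM2l; first by case/andP: (ga_itv i).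
  by rewrite lerXn2r ?nnegrE ?ler0n // ler_nat.
have gn : g n - g 0%N <= d.+1%:R.
  rewrite lerBlDr -[X in X <= _]addr0 lerD //; last first.
    by apply: sumr_ge0 => i _; rewrite mulr_ge0 ?exprn_ge0 //; case/andP: (ga_itv i).
  apply: le_trans (_ : \sum_(i < d.+1) 1 <= _); last by rewrite sumr_const card_ord.
  apply: ler_sum => i _; case/andP: (ga_itv i) => _ gi.
  apply: le_trans (ler_wpM2r _ gi) _; first by rewrite exprn_ge0.
  rewrite mulrC ler_pdivrMr // mul1r /P -natrX ler_nat leq_pmull //.
have W1 v : nm (W v) <= 1.
  by rewrite /W; case: ifP => _; rewrite ?nm_e ?nm0 ?ler01.
have WV : \sum_(v < n) nm (W v.+1 - W v) <= 2 + 2 * pi * d.+1%:R.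
  apply: le_trans (@interval_variation W g lo hi n gmono (fun v => erefl)) _.
  by rewrite lerD2l ler_wpM2l // mulr_ge0 ?pi_ge0.
have [c [cE cb]] := dft_bound W1 WV.
have phase v : e_ (\sum_(i < d.+1) alpha i * v.+1%:R ^+ i.+1) =
    e_ (\sum_(i < d.+1) (b i)%:R / P i * v.+1%:R ^+ i.+1) * e_ (g v).
  rewrite -e_D -(e_Dint (_ + g v) (\sum_(i < d.+1) Num.floor (alpha i) * (v.+1)%:Z ^+ i.+1)).
  congr e_; rewrite rmorph_sum /= -!big_split; apply: eq_bigr => i _ /=.
  rewrite rmorphM rmorphXn /= -pmulrn /ga /al.
  by move: (_%:~R) (_ / _) (_ ^+ _) => x y z; ring.
have T0 : 0 <= T by apply: le_trans (HT (fun _ => 0%N)); apply: nm_ge0.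
(* The character l v/(n+1) raises the numerator of the linear coefficient by l r, as that
   denominator is r (n+1). The variable is v + 1 rather than v, hence the constant phase -
   l/(n+1). *)
have -> : \sum_(v < n.+1 | (lo <= v < hi)%N) a v * e_ (\sum_(i < d.+1) alpha i * v.+1%:R ^+ i.+1)
  = \sum_(l < n.+1) c l * e_ (- (l%:R / n.+1%:R)) * \sum_(v < n.+1) a v *
      e_ (\sum_(i < d.+1) ((b i + (i == ord0) * (l * r))%N%:R / P i) * v.+1%:R ^+ i.+1).
  transitivity (\sum_(v < n.+1) a v * e_ (\sum_(i < d.+1) (b i)%:R / P i * v.+1%:R ^+ i.+1) * W v).
    rewrite big_mkcond; apply: eq_bigr => v _; rewrite /W.
    by case: ifP => _; rewrite ?mulr0 // phase mulrA.
  under eq_bigr => v _ do rewrite cE // mulr_sumr.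
  rewrite exchange_big; apply: eq_bigr => l _ /=; rewrite mulr_sumr.
  apply: eq_bigr => v _.
  have -> : \sum_(i < d.+1) ((b i + (i == ord0) * (l * r))%N%:R / P i) * v.+1%:R ^+ i.+1
    = \sum_(i < d.+1) (b i)%:R / P i * v.+1%:R ^+ i.+1 + (l%:R / n.+1%:R + l%:R * v%:R / n.+1%:R)
      :> RR.
    under eq_bigr do rewrite natrD mulrDl mulrDl.
    rewrite big_split /=; congr (_ + _); rewrite big_ord_recl /= big1 ?addr0 => [|i _].
      rewrite mul1n expr1 /P expn1 !natrM -[v.+1%:R]natr1.
      have nn : (n.+1%:R : RR) != 0 by rewrite pnatr_eq0.
      have rr : (r%:R : RR) != 0 by rewrite pnatr_eq0 -lt0n.
      by move: (n.+1%:R : RR) nn => N N0; field; rewrite N0 rr.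
    by rewrite mul0n mul0r mul0r.
  rewrite !e_D; have := e_N (l%:R / n.+1%:R).
  set x := e_ (- (l%:R / n.+1%:R)); set y := e_ (l%:R / n.+1%:R).
  set z := e_ (\sum_(i < _) _); set t := e_ (l%:R * _ / _).
  by move: x y z t => x y z t xy; rewrite -[LHS]mul1r -xy; ring.
apply: le_trans (nm_sum _ _ _) _.
apply: le_trans (_ : \sum_(l < n.+1) nm (c l) * T <= _).
  by apply: ler_sum => l _; rewrite !nmM nm_e mulr1 ler_wpM2l ?nm_ge0.
by rewrite -mulr_suml ler_wpM2r.
Qed.

Lemma meval_line (n d : nat) (F : mpoly.mpoly n RR) (x u : 'I_n -> RR) :
  mtdeg F = d ->
  exists al : nat -> RR, forall t : RR,
    mpoly.meval (fun i => x i + u i * t) F = \sum_(j < d.+1) al j * t ^+ j.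
Proof.
move=> Fd.
pose P : {poly RR} := \sum_(m <- mpoly.msupp F) mpoly.mcoeff m F *: \prod_(i < n)
  ((x i)%:P + u i *: 'X) ^+ mpoly.fun_of_multinom m i.
have sP : (size P <= d.+1)%N.
  rewrite -Fd /mtdeg /P; elim: (mpoly.msupp F) => [|m s IHs].
    by rewrite !big_nil size_poly0.
  rewrite !big_cons -maxnSS; apply: leq_trans (size_polyD _ _) _.
  rewrite geq_max !leq_max IHs orbT andbT; apply/orP; left.
  apply: leq_trans (size_scale_leq _ _) _.
  apply: leq_trans (_ : ((\sum_(i < n) mpoly.fun_of_multinom m i).+1 <= _)%N);
    last by rewrite ltnS -mpoly.mdegE.
  elim/big_rec2: _ => [|i q N _ sN]; first by rewrite size_poly1.
  have s1 : (size (((x i)%:P + u i *: 'X) ^+ mpoly.fun_of_multinom m i)%R <=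
    (mpoly.fun_of_multinom m i).+1)%N.
    apply: leq_trans (size_poly_exp_leq _ _) _; rewrite ltnS.
    have s2 : (size ((x i)%:P + u i *: 'X)%R <= 2)%N.
      apply: leq_trans (size_polyD _ _) _; rewrite geq_max (leq_trans (size_polyC_leq1 _)) //.
      by apply: leq_trans (size_scale_leq _ _) _; rewrite size_polyX.
    by rewrite -[X in (_ <= X)%N]mul1n leq_mul2r -subn1 leq_subLR s2 orbT.
  apply: leq_trans (size_polyMleq _ _) _.
  by rewrite -ltnS; move: s1 sN; case: (size _) => [|a]; case: (size _) => [|b] /=; lia.
exists (fun j => P`_j) => t.
rewrite -(horner_coef_wide t sP) /P horner_sum mpoly.mevalE; apply: eq_bigr => m _.
rewrite hornerZ horner_prod; congr (_ * _); apply: eq_bigr => i _.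
by rewrite horner_exp hornerD hornerC hornerZ hornerX.
Qed.

(** * Character sums *)

Lemma arch_complex (x : CC) : exists n : nat, `|x| < n%:R.
Proof.
exists (Num.truncn (nm x)).+1.
by rewrite normcE_nm -(rmorph_nat (real_complex RR)) ltcR truncnS_gt.
Qed.

Lemma sqrtC_nat (m : nat) : sqrtC (m%:R : CC) = ((Num.sqrt m%:R : RR)%:C)%C.
Proof.
have -> : (m%:R : CC) = ((Num.sqrt m%:R : RR)%:C)%C ^+ 2.
  by rewrite -rmorphXn /= sqr_sqrtr ?ler0n // rmorph_nat.
by rewrite sqrCK // ler0c sqrtr_ge0.
Qed.

Section DirichletCharacter.
Variables (q : nat) (chi : int -> CC).
Hypothesis pr_q : prime q.
Hypothesis chiD : dirichlet_char q chi.

Lemma dir_M a b : chi (a * b) = chi a * chi b. Proof. by case: chiD. Qed.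

Lemma dir_1 : chi 1 = 1.
Proof.
have [_ _ /(_ 1) c1] := chiD; have : chi 1 != 0 by apply/c1; rewrite /coprimez gcd1z.
by move=> n0; apply: (mulfI n0); rewrite -dir_M !mulr1.
Qed.

Lemma dir_addn a (k : nat) : chi (a + k%:Z * q%:Z) = chi a.
Proof.
have [_ per _] := chiD; elim: k => [|k IHk]; first by rewrite mul0r addr0.
by rewrite intS mulrDl mul1r [q%:Z + _]addrC addrA per.
Qed.

Lemma dir_addz a (k : int) : chi (a + k * q%:Z) = chi a.
Proof.
case: k => k; first exact: dir_addn.
by rewrite NegzE mulNr -[LHS](dir_addn _ k.+1) subrK.
Qed.

Lemma dir_mod a : chi (a %% q%:Z)%Z = chi a.
Proof. by rewrite {2}(divz_eq a q%:Z) addrC dir_addz. Qed.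

Lemma dir_modn (a : nat) : chi (a %% q)%N%:Z = chi a%:Z.
Proof. by rewrite -modz_nat dir_mod. Qed.

Definition fchar (x : 'F_q) : CC := chi (x : nat)%:Z.

Lemma fchar_nat (a : nat) : fchar a%:R = chi a%:Z.
Proof. by rewrite /fchar val_Fp_nat // dir_modn. Qed.

Lemma fcharM : {morph fchar : x y / x * y}.
Proof.
move=> x y; rewrite -[x]natr_Zp -[y]natr_Zp -natrM !fchar_nat.
by rewrite PoszM dir_M.
Qed.

Lemma fchar1 : fchar 1 = 1.
Proof. by rewrite -[1 in LHS]/(1%:R) fchar_nat dir_1. Qed.

Lemma dir_eq0 : chi 0 = 0.
Proof.
have [_ _ /(_ 0) c0] := chiD; apply/eqP/negPn/negP => /c0.
rewrite coprimezE /coprime gcd0n => /eqP q1.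
by have := prime_gt1 pr_q; rewrite -[q]/(`|q%:Z|%N) q1.
Qed.

Lemma fchar0 : fchar 0 = 0. Proof. exact: dir_eq0. Qed.
End DirichletCharacter.

Lemma fchar_nontriv (q : nat) (chi : int -> CC) :
  prime q -> nontrivial_dirichlet_char q chi ->
  exists2 y : 'F_q, y != 0 & fchar chi y != 1.
Proof.
move=> pr_q [chiD [a [ca a1]]].
have q0 : q%:Z != 0 by rewrite eqz_nat -lt0n prime_gt0.
have [y ya] : exists y : nat, (a %% q%:Z)%Z = y%:Z.
  by exists `|(a %% q%:Z)%Z|%N; rewrite gez0_abs // modz_ge0.
exists y%:R; last by rewrite (fchar_nat pr_q chiD) -ya (dir_mod chiD).
have [_ _ ch] := chiD.
have : chi a != 0 by apply/ch.
rewrite -(dir_mod chiD) ya -(fchar_nat pr_q chiD); apply: contraNneq => ->.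
by rewrite (fchar0 pr_q chiD).
Qed.

Section CompleteSum.
Variables (q : nat) (chi : int -> CC).
Hypothesis pr_q : prime q.
Hypothesis chiN : nontrivial_dirichlet_char q chi.
Let chiD := chiN.1.
Local Notation F := 'F_q.

(** Modulo 2 the only unit is 1. The strict bound makes 0 ^+ (q - 2) vanish in [fchar_conj], and
    later yields U i < q_i. *)
Lemma prime_gt2 : (2 < q)%N.
Proof.
rewrite ltn_neqAle prime_gt1 // andbT; apply/eqP => q2.
have [y y0] := fchar_nontriv pr_q chiN; case/negP.
suff -> : y = 1 by rewrite fchar1.
have yq : (y < 2)%N by have := ltn_ord y;
  rewrite [X in (_ < X)%N]Fp_cast // [X in (_ < X)%N -> _](esym q2).
by move: y0; rewrite -[y]natr_Zp; case: (y : nat) yq => [|[|]].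
Qed.

Lemma fchar_conj (x : F) : (fchar chi x)^*%C = fchar chi x ^+ (q - 2).
Proof.
have [->|x0] := eqVneq x 0.
  by rewrite fchar0 // expr0n subn_eq0 leqNgt prime_gt2 conjc0.
have n1 : `|fchar chi x| = 1.
  by apply: norm_char x0 => //; [exact: fcharM | exact: fchar1].
have xq : fchar chi x ^+ (q - 2) * fchar chi x = 1.
  rewrite -exprSr.
  have X k : fchar chi x ^+ k = fchar chi (x ^+ k).
    by elim: k => [|k IHk]; rewrite ?expr0 ?fchar1 // !exprS IHk fcharM.
  rewrite X -[RHS](fchar1 pr_q chiD); congr fchar; apply: (mulfI x0).
  rewrite -exprS mulr1 -[RHS](expf_card x) card_Fp //; congr (_ ^+ _).
  by have := prime_gt2; lia.
have : fchar chi x != 0 by rewrite -normr_eq0 n1 oner_eq0.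
by move=> nz; apply: (mulIf nz); rewrite xq mulrC -sqr_normc n1 expr1n.
Qed.
End CompleteSum.

(** A translation of y moves the simple zero [j0] to the origin. The remaining points only have to
    avoid it; they may coincide with one another. *)
Lemma weil_shifted (q : nat) (X : 'F_q -> CC) (I : finType) (v : I -> 'F_q)
    (k : I -> nat) (j0 : I) :
  prime q -> {morph X : x y / x * y} -> X 0 = 0 -> X 1 = 1 ->
  (exists2 y, y != 0 & X y != 1) -> k j0 = 1%N ->
  (forall j, j != j0 -> v j != v j0) ->
  nm (\sum_y \prod_j X (y + v j) ^+ k j) <= #|I|%:R * Num.sqrt q%:R.
Proof.
move=> pr_q XM X0 X1 Xn k0 vj.
pose pts := [seq (v j - v j0, k j) | j <- enum I & j != j0].
have pts0 : all (fun a => a.1 != 0) pts.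
  apply/allP => a /mapP[j]; rewrite mem_filter => /andP[/vj jj _] -> /=.
  by rewrite subr_eq0.
have W := weil_bound pr_q arch_complex XM X0 X1 Xn pts0.
have XX x m : X x ^+ m = X (x ^+ m).
  by elim: m => [|m IHm]; rewrite ?expr0 ?X1 // !exprS IHm XM.
have E : \sum_y \prod_j X (y + v j) ^+ k j =
   \sum_y X (y * \prod_(a <- pts) (a.1 + y) ^+ a.2).
  rewrite (reindex_inj (addIr (- v j0))) /=; apply: eq_bigr => y _.
  rewrite (bigD1 j0) //= subrK k0 expr1 XM; congr (_ * _).
  rewrite big_map big_filter big_enum_cond /= (big_morph X XM X1).
  by apply: eq_big => [j|j _] //; rewrite -XX; congr (X _ ^+ _); ring.
rewrite E -lecR -normcE_nm; apply: le_trans W _.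
rewrite sqrtC_nat rmorphM /= rmorph_nat ler_wpM2r ?ler0c ?sqrtr_ge0 // ler_nat.
by rewrite size_map size_filter (leq_trans (count_size _ _)) // -cardE.
Qed.

Lemma sum_Fp (q : nat) (f : nat -> CC) : prime q ->
  \sum_(y < q) f y = \sum_(y : 'F_q) f y.
Proof.
by move=> pr_q; rewrite -(big_mkord xpredT f) -[in RHS](big_mkord xpredT f) Fp_cast.
Qed.

Lemma prod_lrshift (r : nat) (f g : 'I_(r + r) -> CC) :
  \prod_(j < r) (f (lshift r j) * g (rshift r j)) =
  \prod_(j < r + r) (if (j < r)%N then f j else g j).
Proof.
rewrite big_split big_split_ord; congr (_ * _); apply: eq_bigr => j _ /=.
  by rewrite ltn_ord.
by rewrite ltnNge leq_addr.
Qed.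

(** Conjugation is the power q - 2, which turns the product into one character of a polynomial. If
    the unique value sits in the conjugated half, the conjugate character is used instead, so that
    the exponent at [j0] is 1 in either case. *)
Lemma complete_sum_bound (q r : nat) (chi : int -> CC) (v : 'I_(r + r) -> nat) (j0 : 'I_(r + r)) :
  prime q -> nontrivial_dirichlet_char q chi ->
  (forall j, (v j < q)%N) -> (forall j, j != j0 -> v j != v j0) ->
  nm (\sum_(y < q) \prod_(j < r)
    (chi (y + v (lshift r j))%N%:Z * (chi (y + v (rshift r j))%N%:Z)^*%C))
    <= (r + r)%:R * Num.sqrt q%:R.
Proof.
move=> pr_q chiN vq vj; have chiD := chiN.1.
have vF j : j != j0 -> ((v j)%:R : 'F_q) != (v j0)%:R.
  move=> /vj; apply: contraNneq => /(congr1 (fun x : 'F_q => x : nat)); rewrite !val_Fp_nat //.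
  by rewrite !modn_small // => ->.
have natF (y : 'F_q) j : chi (y + v j)%N%:Z = fchar chi (y + (v j)%:R).
  by rewrite -(fchar_nat pr_q chiD) natrD natr_Zp.
rewrite (sum_Fp (fun y => \prod_(j < r) (chi (y + v (lshift r j))%N%:Z *
  (chi (y + v (rshift r j))%N%:Z)^*%C)) pr_q).
have q2 := prime_gt2 pr_q chiN.
have XM := fcharM pr_q chiD; have X0 := fchar0 pr_q chiD; have X1 := fchar1 pr_q chiD.
have Xn := fchar_nontriv pr_q chiN.
have cardI : #|'I_(r + r)| = (r + r)%N by rewrite card_ord.
have [lj|lj] := boolP (j0 < r)%N.
  have := @weil_shifted q (fchar chi) _ (fun j => (v j)%:R) (fun j =>
    if j < r then 1 else q - 2)%N j0 pr_q XM X0 X1 Xn.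
  rewrite lj => /(_ erefl vF); rewrite cardI; congr (nm _ <= _).
  apply: eq_bigr => y _.
  rewrite (prod_lrshift (fun j => chi (y + v j)%N%:Z) (fun j => (chi (y + v j)%N%:Z)^*%C)).
  apply: eq_bigr => j _; rewrite natF; case: ifP => _ //.
  by rewrite (fchar_conj pr_q chiN).
pose X (x : 'F_q) : CC := (fchar chi x)^*%C.
have XM' : {morph X : x y / x * y} by move=> x y; rewrite /X XM rmorphM.
have X0' : X 0 = 0 by rewrite /X X0 conjc0.
have X1' : X 1 = 1 by rewrite /X X1 conjc1.
have Xn' : exists2 y, y != 0 & X y != 1.
  have [y y0 y1] := Xn; exists y => //; apply: contra y1 => /eqP h.
  by rewrite -[fchar _ _]conjcK -/(X y) h conjc1.
have := @weil_shifted q X _ (fun j => (v j)%:R) (fun j =>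
  if j < r then q - 2 else 1)%N j0 pr_q XM' X0' X1' Xn'.
rewrite (negPf lj) => /(_ erefl vF); rewrite cardI; congr (nm _ <= _).
apply: eq_bigr => y _.
rewrite (prod_lrshift (fun j => chi (y + v j)%N%:Z) (fun j => (chi (y + v j)%N%:Z)^*%C)).
apply: eq_bigr => j _; rewrite natF; case: ifP => _ //.
by rewrite /X -rmorphXn /= -(fchar_conj pr_q chiN) conjcK.
Qed.

(** * Moments over a grid of frequencies *)

Lemma dir_norm_le1 (q : nat) (chi : int -> CC) a : prime q ->
  dirichlet_char q chi -> nm (chi a) <= 1.
Proof.
move=> pr_q chiD.
have [y ya] : exists y : nat, (a %% q%:Z)%Z = y%:Z.
  by exists `|(a %% q%:Z)%Z|%N; rewrite gez0_abs // modz_ge0 // eqz_nat -lt0n prime_gt0.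
rewrite -(dir_mod chiD) ya -(fchar_nat pr_q chiD).
have [->|y0] := eqVneq (y%:R : 'F_q) 0; first by rewrite (fchar0 pr_q chiD) nm0 ler01.
have := norm_char pr_q (fcharM pr_q chiD) (fchar1 pr_q chiD) y0.
by rewrite normcE_nm => /(congr1 (@complex.Re RR)) /= ->.
Qed.

Lemma sum_lrshift (r : nat) (f : 'I_(r + r) -> RR) :
  \sum_(j < r + r) (if (j < r)%N then f j else - f j) =
  \sum_(j < r) f (lshift r j) - \sum_(j < r) f (rshift r j).
Proof.
rewrite big_split_ord -sumrN; congr (_ + _); apply: eq_bigr => j _ /=.
  by rewrite ltn_ord.
by rewrite ltnNge leq_addr.
Qed.

Section GridMoment.
Variables (d r m : nat).
Hypothesis r_gt0 : (0 < r)%N.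
Let P (i : 'I_d) : nat := (r * m.+1 ^ i.+1)%N.

Definition grid_phase (b : 'I_d -> nat) (v : nat) : RR :=
  \sum_(i < d) (b i)%:R / (r * m.+1 ^ i.+1)%:R * v.+1%:R ^+ i.+1.

Definition grid_sum (a : nat -> CC) (b : 'I_d -> nat) : CC :=
  \sum_(v < m.+1) a v * e_ (grid_phase b v).

(** The admissible range depends on [i]; one ordinal type large enough for all [i] and a [family]
    restriction avoid dependent functions. *)
Definition grid : {pred {ffun 'I_d -> 'I_(r * m.+1 ^ d).+1}} :=
  family (fun i : 'I_d => [pred k : 'I_(r * m.+1 ^ d).+1 | (k < r * m.+1 ^ i.+1)%N]).

Definition vinogradov_set : {set {ffun 'I_(r + r) -> 'I_m.+1}} :=
  [set v : {ffun 'I_(r + r) -> 'I_m.+1} |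
      [forall i : 'I_d,
         (\sum_(j < r) (v (lshift r j)).+1 ^ i.+1 ==
          \sum_(j < r) (v (rshift r j)).+1 ^ i.+1)%N]].

Let P_gt0 i : (0 < P i)%N. Proof. by rewrite muln_gt0 r_gt0 expn_gt0. Qed.

Definition twisted_prod (a : nat -> CC) (f : {ffun 'I_(r + r) -> 'I_m.+1}) : CC :=
  \prod_(j < r) (a (f (lshift r j)) * (a (f (rshift r j)))^*%C).

Lemma grid_sum_expand a b :
  ((nm (grid_sum a b) ^+ (2 * r))%:C)%C =
  \sum_(f : {ffun 'I_(r + r) -> 'I_m.+1}) twisted_prod a f *
    \prod_(i < d) e_ ((b i)%:R * ((\sum_(j < r) (f (lshift r j)).+1%:R ^+ i.+1)
      - \sum_(j < r) (f (rshift r j)).+1%:R ^+ i.+1) / (P i)%:R).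
Proof.
rewrite exprM rmorphXn /= nm_sqrE.
set T := grid_sum a b.
have -> : (T * T^*%C) ^+ r = \prod_(j < r + r) \sum_(v < m.+1)
    (if (j < r)%N then a v * e_ (grid_phase b v) else (a v * e_ (grid_phase b v))^*%C).
  rewrite (eq_bigr (fun j : 'I_(r + r) => if (j < r)%N then T else T^*%C)); last first.
    by move=> j _; case: ifP => _; rewrite ?rmorph_sum.
  rewrite -(prod_lrshift (fun _ => T) (fun _ => T^*%C)).
  by rewrite prodr_const card_ord.
rewrite bigA_distr_bigA /=; apply: eq_bigr => f _.
rewrite /twisted_prod (prod_lrshift (fun j => a (f j)) (fun j => (a (f j))^*%C)).
have -> : \prod_(i < d) e_ ((b i)%:R * ((\sum_(j < r) (f (lshift r j)).+1%:R ^+ i.+1)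
      - \sum_(j < r) (f (rshift r j)).+1%:R ^+ i.+1) / (P i)%:R) =
    \prod_(j < r + r) e_ (if (j < r)%N then grid_phase b (f j) else - grid_phase b (f j)).
  rewrite -(big_morph e_ e_D e_0) -(big_morph e_ e_D e_0); congr e_.
  rewrite (sum_lrshift (fun j => grid_phase b (f j))) /grid_phase.
  rewrite [X in _ = X - _]exchange_big [X in _ = _ - X]exchange_big -sumrB.
  apply: eq_bigr => i _; rewrite -!mulr_sumr -mulrBr /P mulrAC; ring.
rewrite -big_split /=; apply: eq_bigr => j _; case: ifP => _ //.
have conjM (x y : CC) : (x * y)^*%C = x^*%C * y^*%C by apply: rmorphM.
by rewrite conjM e_conj.
Qed.

Lemma grid_moment a :
  ((\sum_(b in grid) nm (grid_sum a (fun i => b i)) ^+ (2 * r))%:C)%C =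
   (\prod_(i < d) (r * m.+1 ^ i.+1))%N%:R * \sum_(f in vinogradov_set) twisted_prod a f.
Proof.
rewrite rmorph_sum /=; under eq_bigr do rewrite grid_sum_expand.
rewrite exchange_big /= mulr_sumr [RHS]big_mkcond /=; apply: eq_bigr => f _.
rewrite -mulr_sumr.
pose F i (k : 'I_(r * m.+1 ^ d).+1) := e_ (k%:R * ((\sum_(j < r) (f (lshift r j)).+1%:R ^+ i.+1)
    - \sum_(j < r) (f (rshift r j)).+1%:R ^+ i.+1) / (r * m.+1 ^ i.+1)%:R).
have -> : \sum_(b in grid) \prod_(i < d) F i (b i) =
  \prod_(i < d) \sum_(k : 'I_(r * m.+1 ^ d).+1 | (k < r * m.+1 ^ i.+1)%N) F i k.
  by rewrite bigA_distr_big_dep.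
pose L i := (\sum_(j < r) (f (lshift r j)).+1 ^ i.+1)%N.
pose R i := (\sum_(j < r) (f (rshift r j)).+1 ^ i.+1)%N.
have Fi (i : 'I_d) : \sum_(k : 'I_(r * m.+1 ^ d).+1 | (k < r * m.+1 ^ i.+1)%N) F i k = ((L i ==
  R i) * P i)%:R.
  have PN : (P i <= (r * m.+1 ^ d).+1)%N.
    by rewrite leqW // leq_mul2l (leq_pexp2l _ (ltn_ord i)) ?orbT.
  (* A sum of r powers lies between r and r V^(i+1). Less r it lies in [0, P i), so orthogonality
     modulo [P i] detects equality and not only congruence. *)
  have xb (s : 'I_r -> 'I_(r + r)) :
     (\sum_(j < r) (f (s j)).+1 ^ i.+1 = \sum_(j < r) ((f (s j)).+1 ^ i.+1).-1 + r)%N /\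
     (\sum_(j < r) ((f (s j)).+1 ^ i.+1).-1 < P i)%N.
    split.
      transitivity (\sum_(j < r) (((f (s j)).+1 ^ i.+1).-1 + 1))%N.
        by apply: eq_bigr => j _; rewrite addn1 prednK // expn_gt0.
      by rewrite big_split /= sum1_card card_ord.
    have : (\sum_(j < r) ((f (s j)).+1 ^ i.+1).-1 <= \sum_(j < r) (m.+1 ^ i.+1).-1)%N.
      apply: leq_sum => j _; rewrite -ltnS !prednK ?expn_gt0 //.
      by rewrite leq_exp2r // ltn_ord.
    rewrite sum_nat_const card_ord => /leq_ltn_trans; apply.
    by rewrite ltn_pmul2l // ltn_predL expn_gt0.
  have [Lx Lb] := xb (lshift r); have [Rx Rb] := xb (@rshift r r).
  move: Lx Lb Rx Rb; set x := (\sum_(j < r) _.-1)%N; set y := (\sum_(j < r) _.-1)%N.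
  move=> Lx Lb Rx Rb.
  have xL : L i = (x + r)%N := Lx.
  have yR : R i = (y + r)%N := Rx.
  rewrite xL yR eqn_add2r.
  have PE : P i = (P i).-1.+1 by rewrite prednK.
  have := @e_frac_orthogonal (P i).-1 x y; rewrite -PE => /(_ Lb Rb) <-.
  rewrite (big_ord_narrow PN) /=.
  apply: eq_bigr => k _; rewrite /F /=; congr e_; congr (_ * _ / _).
  have natX (s : 'I_r -> 'I_(r + r)) : \sum_(j < r) (f (s j)).+1%:R ^+ i.+1 = (\sum_(j < r)
    (f (s j)).+1 ^ i.+1)%:R :> RR.
    by rewrite natr_sum; apply: eq_bigr => j _; rewrite natrX.
  by rewrite !natX -/(L i) -/(R i) xL yR !natrD opprD addrACA subrr addr0.
rewrite [X in twisted_prod a f * X](eq_bigr _ (fun i _ => Fi i)).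
rewrite inE; case: ifP => [/forallP fJ|/negbT].
  rewrite (eq_bigr (fun i => (P i)%:R)) => [|i _]; last by rewrite (fJ i : L i == R i) mul1n.
  by rewrite -natr_prod mulrC.
rewrite negb_forall => /existsP[i ni].
by rewrite (bigD1 i) //= (negPf (ni : ~~ (L i == R i))) mul0n mul0r mulr0.
Qed.
End GridMoment.

Definition has_unique_value (r V : nat) (f : {ffun 'I_(r + r) -> 'I_V}) : bool :=
  [exists j0, forall j, (j != j0) ==> (f j != f j0)].

(** If every value is taken at least twice, there are at most r values, so [f] factors through
    ['I_r]. *)
Lemma card_no_unique_value (r V : nat) : (0 < V)%N ->
  (#|[set f : {ffun 'I_(r + r) -> 'I_V} | ~~ has_unique_value f]| <= r ^ (r + r) * V ^ r)%N.
Proof.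
move=> V0.
pose mk (s : {ffun 'I_(r + r) -> 'I_r} * {ffun 'I_r -> 'I_V}) : {ffun 'I_(r + r) -> 'I_V} :=
  [ffun j => s.2 (s.1 j)].
apply: leq_trans (_ : #|mk @: predT| <= _)%N; last first.
  apply: leq_trans (leq_imset_card _ _) _.
  by rewrite card_prod !card_ffun !card_ord.
apply: subset_leq_card; apply/fintype.subsetP => f; rewrite inE => nu.
pose S := f @: predT.
have S2 : (#|S| <= r)%N.
  have : (\sum_(x in S) 2 <= \sum_(x in S) \sum_(j in predT | f j == x) 1)%N.
    apply: leq_sum => x /imsetP[j0 _ ->].
    move: nu; rewrite negb_exists => /forallP/(_ j0); rewrite negb_forall => /existsP[j].
    rewrite negb_imply negbK => /andP[jj0 fj].
    rewrite (bigD1 j0) ?inE ?eqxx //= (bigD1 j) ?inE ?fj ?jj0 //=.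
  rewrite -partition_big_imset sum_nat_const sum1_card card_ord addnn -muln2.
  by rewrite leq_pmul2r.
pose e x := index x (enum S).
have eS j : (e (f j) < #|S|)%N by rewrite cardE index_mem mem_enum imset_f.
pose s1 : {ffun 'I_(r + r) -> 'I_r} := [ffun j => Ordinal (leq_trans (eS j) S2)].
pose s2 : {ffun 'I_r -> 'I_V} := [ffun i : 'I_r => nth (Ordinal V0) (enum S) i].
apply/imsetP; exists (s1, s2); rewrite ?inE //; apply/ffunP => j.
by rewrite !ffunE /= nth_index // mem_enum imset_f.
Qed.

Section MeanValue.
Variables (d r m n : nat) (qs : 'I_n -> nat) (chi : 'I_n -> int -> CC).
Hypothesis r_gt0 : (0 < r)%N.
Hypothesis pr_q : forall i, prime (qs i).
Hypothesis chiN : forall i, nontrivial_dirichlet_char (qs i) (chi i).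
Hypothesis mq : forall i, (m.+1 < qs i)%N.

Definition residue_box : {pred {ffun 'I_n -> 'I_(\max_(i < n) qs i)}} :=
  family (fun i : 'I_n => [pred k : 'I_(\max_(i < n) qs i) | (k < qs i)%N]).

Definition char_seq (y : 'I_n -> nat) (v : nat) : CC :=
  \prod_(i < n) chi i (y i + v.+1)%N%:Z.

Lemma sum_twisted_prod (f : {ffun 'I_(r + r) -> 'I_m.+1}) :
  \sum_(y in residue_box) twisted_prod (char_seq (fun i => y i)) f =
  \prod_(i < n) \sum_(k < qs i)
     \prod_(j < r) (chi i (k + (f (lshift r j)).+1)%N%:Z
        * (chi i (k + (f (rshift r j)).+1)%N%:Z)^*%C).
Proof.
pose G i (k : nat) := \prod_(j < r) (chi i (k + (f (lshift r j)).+1)%N%:Z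
        * (chi i (k + (f (rshift r j)).+1)%N%:Z)^*%C).
transitivity (\sum_(y in residue_box) \prod_(i < n) G i (y i)).
  apply: eq_bigr => y _; rewrite /G exchange_big /twisted_prod; apply: eq_bigr => j _.
  rewrite big_split /=; congr (_ * _); rewrite /char_seq.
  by rewrite rmorph_prod.
rewrite -(bigA_distr_big_dep _ (fun i (k : 'I_(\max_(i < n) qs i)) => G i k)).
apply: eq_bigr => i _.
have qM : (qs i <= \max_(i < n) qs i)%N by apply: (leq_bigmax i).
by rewrite (big_ord_narrow qM).
Qed.

(** Summing over residues first makes the moment a product of complete sums. With a unique value
    each coordinate has square root cancellation; [mq] keeps distinct values distinct modulo q_i.
    The other tuples are bounded trivially, and for them the Vinogradov equations are dropped. *)
Lemma mean_value :
  \sum_(y in residue_box) \sum_(b in @grid d r m)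
     nm (grid_sum r m (char_seq (fun i => y i)) (fun i => b i)) ^+ (2 * r)
  <= (\prod_(i < d) (r * m.+1 ^ i.+1))%N%:R *
     ((Jrd r d m.+1)%:R * ((r + r)%:R ^+ n * Num.sqrt (\prod_(i < n) qs i)%N%:R)
      + (r ^ (r + r) * m.+1 ^ r)%N%:R * (\prod_(i < n) qs i)%N%:R).
Proof.
set PP := (\prod_(i < d) _)%N.
pose X (f : {ffun 'I_(r + r) -> 'I_m.+1}) : CC := \sum_(y in residue_box)
  twisted_prod (char_seq (fun i => y i)) f.
have E : ((\sum_(y in residue_box) \sum_(b in @grid d r m)
     nm (grid_sum r m (char_seq (fun i => y i)) (fun i => b i)) ^+ (2 * r))%:C)%C
   = PP%:R * \sum_(f in vinogradov_set d r m) X f.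
  rewrite rmorph_sum /=; under eq_bigr do rewrite grid_moment //.
  by rewrite -mulr_sumr exchange_big.
have pos : 0 <= \sum_(y in residue_box) \sum_(b in @grid d r m)
     nm (grid_sum r m (char_seq (fun i => y i)) (fun i => b i)) ^+ (2 * r).
  by apply: sumr_ge0 => y _; apply: sumr_ge0 => b _; rewrite exprn_ge0 // nm_ge0.
rewrite -[leLHS]ger0_norm // -nm_real E nmM nm_nat ler_wpM2l ?ler0n //.
apply: le_trans (nm_sum _ _ _) _.
pose good (f : {ffun 'I_(r + r) -> 'I_m.+1}) := has_unique_value f.
have goodX f : good f -> nm (X f) <= (r + r)%:R ^+ n * Num.sqrt (\prod_(i < n) qs i)%N%:R.
  move=> /existsP[j0 /forallP uj]; rewrite /X sum_twisted_prod nm_prod.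
  have sqE : Num.sqrt (\prod_(i < n) qs i)%N%:R = \prod_(i < n) Num.sqrt (qs i)%:R :> RR.
    rewrite natr_prod; elim: (index_enum _) => [|i s IHs]; first by rewrite !big_nil sqrtr1.
    by rewrite !big_cons sqrtrM ?ler0n // IHs.
  have -> : (r + r)%:R ^+ n = \prod_(i < n) (r + r)%:R :> RR by rewrite prodr_const card_ord.
  rewrite sqE -big_split /=.
  apply: ler_prod => i _; rewrite nm_ge0 /=.
  have := @complete_sum_bound (qs i) r (chi i) (fun j => (f j).+1) j0 (pr_q i) (chiN i).
  apply=> [j|j jj0]; first by apply: leq_ltn_trans (ltn_ord _) (mq i).
  by rewrite eqSS; have := uj j; rewrite jj0.
have badX f : nm (X f) <= (\prod_(i < n) qs i)%N%:R.
  rewrite /X sum_twisted_prod nm_prod natr_prod; apply: ler_prod => i _; rewrite nm_ge0 /=.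
  apply: le_trans (nm_sum _ _ _) _.
  apply: le_trans (_ : \sum_(k < qs i) 1 <= _); last by rewrite sumr_const card_ord.
  apply: ler_sum => k _; rewrite nm_prod.
  have c1 a := dir_norm_le1 a (pr_q i) (chiN i).1.
  by apply: prodr_ile1 => j _; rewrite nm_ge0 nmM nmJ mulr_ile1 ?nm_ge0.
rewrite (bigID good) /=; apply: lerD.
  apply: le_trans (ler_sum _ (fun f h => goodX f (proj2 (andP h)))) _.
  rewrite sumr_const -[leLHS]mulr_natl ler_wpM2r ?mulr_ge0 ?sqrtr_ge0 ?exprn_ge0 ?ler0n //.
  by rewrite ler_nat /Jrd; apply: subset_leq_card; apply/fintype.subsetP => f /andP[].
apply: le_trans (ler_sum _ (fun f _ => badX f)) _.
rewrite sumr_const -[leLHS]mulr_natl ler_wpM2r ?ler0n // ler_nat.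
apply: leq_trans (@card_no_unique_value r m.+1 (ltn0Sn m)).
by apply: subset_leq_card; apply/fintype.subsetP => f /andP[_]; rewrite inE.
Qed.
End MeanValue.

(** * Counting shifts *)

(* A solution [(s, s')] is determined by the quotients of [s u' + (A - s') u] by
   [g q] and of [s] by [u / g], where [g = gcd u u']. *)
Lemma card_congruence_pairs (q A K u u' : nat) (x0 : int) :
  prime q -> (0 < u < q)%N -> (0 < u' < q)%N -> (A * (u + u') <= K * q)%N ->
  (#|[set z : 'I_A * 'I_A | ((x0 + z.1%:Z) * u'%:Z == (x0 + z.2%:Z) * u%:Z %[mod q])%Z]|
    <= K.+1 * (A * gcdn u u' %/ u).+1)%N.
Proof.
move=> pr_q /andP[u0 uq] /andP[u'0 u'q] AK.
set X := [set z | _].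
pose g := gcdn u u'; have g0 : (0 < g)%N by rewrite gcdn_gt0 u0.
have gu : (g %| u)%N by apply: dvdn_gcdl.
have gu' : (g %| u')%N by apply: dvdn_gcdr.
pose w := (u %/ g)%N; have w0 : (0 < w)%N by rewrite divn_gt0 // dvdn_leq.
have q0 := prime_gt0 pr_q.
have wE : (A %/ w = A * g %/ u)%N.
  by rewrite -[in RHS](divnK gu) -/w divnMr.
pose D (z : 'I_A * 'I_A) := (z.1 * u' + (A - z.2) * u)%N.
have DK z : (D z %/ (g * q) < K.+1)%N.
  rewrite ltnS; apply: leq_trans (_ : K * q %/ q <= _)%N; last by rewrite mulnK.
  apply: leq_trans (_ : D z %/ q <= _)%N.
    by rewrite leq_div2l // leq_pmull.
  apply: leq_div2r; apply: leq_trans AK; rewrite mulnDr /D addnC.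
  by apply: leq_add; rewrite leq_mul2r ?leq_subr ?(ltnW (ltn_ord z.1)) orbT.
have zw (z : 'I_A * 'I_A) : (z.1 %/ w < (A * g %/ u).+1)%N.
  by rewrite ltnS -wE leq_div2r // ltnW.
pose f z := (Ordinal (DK z), Ordinal (zw z)).
rewrite -[X in (_ <= X)%N](_ : #|{: 'I_K.+1 * 'I_(A * g %/ u).+1}| = _); last first.
  by rewrite card_prod !card_ord.
have finj : {in X &, injective f}; last by rewrite -(card_in_imset finj) max_card.
have XD z : z \in X -> (q%:Z %| (D z)%:Z + (x0 * (u'%:Z - u%:Z) - A%:Z * u%:Z))%Z.
  rewrite inE eqz_mod_dvd /D; congr (_ %| _)%Z.
  rewrite PoszD !PoszM -subzn; last by rewrite ltnW.
  ring.
have gD z : (g %| D z)%N by rewrite dvdn_add // dvdn_mull.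
have cgq : coprime g q.
  rewrite coprime_sym prime_coprime //; apply: contraTN uq => qg; rewrite -leqNgt.
  by apply: leq_trans (dvdn_leq g0 qg) (dvdn_leq u0 gu).
have Deq z1 z2 : z1 \in X -> z2 \in X -> (D z1 <= D z2)%N ->
    (D z1 %/ (g * q) = D z2 %/ (g * q))%N -> D z1 = D z2.
  move=> X1 X2 le12 E.
  have : (g * q %| D z2 - D z1)%N.
    rewrite Gauss_dvd // dvdn_sub //=.
    have := rpredB (XD _ X2) (XD _ X1).
    rewrite opprD addrACA subrr addr0 subzn //.
  move=> dv; apply/eqP; rewrite eqn_leq le12 -subn_eq0 /=.
  have lt : (D z2 - D z1 < g * q)%N.
    rewrite (divn_eq (D z1) (g * q)) (divn_eq (D z2) (g * q)) -E subnDl.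
    by apply: leq_ltn_trans (leq_subr _ _) _; rewrite ltn_pmod // muln_gt0 g0.
  by rewrite eqn0Ngt; apply/negP => /dvdn_leq/(_ dv); rewrite leqNgt lt.
have seq z1 z2 : D z1 = D z2 -> (z1.1 <= z2.1)%N -> (z1.1 %/ w = z2.1 %/ w)%N -> z1 = z2.
  move=> E le12 Ew.
  have E2 : (u' * (z2.1 - z1.1) + (A - z2.2) * u = (A - z1.2) * u)%N.
    apply: (@addnI (z1.1 * u')%N); move: E; rewrite /D => ->.
    by rewrite addnA [(u' * _)%N]mulnC mulnBl subnKC // leq_mul2r le12 orbT.
  have du : (u %| u' * (z2.1 - z1.1))%N.
    by rewrite -(dvdn_addl _ (dvdn_mull (A - z2.2) (dvdnn u))) E2 dvdn_mull.
  have dw : (w %| z2.1 - z1.1)%N.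
    have cw : coprime w (u' %/ g).
      rewrite /coprime -(eqn_pmul2r g0) mul1n muln_gcdl /w divnK // divnK //.
    rewrite -(Gauss_dvdr _ cw) -(dvdn_pmul2r g0) /w divnK // mulnAC divnK //.
  have Es : z1.1 = z2.1 :> nat.
    have [t Et] := dvdnP dw.
    have z2E : z2.1 = (t * w + z1.1)%N :> nat by rewrite -Et subnK.
    move: Ew; rewrite z2E divnMDl // => /eqP; rewrite -{1}[(z1.1 %/ w)%N]add0n eqn_add2r => /eqP <-.
    by rewrite mul0n add0n.
  have Es' : z1.2 = z2.2 :> nat.
    move: E2; rewrite Es subnn muln0 add0n => /eqP; rewrite eqn_pmul2r // => /eqP E2.
    by rewrite -(subKn (ltnW (ltn_ord z1.2))) -E2 subKn // ltnW.
  by case: z1 z2 Es Es' {E le12 Ew E2 du dw} => [a b] [c e] /= /val_inj-> /val_inj->.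
move=> z1 z2 X1 X2 [E1 E2].
have ED : D z1 = D z2.
  have [le12|/ltnW le21] := leqP (D z1) (D z2); first exact: Deq.
  by apply/esym/Deq.
by have [le12|/ltnW le21] := leqP z1.1 z2.1; [apply: seq | apply/esym/seq].
Qed.

(** With g the gcd and t = g a the summand is 1/a. Keeping only g | t', which has at most U/g
    solutions t', separates the sum into two harmonic sums. *)
Lemma sum_gcd_div (U : nat) :
  \sum_(t < U) \sum_(t' < U) (gcdn t.+1 t'.+1)%:R / t.+1%:R <= U%:R * harmonic_sum U ^+ 2.
Proof.
pose F (g a t t' : nat) : RR := ((g.+1 * a.+1 == t.+1)%N && (g.+1 %| t'.+1)%N)%:R * a.+1%:R^-1.
have F0 g a t t' : 0 <= F g a t t' by rewrite mulr_ge0 ?ler0n // invr_ge0 ler0n.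
apply: le_trans (_ : \sum_(t < U) \sum_(t' < U) \sum_(g < U) \sum_(a < U) F g a t t' <= _).
  apply: ler_sum => t _; apply: ler_sum => t' _.
  pose g := gcdn t.+1 t'.+1; have g0 : (0 < g)%N by rewrite gcdn_gt0.
  have gt : (g %| t.+1)%N := dvdn_gcdl _ _.
  pose a := (t.+1 %/ g)%N; have a0 : (0 < a)%N by rewrite divn_gt0 // dvdn_leq.
  have gU : (g.-1 < U)%N by rewrite prednK // (leq_trans (dvdn_leq _ gt)).
  have aU : (a.-1 < U)%N by rewrite prednK // (leq_trans (leq_div _ _)).
  rewrite (bigD1 (Ordinal gU)) //= (bigD1 (Ordinal aU)) //= -addrA.
  rewrite ler_wpDr //; last first.
    rewrite /F /= !prednK // mulnC divnK // eqxx dvdn_gcdr mul1r.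
    have tE : t.+1%:R = a%:R * g%:R :> RR by rewrite -natrM divnK.
    by rewrite tE invfM -/g mulrCA mulfV ?mulr1 // pnatr_eq0 -lt0n.
  by rewrite addr_ge0 // sumr_ge0 // => i _; rewrite ?sumr_ge0.
under eq_bigr do rewrite exchange_big; rewrite exchange_big /=.
apply: le_trans (_ : \sum_(g < U) \sum_(a < U) (U%:R * g.+1%:R^-1) * a.+1%:R^-1 <= _).
  apply: ler_sum => g _.
  under eq_bigr do rewrite exchange_big; rewrite exchange_big /=.
  apply: ler_sum => a _.
  under eq_bigr do rewrite -mulr_suml; rewrite -mulr_suml ler_wpM2r ?invr_ge0 ?ler0n //.
  have mult : \sum_(t' < U) ((g.+1 %| t'.+1)%N)%:R <= U%:R * g.+1%:R^-1 :> RR.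
    rewrite -natr_sum; have := @sum_multiples g.+1 (U %/ g.+1) U (ltn0Sn _) (leq_trunc_div _ _).
    rewrite (eq_bigr (fun t' : 'I_U => ((g.+1 %| t'.+1)%N : nat))) => [->|t' _]; last first.
      by rewrite leq_div2r // andbT.
    by rewrite ler_pdivlMr ?ltr0n // -natrM ler_nat leq_trunc_div.
  have [lt|ge] := ltnP (g.+1 * a.+1).-1 U; last first.
    rewrite big1 ?mulr_ge0 ?invr_ge0 ?ler0n // => t _; apply: big1 => t' _.
    rewrite (_ : (_ == _)%N = false) //; apply/negbTE/eqP => E.
    by move: ge; rewrite E /= leqNgt ltn_ord.
  rewrite (bigD1 (Ordinal lt)) //= [X in _ + X]big1 ?addr0 => [|t nt]; last first.
    apply: big1 => t' _; rewrite (_ : (_ == _)%N = false) //.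
    by apply: contraNF nt => /eqP E; apply/eqP/val_inj; rewrite -[LHS]/(t.+1.-1) -E.
  apply: le_trans mult; apply: ler_sum => t' _; rewrite ler_nat.
  by case: (_ == _); case: (_ %| _)%N.
rewrite exprS expr1 mulrA.
under eq_bigr do rewrite -mulr_sumr; rewrite -mulr_suml -mulr_sumr.
by rewrite /harmonic_sum.
Qed.

Lemma congruence_count (q A K U : nat) (x0 : int) : prime q -> (U < q)%N -> (U <= A)%N ->
  (A * (U + U) <= K * q)%N ->
  ((\sum_(z : 'I_A * 'I_U) \sum_(z' : 'I_A * 'I_U)
     (((x0 + z.1%:Z) * z'.2.+1%:Z == (x0 + z'.1%:Z) * z.2.+1%:Z %[mod q])%Z : nat))%N%:R : RR)
   <= K.+1%:R * (A * U)%N%:R * (1 + harmonic_sum U ^+ 2).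
Proof.
move=> pr_q Uq UA AK.
pose N (t t' : 'I_U) := #|[set z : 'I_A * 'I_A | ((x0 + z.1%:Z) * t'.+1%:Z == (x0 + z.2%:Z)
  * t.+1%:Z %[mod q])%Z]|.
have -> : (\sum_(z : 'I_A * 'I_U) \sum_(z' : 'I_A * 'I_U)
     (((x0 + z.1%:Z) * z'.2.+1%:Z == (x0 + z'.1%:Z) * z.2.+1%:Z %[mod q])%Z : nat)
   = \sum_(t < U) \sum_(t' < U) N t t')%N.
  rewrite -(pair_bigA _ (fun (s : 'I_A) (t : 'I_U) => \sum_(z' : 'I_A * 'I_U)
     (((x0 + s%:Z) * z'.2.+1%:Z == (x0 + z'.1%:Z) * t.+1%:Z %[mod q])%Z : nat)))%N /=.
  rewrite exchange_big /=; apply: eq_bigr => t _.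
  under eq_bigr => s _.
    rewrite -(pair_bigA _ (fun (s' : 'I_A) (t' : 'I_U) =>
     (((x0 + s%:Z) * t'.+1%:Z == (x0 + s'%:Z) * t.+1%:Z %[mod q])%Z : nat)))%N /=.
    rewrite exchange_big /=.
    over.
  rewrite exchange_big /=; apply: eq_bigr => t' _.
  rewrite pair_bigA /= /N -sum1_card [RHS]big_mkcond /=; apply: eq_bigr => z _.
  by rewrite inE; case: ifP.
have Nb t t' : (N t t')%:R <= K.+1%:R * (1 + A%:R * ((gcdn t.+1 t'.+1)%:R / t.+1%:R)) :> RR.
  apply: le_trans (_ : (K.+1 * (A * gcdn t.+1 t'.+1 %/ t.+1).+1)%N%:R <= _).
    rewrite ler_nat; apply: card_congruence_pairs => //.
    - by rewrite /= (leq_ltn_trans (ltn_ord t)).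
    - by rewrite /= (leq_ltn_trans (ltn_ord t')).
    by apply: leq_trans AK; rewrite leq_mul2l leq_add ?orbT.
  rewrite natrM ler_wpM2l ?ler0n // -natr1 addrC lerD2l mulrA -natrM.
  by rewrite ler_pdivlMr ?ltr0n // -natrM ler_nat leq_trunc_div.
rewrite natr_sum; apply: le_trans (_ : \sum_(t < U) \sum_(t' < U)
   K.+1%:R * (1 + A%:R * ((gcdn t.+1 t'.+1)%:R / t.+1%:R)) <= _).
  by apply: ler_sum => t _; rewrite natr_sum; apply: ler_sum => t' _; apply: Nb.
under eq_bigr do rewrite -mulr_sumr big_split /= -mulr_sumr sumr_const card_ord.
rewrite -mulr_sumr big_split /= -mulr_sumr sumr_const card_ord -mulrA ler_wpM2l ?ler0n //.
rewrite mulrDr mulr1; apply: lerD.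
  by rewrite -mulrnA ler_nat leq_mul2r UA orbT.
by rewrite natrM -mulrA ler_wpM2l ?ler0n // sum_gcd_div.
Qed.

Lemma AGM_weighted (k : nat) (a b c : RR) : 0 <= a -> 0 <= b -> 0 <= c ->
  a ^+ k * b * c <= ((k%:R * a + b + c) / k.+2%:R) ^+ k.+2.
Proof.
move=> a0 b0 c0.
pose E (i : 'I_k.+2) := if (i : nat) is i'.+1 then (if i' is i''.+1 then a else c) else b.
have E0 : {in 'I_k.+2, forall i, 0 <= E i}.
  by move=> i _; rewrite /E; case: (i : nat) => [|[|]].
have := (leif_AGM E0).1; rewrite card_ord.
have -> : \prod_(i in 'I_k.+2) E i = a ^+ k * b * c.
  rewrite (eq_bigl xpredT) // !big_ord_recl /= /E /=.
  by rewrite prodr_const card_ord; ring.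
have -> // : \sum_(i in 'I_k.+2) E i = k%:R * a + b + c.
rewrite (eq_bigl xpredT) // !big_ord_recl /= /E /=.
by rewrite sumr_const card_ord -mulr_natl; ring.
Qed.

(* Weighted AM-GM applied to [k] copies of [w / sum w], [w^2 / sum w^2] and
   [t^(k+2) / sum t^(k+2)], then summed. *)
Lemma holder_second_moment (Y : finType) (w t : Y -> RR) (k : nat) :
  (forall y, 0 <= w y) -> (forall y, 0 <= t y) ->
  (\sum_y w y * t y) ^+ k.+2 <=
    (\sum_y w y) ^+ k * (\sum_y w y ^+ 2) * (\sum_y t y ^+ k.+2).
Proof.
move=> w0 t0; set A := \sum_y w y; set B := \sum_y w y ^+ 2; set C := \sum_y t y ^+ k.+2.
have A0 : 0 <= A by apply: sumr_ge0.
have B0 : 0 <= B by apply: sumr_ge0 => y _; rewrite exprn_ge0.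
have C0 : 0 <= C by apply: sumr_ge0 => y _; rewrite exprn_ge0.
have Xz : (\sum_y w y * t y = 0) -> (\sum_y w y * t y) ^+ k.+2 <= A ^+ k * B * C.
  by move=> ->; rewrite expr0n /= !mulr_ge0 // exprn_ge0.
have wz : (forall y, w y = 0) -> (\sum_y w y * t y) ^+ k.+2 <= A ^+ k * B * C.
  by move=> wz; apply: Xz; apply: big1 => y _; rewrite wz mul0r.
have [/eqP Az|An] := eqVneq A 0.
  by apply: wz => y; move: Az; rewrite psumr_eq0 // => /allP/(_ y)/(_ _)/eqP->;
    rewrite ?mem_index_enum.
have [/eqP Bz|Bn] := eqVneq B 0.
  apply: wz => y; move: Bz; rewrite psumr_eq0 => [|i _]; last by rewrite exprn_ge0.
  by move=> /allP/(_ y (mem_index_enum _)); rewrite expf_eq0 => /eqP.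
have [/eqP Cz|Cn] := eqVneq C 0.
  apply: Xz; apply: big1 => y _; move: Cz; rewrite psumr_eq0 => [|i _]; last by rewrite exprn_ge0.
  by move=> /allP/(_ y (mem_index_enum _)); rewrite expf_eq0 => /eqP->; rewrite mulr0.
have Ap : 0 < A by rewrite lt_def An.
have Bp : 0 < B by rewrite lt_def Bn.
have Cp : 0 < C by rewrite lt_def Cn.
pose X := A ^+ k * B * C; have Xp : 0 < X by rewrite !mulr_gt0 // exprn_gt0.
pose G := X `^ (k.+2%:R^-1).
have Gp : 0 < G by apply: powR_gt0.
have GX : G ^+ k.+2 = X.
  by rewrite -powR_mulrn ?ltW // -powRrM mulVf ?pnatr_eq0 // powRr1 // ltW.
have kp : 0 < k.+2%:R :> RR by rewrite ltr0n.
have le y : w y * t y / G <= (k%:R * (w y / A) + w y ^+ 2 / B + t y ^+ k.+2 / C) / k.+2%:R.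
  have p0 : 0 <= w y * t y / G by rewrite divr_ge0 ?mulr_ge0 // ltW.
  have a0 : 0 <= w y / A by rewrite divr_ge0.
  have b0 : 0 <= w y ^+ 2 / B by rewrite divr_ge0 // exprn_ge0.
  have c0 : 0 <= t y ^+ k.+2 / C by rewrite divr_ge0 // exprn_ge0.
  have mu0 : 0 <= (k%:R * (w y / A) + w y ^+ 2 / B + t y ^+ k.+2 / C) / k.+2%:R.
    by rewrite divr_ge0 ?ler0n // !addr_ge0 // mulr_ge0 ?ler0n.
  have E : (w y * t y / G) ^+ k.+2 = (w y / A) ^+ k * (w y ^+ 2 / B) * (t y ^+ k.+2 / C).
    have -> : (w y * t y / G) ^+ k.+2 = w y ^+ k * w y ^+ 2 * t y ^+ k.+2 / X.
      by rewrite expr_div_n GX exprMn -exprD addn2.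
    rewrite /X expr_div_n; move: (A ^+ k) (expf_neq0 k An) (t y ^+ _) => Ak Akn tk.
    by field; rewrite Akn Bn Cn.
  have := AGM_weighted k a0 b0 c0; rewrite -E.
  by rewrite ler_pXn2r ?nnegrE.
have : (\sum_y w y * t y) / G <= 1.
  rewrite mulr_suml; apply: le_trans (ler_sum _ (fun y _ => le y)) _.
  rewrite -mulr_suml !big_split /= -mulr_sumr -!mulr_suml -/A -/B -/C !divff //.
  by rewrite ler_pdivrMr // mul1r mulr1 !natr1.
rewrite ler_pdivrMr // mul1r => /(lerXn2r k.+2) H.
rewrite -/X -GX; apply: H; rewrite nnegrE; last exact: ltW.
by apply: sumr_ge0 => y _; apply: mulr_ge0.
Qed.

(** * The shifted sums *)

Lemma convex_pred_interval (P : pred nat) (V : nat) :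
  (forall a b c, (a <= b <= c)%N -> P a -> P c -> P b) ->
  exists lo hi, forall v, (v < V)%N -> P v = (lo <= v < hi)%N.
Proof.
move=> Pc; have [exP|nP] := boolP [exists v : 'I_V, P v]; last first.
  exists 0%N, 0%N => v vV; apply/negbTE; apply: contra nP => Pv.
  by apply/existsP; exists (Ordinal vV).
have [v0 Pv0] := existsP exP.
have ex : exists v, P v && (v < V)%N by exists (v0 : nat); rewrite Pv0 /=.
have ub v : P v && (v < V)%N -> (v <= V)%N by move=> /andP[_ /ltnW].
case: (ex_minnP ex) => lo /andP[Plo loV] lomin.
case: (ex_maxnP ex ub) => hi /andP[Phi hiV] himax.
exists lo, hi.+1 => v vV; apply/idP/idP => [Pv|/andP[v1 v2]].
  by rewrite ltnS lomin ?himax ?Pv.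
by apply: (Pc lo v hi) => //; rewrite v1 -ltnS.
Qed.

(** The grid sum is periodic in every [b i], so [b] may be reduced into the grid, where a single
    term is at most the whole sum. This lets the frequency vary freely with the shift. *)
Lemma grid_sum_le_moment (d r m : nat) (a : nat -> CC) (b : 'I_d -> nat) : (0 < r)%N ->
  nm (grid_sum r m a b) <=
  (\sum_(b' in @grid d r m) nm (grid_sum r m a (fun i => b' i)) ^+ (2 * r)) `^ ((2 * r)%:R^-1).
Proof.
move=> r0; have P0 i : (0 < r * m.+1 ^ i.+1)%N by rewrite muln_gt0 r0 expn_gt0.
have bN (i : 'I_d) : (b i %% (r * m.+1 ^ i.+1) < (r * m.+1 ^ d).+1)%N.
  apply: leq_trans (ltn_pmod _ (P0 i)) _.
  by rewrite leqW // leq_mul2l (leq_pexp2l _ (ltn_ord i)) ?orbT.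
pose b' : {ffun 'I_d -> 'I_(r * m.+1 ^ d).+1} := [ffun i => Ordinal (bN i)].
have b'g : b' \in @grid d r m.
  by apply/familyP => i; rewrite ffunE inE /= ltn_pmod.
have -> : grid_sum r m a b = grid_sum r m a (fun i => b' i).
  apply: eq_bigr => v _; congr (_ * _).
  rewrite -[RHS](e_Dint _ (\sum_(i < d) (b i %/ (r * m.+1 ^ i.+1))%N%:Z * v.+1%:Z ^+ i.+1)).
  congr e_; rewrite /grid_phase rmorph_sum -big_split; apply: eq_bigr => i _ /=.
  have IE k : ((k%:Z * v.+1%:Z ^+ i.+1)%:~R : RR) = k%:R * v.+1%:R ^+ i.+1.
    by rewrite intrM rmorphXn.
  rewrite ffunE /= {1}(divn_eq (b i) (r * m.+1 ^ i.+1)) IE.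
  have Pn : ((r * m.+1 ^ i.+1)%N%:R : RR) != 0 by rewrite pnatr_eq0 -lt0n.
  rewrite natrD [X in (X + _) / _]natrM mulrDl mulfK // mulrDl addrC //.
set x := nm _.
have x0 : 0 <= x by apply: nm_ge0.
have r2 : ((2 * r)%:R : RR) != 0 by rewrite pnatr_eq0 muln_eq0 /= -lt0n.
have {1}-> : x = (x ^+ (2 * r)) `^ ((2 * r)%:R^-1).
  by rewrite -powR_mulrn // -powRrM mulfV // powRr1.
apply: ge0_ler_powR; rewrite ?invr_ge0 ?ler0n ?nnegrE ?exprn_ge0 //.
  by apply: sumr_ge0 => ? _; rewrite exprn_ge0 ?nm_ge0.
by rewrite (bigD1 b') //= lerDl sumr_ge0 // => ? _; rewrite exprn_ge0 ?nm_ge0.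
Qed.

Section ShiftedSum.
Variables (d r m n : nat) (qs h U : 'I_n -> nat) (chi : 'I_n -> int -> CC).
Variables (F : mpoly.mpoly n RR) (M H : 'I_n -> int).
Hypothesis r_gt0 : (0 < r)%N.
Hypothesis pr_q : forall i, prime (qs i).
Hypothesis chiN : forall i, nontrivial_dirichlet_char (qs i) (chi i).
Hypothesis HE : forall i, H i = (h i)%:Z.
Hypothesis UV : forall i, (U i * m.+1 <= h i)%N.
Hypothesis Uq : forall i, (U i < qs i)%N.
Hypothesis Fd : mtdeg F = d.+1.

Let N := (2 * box_bound H)%N.
Local Notation cell := ('I_N * 'I_N)%type.

Let h_lt i : (h i < box_bound H)%N.
Proof.
by rewrite ltnS -[h i]/(`|(h i)%:Z|%N) -HE; apply: (leq_bigmax i).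
Qed.

(* The pair [z = p i] stands for [x_i = M i + 1 - h i + z.1] and [u_i = z.2 + 1];
   [shift_inside p v] says that [x + u (v + 1)] lies in the box. *)
Definition shift_pairs : {pred {ffun 'I_n -> cell}} :=
  family (fun i : 'I_n => [pred z : cell | (z.1 < 2 * h i)%N && (z.2 < U i)%N]).

Definition shift_base (p : {ffun 'I_n -> cell}) (i : 'I_n) : int :=
  M i + 1 - (h i)%:Z + (p i).1%:Z.

Definition shift_point (p : {ffun 'I_n -> cell}) (v : nat) (i : 'I_n) : int :=
  shift_base p i + ((p i).2.+1 * v.+1)%N%:Z.

Definition shift_inside (p : {ffun 'I_n -> cell}) (v : nat) : bool :=
  [forall i, (h i <= (p i).1 + (p i).2.+1 * v.+1 < 2 * h i)%N].

Let term (x : 'I_n -> int) : CC :=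
  (\prod_(i < n) chi i (x i)) * e_ (mpoly.meval (fun i => (x i)%:~R) F).

(** For fixed v and u each point of the box comes from exactly one x. Since u v <= U V <= h, that x
    lies in the range of length 2 h, so the identity has no boundary error. *)
Lemma shift_identity v : (v < m.+1)%N ->
  \sum_(p in shift_pairs | shift_inside p v) term (shift_point p v) =
  (\prod_(i < n) U i)%N%:R * char_exp_sum chi F M H.
Proof.
move=> vm.
have subh (x k : nat) : (k <= x)%N -> (x < 2 * k)%N -> (x - k < k)%N by clear; lia.
pose hit (p : {ffun 'I_n -> cell}) (j : {ffun 'I_n -> 'I_(box_bound H)}) i :=
  ((p i).1 + (p i).2.+1 * v.+1 == j i + h i)%N.
pose C (i : 'I_n) (z : cell) := (z.1 < 2 * h i)%N && (z.2 < U i)%N.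
transitivity (\sum_(p in shift_pairs) \sum_(j in box_idx H)
   (if [forall i, hit p j i] then term (box_pt M j) else 0)).
  rewrite [LHS]big_mkcondr; apply: eq_bigr => p _; case: ifPn => [/forallP ins|nins].
    have jb i : ((p i).1 + (p i).2.+1 * v.+1 - h i < box_bound H)%N.
      by case/andP: (ins i) => h1 h2; apply: ltn_trans (subh _ _ h1 h2) (h_lt i).
    pose j0 : {ffun 'I_n -> 'I_(box_bound H)} := [ffun i => Ordinal (jb i)].
    have j0b : j0 \in box_idx H.
      rewrite inE; apply/forallP => i; rewrite HE ffunE ltz_nat /=.
      by case/andP: (ins i) => h1 h2; apply: subh.
    rewrite (bigD1 j0) //= big1 ?addr0 => [|j /andP[_ jj]].
      rewrite (_ : [forall i, _] = true); last first.
        by apply/forallP => i; rewrite /hit ffunE /= subnK //; case/andP: (ins i).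
      have E : shift_point p v = box_pt M j0.
        apply: funext => i; rewrite /shift_point /box_pt ffunE /=.
        have /andP[h1 _] := ins i; rewrite -subzn // PoszD /shift_base; ring.
      by rewrite E.
    case: ifP => // /forallP hj; case/eqP: jj; apply/ffunP => i; apply: val_inj.
    by rewrite ffunE /= (eqP (hj i)) addnK.
  rewrite big1 // => j; rewrite inE => /forallP jb; case: ifP => // /forallP hj.
  case/negP: nins; apply/forallP => i; rewrite (eqP (hj i)) leq_addl /=.
  by have := jb i; rewrite HE ltz_nat mul2n -addnn ltn_add2r.
rewrite exchange_big /= /char_exp_sum mulr_sumr; apply: eq_bigr => j.
rewrite inE => /forallP jb.
transitivity (\sum_(p in shift_pairs) ([forall i, hit p j i] : nat)%:R * term (box_pt M j)).
  by apply: eq_bigr => p _; case: ifP => _; rewrite ?mul1r ?mul0r.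
rewrite -mulr_suml -natr_sum; congr (_%:R * _).
transitivity (\sum_(p in shift_pairs) \prod_(i < n) (hit p j i : nat))%N.
  apply: eq_bigr => p _; case: (boolP [forall i, hit p j i]) => [/forallP hp|].
    by rewrite big1 // => i _; rewrite hp.
  by rewrite negb_forall => /existsP[i ni]; rewrite (bigD1 i) //= (negPf ni).
rewrite /shift_pairs /hit.
rewrite -(bigA_distr_big_dep _ (fun i (z : cell) => (z.1 + z.2.+1 * v.+1 == j i + h i)%N : nat)).
apply: eq_bigr => i _.
have UN : (U i <= N)%N.
  apply: leq_trans (leq_trans _ (UV i)) _; first by rewrite leq_pmulr.
  by rewrite (leq_trans (ltnW (h_lt i))) // leq_pmull.
have shift_le (z : 'I_(U i)) : (z.+1 * v.+1 <= h i)%N.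
  by apply: leq_trans (UV i); rewrite leq_mul.
have jh : (j i < h i)%N by have := jb i; rewrite HE ltz_nat.
transitivity (\sum_(z2 < N | (z2 < U i)%N) 1)%N; last first.
  by rewrite (big_ord_narrow UN) sum1_card card_ord.
transitivity (\sum_(z1 < N) \sum_(z2 < N)
  if (z1 < 2 * h i)%N && (z2 < U i)%N then (z1 + z2.+1 * v.+1 == j i + h i)%N : nat else 0)%N.
  by rewrite pair_bigA /= big_mkcond; apply: eq_bigr => z _.
rewrite exchange_big [RHS]big_mkcond; apply: eq_bigr => z2 _.
case: ifP => z2U; last by rewrite big1 // => z1 _; rewrite andbF.
have sl := shift_le (Ordinal z2U); rewrite /= in sl.
have z1N : (j i + h i - z2.+1 * v.+1 < N)%N.
  apply: leq_ltn_trans (leq_subr _ _) _; rewrite /N mul2n -addnn.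
  by have := h_lt i; lia.
rewrite (bigD1 (Ordinal z1N)) //= andbT big1 => [|z1 nz].
  rewrite subnK ?eqxx; last by rewrite (leq_trans sl) // leq_addl.
  by rewrite ifT // (leq_ltn_trans (leq_subr _ _)) // mul2n -addnn ltn_add2r.
case: ifP => // _; apply/eqP; rewrite eqb0; apply: contra nz => /eqP E.
by apply/eqP/val_inj; rewrite /= -E addnK.
Qed.

Definition pair_base (i : 'I_n) (z : cell) : int := M i + 1 - (h i)%:Z + z.1%:Z.

(** The residue x/u modulo q_i. The Bezout coefficient from [egcdn] is the inverse of u, which
    exists because u <= U i < q_i. *)
Definition pair_residue (i : 'I_n) (z : cell) : nat :=
  `|((pair_base i z * (egcdn z.2.+1 (qs i)).1%:Z) %% (qs i)%:Z)%Z|%N.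

Let q0 i : (qs i)%:Z != 0. Proof. by rewrite eqz_nat -lt0n prime_gt0. Qed.

Lemma pair_residue_lt i z : (pair_residue i z < qs i)%N.
Proof.
rewrite /pair_residue -ltz_nat gez0_abs ?modz_ge0 //.
by rewrite ltz_pmod // ltz_nat prime_gt0.
Qed.

Lemma pair_residueE i (z : cell) : (z.2 < U i)%N ->
  exists c : int, pair_base i z = z.2.+1%:Z * (pair_residue i z)%:Z + c * (qs i)%:Z.
Proof.
move=> zU; set b := pair_base i z; set w := (egcdn z.2.+1 (qs i)).1.
have rE : (pair_residue i z)%:Z = b * w%:Z - ((b * w%:Z) %/ (qs i)%:Z)%Z * (qs i)%:Z.
  by rewrite /pair_residue gez0_abs ?modz_ge0.
have cop : gcdn z.2.+1 (qs i) = 1%N.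
  apply/eqP; rewrite -/(coprime _ _) coprime_sym prime_coprime //.
  apply/negP => /dvdn_leq; rewrite ltn0Sn => /(_ isT).
  by rewrite leqNgt (leq_ltn_trans _ (Uq i)).
have wE : (w * z.2.+1 = (egcdn z.2.+1 (qs i)).2 * qs i + 1)%N.
  by rewrite /w; case: egcdnP => //= km kn -> _; rewrite cop.
have wEZ : w%:Z * z.2.+1%:Z = (egcdn z.2.+1 (qs i)).2%:Z * (qs i)%:Z + 1.
  by rewrite -!PoszM wE PoszD.
exists (z.2.+1%:Z * ((b * w%:Z) %/ (qs i)%:Z)%Z - b * (egcdn z.2.+1 (qs i)).2%:Z).
have alg (W T D K Q : int) : W * T = K * Q + 1 -> b = T * (b * W - D * Q) + (T * D - b * K) * Q.
  by move=> E; have -> : T * (b * W - D * Q) = b * (W * T) - T * D * Q by [ring]; rewrite E; ring.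
by rewrite rE; exact: alg wEZ.
Qed.

Definition pair_map (p : {ffun 'I_n -> cell}) : {ffun 'I_n -> 'I_(\max_(i < n) qs i)} :=
  [ffun i => Ordinal (leq_trans (pair_residue_lt i (p i)) (leq_bigmax i))].

Lemma pair_map_box p : pair_map p \in @residue_box n qs.
Proof. by apply/familyP => i; rewrite ffunE inE /= pair_residue_lt. Qed.

(** Here chi(x + u v) = chi(u) chi(x/u + v) isolates the dependence on the residues. All coordinates
    increase with v, so the v inside the box form an interval, as [grid_majorant] requires. *)
Lemma inner_sum_bound p T : p \in shift_pairs ->
  (forall b : 'I_d.+1 -> nat, nm (grid_sum r m (char_seq chi (fun i => pair_map p i)) b) <= T) ->
  nm (\sum_(v < m.+1 | shift_inside p v) term (shift_point p v)) <= grid_const d.+1 m * T.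
Proof.
move=> /familyP pP HT.
have pU i : ((p i).2 < U i)%N by have /andP[] := pP i.
have [|lo [hi lohi]] := @convex_pred_interval (shift_inside p) m.+1.
  move=> x y z /andP[xy yz] /forallP px /forallP pz; apply/forallP => i.
  have /andP[px1 _] := px i; have /andP[_ pz2] := pz i.
  rewrite (leq_trans px1) ?leq_add2l ?leq_mul2l ?ltnS ?xy ?orbT //=.
  by apply: leq_ltn_trans pz2; rewrite leq_add2l leq_mul2l ltnS yz orbT.
have [al alE] := meval_line (fun i => (shift_base p i)%:~R) (fun i => (p i).2.+1%:R) Fd.
pose u := \prod_(i < n) chi i (p i).2.+1%:Z.
have termE v : term (shift_point p v) = u * e_ (al 0%N) *
   (char_seq chi (fun i => pair_map p i) v * e_ (\sum_(i < d.+1) al i.+1 * v.+1%:R ^+ i.+1)).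
  have -> : term (shift_point p v) = (u * char_seq chi (fun i => pair_map p i) v) *
      e_ (mpoly.meval (fun i => (shift_base p i)%:~R + (p i).2.+1%:R * v.+1%:R) F).
    congr (_ * e_ _); last first.
      by congr (mpoly.meval _ _); apply: funext => i; rewrite /shift_point rmorphD /= -pmulrn natrM.
    rewrite /u /char_seq -big_split; apply: eq_bigr => i _ /=.
    rewrite -(dir_M (chiN i).1) ffunE /=.
    have [c E] := pair_residueE (pU i).
    rewrite /shift_point (_ : shift_base p i = pair_base i (p i)) // E.
    rewrite -[RHS](dir_addz (chiN i).1 _ c); congr (chi i _).
    by rewrite PoszM PoszD; ring.
  rewrite alE big_ord_recl expr0 mulr1 e_D /=.
  by rewrite -!mulrA; congr (_ * _); rewrite mulrCA.
have u1 : nm u <= 1.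
  rewrite /u nm_prod; apply: prodr_ile1 => i _.
  by rewrite nm_ge0 (dir_norm_le1 _ (pr_q i) (chiN i).1).
have T0 : 0 <= T by apply: le_trans (HT (fun _ => 0%N)); apply: nm_ge0.
have -> : \sum_(v < m.+1 | shift_inside p v) term (shift_point p v) =
   u * e_ (al 0%N) * \sum_(v < m.+1 | (lo <= v < hi)%N) char_seq chi (fun i => pair_map p i) v
      * e_ (\sum_(i < d.+1) al i.+1 * v.+1%:R ^+ i.+1).
  by rewrite mulr_sumr; apply: eq_big => [v|v _]; [exact: lohi | exact: termE].
rewrite !nmM nm_e mulr1.
have := @grid_majorant d r m lo hi (char_seq chi (fun i => pair_map p i)) (fun i => al i.+1)
  T r_gt0 HT.
by apply: le_trans; rewrite ler_piMl ?nm_ge0.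
Qed.

Let moment (y : {ffun 'I_n -> 'I_(\max_(i < n) qs i)}) : RR :=
  \sum_(b in @grid d.+1 r m) nm (grid_sum r m (char_seq chi (fun i => y i)) (fun i => b i))
    ^+ (2 * r).

Lemma shifted_sum_bound :
  (\prod_(i < n) U i * m.+1)%N%:R * nm (char_exp_sum chi F M H) <=
  grid_const d.+1 m * \sum_(p in shift_pairs) moment (pair_map p) `^ ((2 * r)%:R^-1).
Proof.
have -> : (\prod_(i < n) U i * m.+1)%N%:R * nm (char_exp_sum chi F M H) =
   nm (\sum_(v < m.+1) (\prod_(i < n) U i)%N%:R * char_exp_sum chi F M H).
  by rewrite sumr_const card_ord -[_ *+ m.+1]mulr_natl !nmM !nm_nat natrM; ring.
under eq_bigr => v _ do rewrite -(shift_identity (ltn_ord v)).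
under eq_bigr do rewrite big_mkcondr.
rewrite exchange_big /=; apply: le_trans (nm_sum _ _ _) _; rewrite mulr_sumr.
apply: ler_sum => p pP; rewrite -big_mkcond /=.
by apply: inner_sum_bound => // b; apply: grid_sum_le_moment.
Qed.

Lemma card_shift_pairs : (#|shift_pairs| = \prod_(i < n) (2 * h i * U i))%N.
Proof.
rewrite -sum1_card.
transitivity (\sum_(p in shift_pairs) \prod_(i < n) 1)%N.
  by apply: eq_bigr => p _; rewrite big1.
rewrite -(bigA_distr_big_dep _ (fun (i : 'I_n) (z : cell) => 1%N)).
apply: eq_bigr => i _.
have hN : (2 * h i <= N)%N by rewrite leq_mul2l ltnW ?h_lt.
have UN : (U i <= N)%N.
  by apply: leq_trans hN; apply: leq_trans (leq_trans _ (UV i)) _; rewrite ?leq_pmulr ?leq_pmull.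
transitivity (\sum_(z1 < N | (z1 < 2 * h i)%N) \sum_(z2 < N | (z2 < U i)%N) 1)%N.
  by rewrite pair_big.
by rewrite (big_ord_narrow UN) sum1_card card_ord (big_ord_narrow hN) sum_nat_const card_ord.
Qed.

(** Equal quotients x/u = x'/u' modulo q_i give x u' = x' u modulo q_i, so the count splits into one
    congruence count per coordinate. *)
Lemma collision_count K l : (forall i, harmonic_sum (U i) <= l) ->
  (forall i, (2 * h i * (U i + U i) <= K * qs i)%N) ->
  (\sum_(p in shift_pairs) \sum_(p' in shift_pairs) (pair_map p == pair_map p'))%N%:R <=
  \prod_(i < n) (K.+1%:R * (2 * h i * U i)%N%:R * (1 + l ^+ 2)) :> RR.
Proof.
move=> Hl HK.
pose C (i : 'I_n) (z : cell) := (z.1 < 2 * h i)%N && (z.2 < U i)%N.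
pose G i (z z' : cell) := ((pair_base i z * z'.2.+1%:Z ==
  pair_base i z' * z.2.+1%:Z %[mod qs i])%Z : nat).
apply: le_trans (_ : (\prod_(i < n) \sum_(z | C i z) \sum_(z' | C i z') G i z z')%N%:R <= _).
  rewrite ler_nat bigA_distr_big_dep; apply: leq_sum => p /familyP pP.
  rewrite bigA_distr_big_dep; apply: leq_sum => p' /familyP pP'.
  have [E|//] := eqVneq (pair_map p) (pair_map p').
  rewrite big1 // => i _; rewrite /G.
  have /andP[_ pU] := pP i; have /andP[_ pU'] := pP' i.
  have [c E1] := pair_residueE pU; have [c' E2] := pair_residueE pU'.
  have rr : pair_residue i (p i) = pair_residue i (p' i).
    by move: E => /ffunP/(_ i)/(congr1 val); rewrite !ffunE.
  rewrite E1 E2 rr eqz_mod_dvd.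
  set X := (X in (_ %| X)%Z).
  have -> : X = (c * (p' i).2.+1%:Z - c' * (p i).2.+1%:Z) * (qs i)%:Z by rewrite /X; ring.
  by rewrite dvdz_mull.
rewrite natr_prod; apply: ler_prod => i _; rewrite ler0n /=.
have hN : (2 * h i <= N)%N by rewrite leq_mul2l ltnW ?h_lt.
have Uh : (U i <= 2 * h i)%N.
  by apply: leq_trans (leq_trans _ (UV i)) _; rewrite ?leq_pmulr ?leq_pmull.
have UN := leq_trans Uh hN.
have narrow (f : cell -> nat) : (\sum_(z | C i z) f z =
    \sum_(z : 'I_(2 * h i) * 'I_(U i)) f (widen_ord hN z.1, widen_ord UN z.2))%N.
  transitivity (\sum_(z1 < N | (z1 < 2 * h i)%N) \sum_(z2 < N | (z2 < U i)%N) f (z1, z2))%N.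
    by rewrite pair_big /=; apply: eq_big => [[]|[]].
  rewrite (big_ord_narrow hN); under eq_bigr do rewrite (big_ord_narrow UN).
  by rewrite pair_bigA.
rewrite narrow; under eq_bigr do rewrite narrow.
apply: le_trans (congruence_count (M i + 1 - (h i)%:Z) (pr_q i) (Uq i) Uh (HK i)) _.
rewrite ler_wpM2l ?mulr_ge0 ?ler0n // lerD2l lerXn2r ?nnegrE ?Hl //.
  by apply: sumr_ge0 => ? _; rewrite invr_ge0 ler0n.
by apply: le_trans (Hl i); apply: sumr_ge0 => ? _; rewrite invr_ge0 ler0n.
Qed.

Lemma shifted_moment K l : (forall i, harmonic_sum (U i) <= l) ->
  (forall i, (2 * h i * (U i + U i) <= K * qs i)%N) -> (forall i, (m.+1 < qs i)%N) ->
  0 <= grid_const d.+1 m ->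
  ((\prod_(i < n) U i * m.+1)%N%:R * nm (char_exp_sum chi F M H)) ^+ (2 * r) <=
  grid_const d.+1 m ^+ (2 * r) *
  ((\prod_(i < n) (2 * h i * U i))%N%:R ^+ (2 * r - 2) *
   \prod_(i < n) (K.+1%:R * (2 * h i * U i)%N%:R * (1 + l ^+ 2)) *
   ((\prod_(i < d.+1) (r * m.+1 ^ i.+1))%N%:R *
     ((Jrd r d.+1 m.+1)%:R * ((r + r)%:R ^+ n * Num.sqrt (\prod_(i < n) qs i)%N%:R)
      + (r ^ (r + r) * m.+1 ^ r)%N%:R * (\prod_(i < n) qs i)%N%:R))).
Proof.
move=> Hl HK mq gc0.
have mom0 y : 0 <= moment y by apply: sumr_ge0 => ? _; rewrite exprn_ge0 ?nm_ge0.
(* The cut-off makes sums over the whole type agree with sums over [residue_box], where [pair_map]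
   takes its values. *)
pose t y : RR := if y \in @residue_box n qs then moment y `^ ((2 * r)%:R^-1) else 0.
pose w y : RR := (\sum_(p in shift_pairs) (pair_map p == y))%N%:R.
have t0 y : 0 <= t y by rewrite /t; case: ifP => _ //; exact: powR_ge0.
have w0 y : 0 <= w y by apply: ler0n.
have sumE : \sum_(p in shift_pairs) moment (pair_map p) `^ ((2 * r)%:R^-1) = \sum_y w y * t y.
  rewrite /w; under [RHS]eq_bigr do rewrite natr_sum mulr_suml.
  rewrite exchange_big; apply: eq_bigr => p _ /=.
  rewrite (bigD1 (pair_map p)) //= eqxx mul1r big1 ?addr0 => [|y ny].
    by rewrite /t pair_map_box.
  by rewrite eq_sym (negPf ny) mul0r.
apply: le_trans (_ : (grid_const d.+1 m * \sum_y w y * t y) ^+ (2 * r) <= _).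
  apply: lerXn2r; rewrite ?nnegrE.
  - by rewrite mulr_ge0 ?ler0n ?nm_ge0.
  - by rewrite mulr_ge0 // sumr_ge0 // => y _; rewrite mulr_ge0.
  by rewrite -sumE; exact: shifted_sum_bound.
rewrite exprMn ler_wpM2l ?exprn_ge0 //.
have k2 : (2 * r = (2 * r - 2).+2)%N by move: r_gt0; clear; lia.
rewrite [X in _ ^+ X <= _]k2; apply: le_trans (holder_second_moment _ w0 t0) _.
have E1 : \sum_y w y = (\prod_(i < n) (2 * h i * U i))%N%:R.
  rewrite -card_shift_pairs -natr_sum exchange_big -sum1_card; congr (_%:R).
  apply: eq_bigr => p _ /=; rewrite (bigD1 (pair_map p)) //= eqxx big1 // => y ny.
  by rewrite eq_sym (negPf ny).
have E2 : \sum_y w y ^+ 2 <= \prod_(i < n) (K.+1%:R * (2 * h i * U i)%N%:R * (1 + l ^+ 2)).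
  apply: le_trans (collision_count Hl HK); rewrite le_eqVlt; apply/orP; left; apply/eqP.
  rewrite (eq_bigr (fun y => (\sum_(p in shift_pairs)
     (pair_map p == y) * \sum_(p' in shift_pairs) (pair_map p' == y))%N%:R)); last first.
    by move=> y _; rewrite expr2 /w -natrM big_distrl.
  rewrite -natr_sum exchange_big /=; congr (_%:R); apply: eq_bigr => p _.
  rewrite (bigD1 (pair_map p)) //= eqxx mul1n [X in (_ + X)%N]big1 ?addn0 => [|y ny].
    by apply: eq_bigr => p' _; rewrite eq_sym.
  by rewrite eq_sym (negPf ny) mul0n.
have E3 : \sum_y t y ^+ (2 * r - 2).+2 = \sum_(y in @residue_box n qs) moment y.
  rewrite [RHS]big_mkcond -k2; apply: eq_bigr => y _; rewrite /t; case: ifP => _.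
    have r2 : ((2 * r)%:R : RR) != 0 by rewrite pnatr_eq0 muln_eq0 /= -lt0n.
    by rewrite -powR_mulrn ?powR_ge0 // -powRrM mulVf // powRr1.
  by rewrite expr0n muln_eq0 /= eqn0Ngt r_gt0.
rewrite E1 E3; apply: ler_pM.
- by rewrite mulr_ge0 ?exprn_ge0 ?ler0n // sumr_ge0 // => y _; rewrite exprn_ge0.
- by apply: sumr_ge0.
- by rewrite ler_wpM2l ?exprn_ge0 ?ler0n.
exact: mean_value.
Qed.
End ShiftedSum.

(** * Bookkeeping of exponents and choice of parameters *)

Lemma powR_ge1 (a x : RR) : 1 <= a -> 0 <= x -> 1 <= a `^ x.
Proof. by move=> a1 x0; have := ler_powR a1 x0; rewrite powRr0. Qed.

(** The harmonic sum is at most 1 + ln N, and delta ln N = ln(N^delta) <= N^delta - 1. This is how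
    logarithms become part of q^o(1). *)
Lemma harmonic_sum_le (delta : RR) N : 0 < delta ->
  harmonic_sum N <= (1 + delta^-1) * N%:R `^ delta.
Proof.
move=> d0; have c0 : 0 <= 1 + delta^-1 by rewrite addr_ge0 // invr_ge0 ltW.
case: N => [|N]; first by rewrite /harmonic_sum big_ord0 mulr_ge0 // powR_ge0.
have N0 k : 0 < k.+1%:R :> RR by rewrite ltr0n.
have hl k : harmonic_sum k.+1 <= 1 + ln k.+1%:R.
  elim: k => [|k IHk].
    by rewrite /harmonic_sum big_ord_recl big_ord0 ln1 invr1 addr0.
  rewrite /harmonic_sum big_ord_recr /=; apply: le_trans (lerD IHk (lexx _)) _.
  rewrite -addrA lerD2l -lerBrDl.
  have := @le_ln1Dx RR (- k.+2%:R^-1).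
  have -> : 1 + - k.+2%:R^-1 = k.+1%:R / k.+2%:R :> RR.
    have k2 : (k.+2%:R : RR) != 0 by rewrite pnatr_eq0.
    rewrite -[X in X - _](divff k2) -[X in _ - X]mul1r -mulrBl -[k.+2%:R]natr1.
    by rewrite addrK.
  rewrite lnM ?posrE ?invr_gt0 ?N0 // lnV ?posrE ?N0 //.
  rewrite ltrN2 invf_lt1 ?N0 // (ltr_nat RR 1) => /(_ isT).
  by move: (ln k.+1%:R) (ln k.+2%:R) (k.+2%:R^-1) => x y z; lra.
apply: le_trans (hl N) _.
have x1 : 1 <= N.+1%:R `^ delta by apply: powR_ge1; rewrite ?ler1n // ltW.
have : ln (N.+1%:R `^ delta) <= N.+1%:R `^ delta - 1.
  have := @le_ln1Dx RR (N.+1%:R `^ delta - 1); rewrite [1 + _]addrC subrK; apply.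
  by rewrite ltrBrDr addNr; apply: lt_le_trans x1.
rewrite ln_powR => h; rewrite mulrDl mul1r; apply: lerD => //.
rewrite mulrC ler_pdivlMr // mulrC; apply: le_trans h _.
by rewrite gerBl.
Qed.

Lemma Dd_S d : (Dd d.+1 = Dd d + d.+1)%N.
Proof.
rewrite /Dd; have -> : (d.+1 * d.+2 = d * d.+1 + d.+1 * 2)%N by ring.
by rewrite divnDMl.
Qed.

Lemma prod_grid_size d r m : (\prod_(i < d) (r * m ^ i.+1) = r ^ d * m ^ Dd d)%N.
Proof.
elim: d => [|d IHd]; first by rewrite big_ord0.
by rewrite big_ord_recr /= IHd Dd_S expnD [(r ^ d.+1)%N]expnSr mulnACA.
Qed.

(** Here k + 2 = 2r, [W] is the product of the U_i and [B] that of the h_i. One factor [W] more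
    stands on the left than on the right; trading it for [B] costs (2 V)^n, the source of the n in
    the final exponent of q. *)
Lemma cancel_moment (k n : nat) (s V B W X Q G A R C sq : RR) :
  0 <= s -> 0 < V -> 0 < B -> 0 < W -> V <= X -> 0 <= Q -> 0 <= G -> 0 <= A ->
  0 <= R -> 0 <= C -> 0 <= sq -> B <= (2 * V) ^+ n * W ->
  (W * V * s) ^+ k.+2 <= (G * Q) ^+ k.+2 *
    ((2 ^+ n * B * W) ^+ k * ((A * Q ^+ 2) ^+ n * (2 ^+ n * B * W)) *
     (R * (C * V ^+ k.+2 * sq * Q))) ->
  s ^+ k.+2 <= G ^+ k.+2 * A ^+ n * (2 ^+ n) ^+ k.+2 * R * C *
     (Q ^+ (k.+2 + 2 * n + 1) * B ^+ k * X ^+ n * sq).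
Proof.
move=> s0 V0 B0 W0 VX Q0 G0 A0 R0 C0 sq0 BW H.
have X0 : 0 <= X := le_trans (ltW V0) VX.
pose K := G ^+ k.+2 * Q ^+ k.+2 * (2 ^+ n) ^+ k.+1 * B ^+ k.+1 * A ^+ n * Q ^+ (2 * n)
  * R * C * sq * Q.
have B0' := ltW B0; have two0 : 0 <= 2 ^+ n :> RR by rewrite exprn_ge0.
have K0 : 0 <= K by rewrite /K; do 9?apply: mulr_ge0 => //; rewrite exprn_ge0.
have H1 : W * s ^+ k.+2 <= K.
  have p0 : 0 < W ^+ k.+1 * V ^+ k.+2 by rewrite mulr_gt0 // exprn_gt0.
  rewrite -(ler_pM2l p0); move: H.
  have -> : (W * V * s) ^+ k.+2 = W ^+ k.+1 * V ^+ k.+2 * (W * s ^+ k.+2).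
    by rewrite !exprMn [W ^+ k.+2]exprS; ring.
  suff -> : (G * Q) ^+ k.+2 * ((2 ^+ n * B * W) ^+ k * ((A * Q ^+ 2) ^+ n * (2 ^+ n * B * W)) *
     (R * (C * V ^+ k.+2 * sq * Q))) = W ^+ k.+1 * V ^+ k.+2 * K by [].
  have QE : (A * Q ^+ 2) ^+ n = A ^+ n * Q ^+ (2 * n) by rewrite exprMn exprM.
  rewrite /K QE !exprMn [(2 ^+ n) ^+ k.+1]exprS [B ^+ k.+1]exprS [W ^+ k.+1]exprS.
  move: (Q ^+ (2 * n)) (2 ^+ n) => q2n t.
  by ring.
have H2 : B * s ^+ k.+2 <= (2 * X) ^+ n * K.
  apply: le_trans (_ : (2 * V) ^+ n * W * s ^+ k.+2 <= _).
    by rewrite ler_wpM2r ?exprn_ge0.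
  rewrite -mulrA; apply: ler_pM => //.
  - by rewrite exprn_ge0 // mulr_ge0 // ltW.
  - by rewrite mulr_ge0 ?exprn_ge0 // ltW.
  by apply: lerXn2r; rewrite ?nnegrE ?mulr_ge0 ?ler_pM2l // ltW.
rewrite -(ler_pM2l B0); apply: le_trans H2 _; rewrite le_eqVlt; apply/orP; left; apply/eqP.
rewrite /K exprMn !exprD expr1 [B ^+ k.+1]exprS [(2 ^+ n) ^+ k.+2]exprS.
by ring.
Qed.

Lemma box_cardE n (h : 'I_n -> nat) (H : 'I_n -> int) : (forall i, H i = (h i)%:Z) ->
  box_card H = (\prod_(i < n) h i)%N.
Proof.
move=> HE; rewrite /box_card -sum1_card.
transitivity (\sum_(j in family (fun i : 'I_n => [pred k : 'I_(box_bound H) | (k < h i)%N]))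
   \prod_(i < n) 1)%N.
  apply: eq_big => [j|j _]; last by rewrite big1.
  rewrite inE; apply/forallP/familyP => jP i.
    by have := jP i; rewrite HE ltz_nat.
  by have := jP i; rewrite HE ltz_nat.
rewrite -(bigA_distr_big_dep _ (fun (i : 'I_n) (k : 'I_(box_bound H)) => 1%N)).
apply: eq_bigr => i _.
have hb : (h i <= box_bound H)%N.
  by rewrite ltnW // ltnS -[h i]/(`|(h i)%:Z|%N) -HE; apply: (leq_bigmax i).
by rewrite (big_ord_narrow hb) sum1_card card_ord.
Qed.

Lemma prod_pairs_size n (h U : 'I_n -> nat) :
  (\prod_(i < n) (2 * h i * U i))%N%:R =
  2 ^+ n * (\prod_(i < n) h i)%N%:R * (\prod_(i < n) U i)%N%:R :> RR.
Proof.
by rewrite !big_split /= prod_nat_const card_ord !natrM natrX.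
Qed.

(** Both terms are brought to the size V^(2r) q^(1/2): the first by the mean value bound for [J],
    the second because q^(1/2) = X^kn <= (2 V)^kn and D + r + kn = 2 r. *)
Lemma vinogradov_factor (r D kn : nat) (V X q sq Q CJ J delta c : RR) :
  (2 * r = D + r + kn)%N -> 1 <= V -> V <= q -> X <= 2 * V -> 0 <= X -> X ^+ kn = sq -> sq * sq =
    q ->
  Q = q `^ delta -> 0 < delta -> 0 <= c ->
  J <= CJ * V `^ ((2 * r)%:R - D%:R + delta) ->
  forall a : RR, 0 <= a ->
  V ^+ D * (J * (a * sq) + (c * V ^+ r) * q) <= (`|CJ| * a + c * 2 ^+ kn) * V ^+ (2 * r) * sq * Q.
Proof.
move=> rE V1 Vq XV X0 Xk sqq QE d0 c0 HJ a a0.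
have V0 : 0 < V := lt_le_trans ltr01 V1.
have q1 : 1 <= q := le_trans V1 Vq.
have sq0 : 0 <= sq by rewrite -Xk exprn_ge0.
have Q1 : 1 <= Q by rewrite QE powR_ge1 // ltW.
have Q0 : 0 <= Q := le_trans ler01 Q1.
have HJ' : V ^+ D * J <= `|CJ| * V ^+ (2 * r) * Q.
  have VE : V `^ ((2 * r)%:R - D%:R + delta) = V ^+ (r + kn) * V `^ delta.
    rewrite powRD; last by rewrite (gt_eqF V0) implybT.
    have -> : (2 * r)%:R - D%:R = (r + kn)%:R :> RR by rewrite rE -addnA natrD addrC addKr.
    by rewrite powR_mulrn // ltW.
  have -> : V ^+ (2 * r) = V ^+ D * V ^+ (r + kn) by rewrite -exprD addnA -rE.
  have VQ : V `^ delta <= Q.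
    by rewrite QE; apply: ge0_ler_powR; rewrite ?nnegrE // ltW // (lt_le_trans ltr01).
  have -> : `|CJ| * (V ^+ D * V ^+ (r + kn)) * Q = V ^+ D * (`|CJ| * (V ^+ (r + kn) * Q)) by ring.
  rewrite ler_wpM2l ?exprn_ge0 ?(ltW V0) //; apply: le_trans HJ _; rewrite VE.
  apply: le_trans (_ : `|CJ| * (V ^+ (r + kn) * V `^ delta) <= _).
    by rewrite ler_wpM2r ?ler_norm // mulr_ge0 ?exprn_ge0 ?powR_ge0 // ltW.
  by rewrite ler_wpM2l // ler_wpM2l // exprn_ge0 // ltW.
have H2 : V ^+ D * V ^+ r * q <= 2 ^+ kn * V ^+ (2 * r) * sq * Q.
  have sqb : sq <= 2 ^+ kn * V ^+ kn.
    by rewrite -Xk -exprMn lerXn2r ?nnegrE // mulr_ge0 // ltW.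
  have -> : 2 ^+ kn * V ^+ (2 * r) * sq * Q = V ^+ D * V ^+ r * (sq * ((2 ^+ kn * V ^+ kn) * Q)).
    by rewrite rE !exprD; ring.
  rewrite -sqq ler_wpM2l ?mulr_ge0 ?exprn_ge0 ?(ltW V0) // ler_wpM2l //.
  by apply: le_trans sqb _; rewrite ler_peMr // mulr_ge0 ?exprn_ge0 // ltW.
have -> : V ^+ D * (J * (a * sq) + (c * V ^+ r) * q) = V ^+ D * J * (a * sq)
  + c * (V ^+ D * V ^+ r * q) by ring.
have -> : (`|CJ| * a + c * 2 ^+ kn) * V ^+ (2 * r) * sq * Q =
  `|CJ| * V ^+ (2 * r) * Q * (a * sq) + c * (2 ^+ kn * V ^+ (2 * r) * sq * Q) by ring.
by apply: lerD; [rewrite ler_wpM2r // mulr_ge0 | rewrite ler_wpM2l].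
Qed.

Theorem theorem4 (d n r : nat) :
  (0 < d)%N ->
  (exists rd : nat, is_r_d d rd /\ (rd <= r)%N) ->
  (Dd d < r)%N ->
  forall eps : RR, 0 < eps ->
  exists C : RR,
  forall (qs : 'I_n -> nat) (chi : 'I_n -> int -> RR[i])
         (F : mpoly.mpoly n RR) (M H : 'I_n -> int),
    (forall i, prime (qs i)) ->
    (forall i, nontrivial_dirichlet_char (qs i) (chi i)) ->
    mtdeg F = d ->
    (let q : RR := (\prod_(i < n) qs i)%N%:R in
     let k : RR := r%:R - (Dd d)%:R in
     (forall i, q `^ (1 / (2 * k)) < (qs i)%:R) ->
     (forall i, q `^ (1 / (2 * k)) <= (H i)%:~R /\
                (H i)%:~R <= (qs i)%:R `^ (1 / 2 + 1 / (4 * k))) ->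
     `|char_exp_sum chi F M H| <=
       ((C * ((box_card H)%:R `^ (1 - 1 / r%:R))
           * q `^ ((k + n%:R) / (4 * r%:R * k) + eps))%:C)%C).
Proof.
case: d => // d _ [rd [[okr _] rdr]] Dr eps eps0.
have r0 : (0 < r)%N by apply: leq_ltn_trans Dr.
have rR : 0 < r%:R :> RR by rewrite ltr0n.
pose kn := (r - Dd d.+1)%N; have kn0 : (0 < kn)%N by rewrite subn_gt0.
have knR : 0 < kn%:R :> RR by rewrite ltr0n.
have rE : (2 * r = Dd d.+1 + r + kn)%N by rewrite /kn; move: Dr; clear; lia.
have knE : r%:R - (Dd d.+1)%:R = kn%:R :> RR by rewrite /kn natrB // ltnW.
(* The number of factors q^delta spent: 2r from [grid_const], 2n from the harmonic sums in the
   collision count, 1 from [J]. With [delta] below, Q^E = q^(2 r eps). *)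
pose E := (2 * r + 2 * n + 1)%N.
have ER : 0 < E%:R :> RR by rewrite ltr0n /E addn1.
pose delta : RR := eps * (2 * r)%:R / E%:R.
have r2R : 0 < (2 * r)%:R :> RR by rewrite ltr0n muln_gt0.
have d0 : 0 < delta by rewrite divr_gt0 // mulr_gt0.
have [CJ HJ] := okr r rdr delta d0.
pose c1 : RR := 1 + delta^-1; have c10 : 0 <= c1 by rewrite addr_ge0 // invr_ge0 ltW.
pose kap : RR := (cos 1 ^+ 2)^-1; have kap0 : 0 <= kap by rewrite invr_ge0 sqr_ge0.
pose g : RR := 2 * kap * (2 + 2 * pi * d.+1%:R + 2).
have g0 : 0 <= g by rewrite /g !mulr_ge0 // !addr_ge0 // mulr_ge0 // mulr_ge0 ?pi_ge0.
pose G : RR := 1 + g * c1; have G0 : 0 <= G by rewrite addr_ge0 // mulr_ge0.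
(* The 9 is K + 1 for the K = 8 of [HK]. *)
pose A : RR := 9%:R * (1 + c1 ^+ 2).
have A0 : 0 <= A by rewrite mulr_ge0 ?ler0n // addr_ge0 ?sqr_ge0.
pose R : RR := (r ^ d.+1)%N%:R.
pose C2 : RR := `|CJ| * (r + r)%:R ^+ n + (r ^ (r + r))%N%:R * 2 ^+ kn.
have C20 : 0 <= C2 by rewrite addr_ge0 // mulr_ge0 ?exprn_ge0 ?ler0n.
pose C5 : RR := G ^+ (2 * r) * A ^+ n * (2 ^+ n) ^+ (2 * r) * R * C2.
have C50 : 0 <= C5 by rewrite /C5 !mulr_ge0 ?exprn_ge0 ?ler0n.
exists (C5 `^ ((2 * r)%:R^-1)) => qs chi F M H pr_q chiN Fd q k Hq HH.
have kE : k = kn%:R := knE.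
pose X : RR := q `^ (1 / (2 * k)).
have q0n : (0 < \prod_(i < n) qs i)%N by apply: prodn_gt0 => i; apply: prime_gt0.
have q1 : 1 <= q by rewrite ler1n.
have q0 : 0 < q := lt_le_trans ltr01 q1.
have qi_q i : (qs i)%:R <= q.
  rewrite ler_nat (bigD1 i) //= leq_pmulr // prodn_cond_gt0 // => j _; exact: prime_gt0.
have ek0 : 0 <= 1 / (2 * k) by rewrite kE divr_ge0 // mulr_ge0 // ltW.
have X1 : 1 <= X by apply: powR_ge1.
have X0 : 0 <= X := le_trans ler01 X1.
pose Q : RR := q `^ delta.
have Q1 : 1 <= Q by apply: powR_ge1 => //; apply: ltW.
have Q0 : 0 <= Q := le_trans ler01 Q1.
pose h i := `|H i|%N.
have HE i : H i = (h i)%:Z.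
  have [HX _] := HH i; rewrite /h gez0_abs // -(ler0z RR).
  exact: le_trans X0 HX.
have HR i : (H i)%:~R = (h i)%:R :> RR by rewrite HE.
(* V = m + 1 is the integer part of X, which is at least 1. *)
pose m := (Num.truncn X).-1.
have mE : m.+1 = Num.truncn X by rewrite prednK // truncn_gt0.
have VX : m.+1%:R <= X by rewrite mE truncn_le.
have XV : X <= 2 * m.+1%:R.
  apply: le_trans (ltW (truncnS_gt X)) _; rewrite -mE -natrM ler_nat; clear; lia.
have V1 : 1 <= m.+1%:R :> RR by rewrite ler1n.
have Xq : X <= q.
  apply: ler1_powR => //; rewrite kE ler_pdivrMr ?mulr_gt0 // mul1r -natrM ler1n.
  by rewrite muln_gt0.
(* The lower bound on q_i enters here: it keeps V below every modulus. *)
have mq i : (m.+1 < qs i)%N by rewrite -(ltr_nat RR); apply: le_lt_trans VX (Hq i).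
pose U i := (h i %/ m.+1)%N.
have mh i : (m.+1 <= h i)%N.
  by rewrite -(ler_nat RR) -HR; apply: le_trans VX _; case: (HH i).
have U0 i : (0 < U i)%N by rewrite divn_gt0.
have UV i : (U i * m.+1 <= h i)%N by apply: leq_trunc_div.
have hU i : (h i <= 2 * m.+1 * U i)%N.
  have := ltn_ceil (h i) (ltn0Sn m); rewrite -/(U i) => /ltnW h1; apply: leq_trans h1 _.
  by have := U0 i; move: (U i) => u; clear; nia.
(* The upper bound on H_i enters here: h U X <= 2 h U V <= 2 h^2 <= 2 q_i q_i^(1/(2k)) <= 2 q_i X,
   and X cancels. *)
have hUq i : (h i * U i <= 2 * qs i)%N.
  have Xp : 0 < X := lt_le_trans ltr01 X1.
  rewrite -(ler_nat RR) -(ler_pM2r Xp) !natrM.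
  apply: le_trans (_ : 2 * (h i)%:R ^+ 2 <= _).
    apply: le_trans (_ : (h i)%:R * (U i)%:R * (2 * m.+1%:R) <= _).
      by rewrite ler_wpM2l // mulr_ge0 ?ler0n.
    have -> : (h i)%:R * (U i)%:R * (2 * m.+1%:R) = 2 * ((h i)%:R * (U i * m.+1)%N%:R) :> RR.
      by rewrite natrM; ring.
    by rewrite ler_pM2l // expr2 ler_wpM2l ?ler0n // ler_nat.
  rewrite -mulrA ler_pM2l //.
  have [_ Hu] := HH i; rewrite HR in Hu.
  have qi0 : 0 < (qs i)%:R :> RR by rewrite ltr0n prime_gt0.
  apply: le_trans (_ : ((qs i)%:R `^ (1 / 2 + 1 / (4 * k))) ^+ 2 <= _).
    by rewrite lerXn2r // nnegrE ?ler0n ?powR_ge0.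
  have -> : ((qs i)%:R `^ (1 / 2 + 1 / (4 * k))) ^+ 2 = (qs i)%:R * (qs i)%:R `^ (1 / (2 * k)).
    rewrite -powR_mulrn ?powR_ge0 // -powRrM.
    have -> : (1 / 2 + 1 / (4 * k)) * 2%:R = 1 + 1 / (2 * k).
      by field; rewrite kE gt_eqF.
    by rewrite powRD ?(gt_eqF qi0) ?implybT // powRr1 // ltW.
  by rewrite ler_wpM2l ?ler0n // /X ge0_ler_powR ?nnegrE ?ler0n // ltW.
(* If U i >= q_i, then q_i^2 <= h U <= 2 q_i, against q_i > 2. *)
have Uq i : (U i < qs i)%N.
  have q3 := prime_gt2 (pr_q i) (chiN i).
  have Uh : (U i <= h i)%N by apply: leq_trans (UV i); rewrite leq_pmulr.
  rewrite ltnNge; apply/negP => qU.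
  have : (qs i * qs i <= 2 * qs i)%N.
    by apply: leq_trans (hUq i); rewrite leq_mul // (leq_trans qU).
  by rewrite leq_pmul2r ?prime_gt0 // leqNgt q3.
have HK i : (2 * h i * (U i + U i) <= 8 * qs i)%N.
  by have := hUq i; move: (h i) (U i) (qs i) => a b c; clear; nia.
have harm N : (N <= \prod_(i < n) qs i)%N -> harmonic_sum N <= c1 * Q.
  move=> Nq; apply: le_trans (harmonic_sum_le N d0) _; rewrite ler_wpM2l //.
  by rewrite ge0_ler_powR ?nnegrE ?ler0n ?ler_nat // ltW.
have Uharm i : harmonic_sum (U i) <= c1 * Q.
  by apply: harm; rewrite -(ler_nat RR); apply: le_trans (qi_q i); rewrite ler_nat ltnW.
have mharm : harmonic_sum m <= c1 * Q.
  apply: harm; rewrite -(ler_nat RR); apply: le_trans Xq; apply: le_trans VX.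
  by rewrite ler_nat.
have hs0 N : 0 <= harmonic_sum N by apply: sumr_ge0 => ? _; rewrite invr_ge0 ler0n.
have gcE : grid_const d.+1 m = 1 + g * harmonic_sum m by [].
have gc0 : 0 <= grid_const d.+1 m by rewrite gcE addr_ge0 // mulr_ge0.
have gcG : grid_const d.+1 m <= G * Q.
  rewrite gcE mulrDl mul1r; apply: lerD => //.
  by rewrite -mulrA ler_wpM2l.
have SM := shifted_moment M r0 pr_q chiN HE UV Uq Fd Uharm HK mq gc0.
set s := nm (char_exp_sum chi F M H) in SM *.
have s0 : 0 <= s by apply: nm_ge0.
pose B : RR := (\prod_(i < n) h i)%N%:R.
pose W : RR := (\prod_(i < n) U i)%N%:R.
pose V : RR := m.+1%:R.
pose sq := Num.sqrt q.
have sq0 : 0 <= sq by apply: sqrtr_ge0.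
have sqq : sq * sq = q by rewrite -expr2 sqr_sqrtr // ltW.
have Xk : X ^+ kn = sq.
  rewrite /sq -powR12_sqrt ?(ltW q0) // /X -powR_mulrn ?powR_ge0 // -powRrM; congr (_ `^ _).
  by rewrite kE; field; rewrite gt_eqF.
have V0 : 0 < V by rewrite ltr0n.
have W0 : 0 < W by rewrite ltr0n prodn_gt0.
have B0 : 0 < B by rewrite ltr0n prodn_gt0 // => i; apply: leq_trans (mh i).
have k2 : (2 * r = (2 * r - 2).+2)%N by move: r0; clear; lia.
have BW : B <= (2 * V) ^+ n * W.
  rewrite /B /W /V -natrM -natrX -natrM ler_nat.
  have -> : ((2 * m.+1) ^ n = \prod_(i < n) (2 * m.+1))%N by rewrite prod_nat_const card_ord.
  by rewrite -big_split; apply: leq_prod => i _.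
have main : (W * V * s) ^+ (2 * r - 2).+2 <= (G * Q) ^+ (2 * r - 2).+2 *
    ((2 ^+ n * B * W) ^+ (2 * r - 2) * ((A * Q ^+ 2) ^+ n * (2 ^+ n * B * W)) *
     (R * (C2 * V ^+ (2 * r - 2).+2 * sq * Q))).
  rewrite -k2 /W /V -natrM; apply: le_trans SM _.
  rewrite prod_pairs_size -/B -/W.
  have P0 : 0 <= 2 ^+ n * B * W by rewrite !mulr_ge0 ?exprn_ge0 ?ler0n.
  apply: ler_pM.
  - by rewrite exprn_ge0.
  - apply: mulr_ge0.
      rewrite mulr_ge0 ?exprn_ge0 //; apply: prodr_ge0 => i _.
      by rewrite !mulr_ge0 ?ler0n // addr_ge0 // sqr_ge0.
    by rewrite mulr_ge0 ?ler0n // addr_ge0 // !mulr_ge0 ?exprn_ge0 ?sqrtr_ge0 ?ler0n.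
  - by rewrite lerXn2r ?nnegrE ?mulr_ge0.
  apply: ler_pM.
  - rewrite mulr_ge0 ?exprn_ge0 //; apply: prodr_ge0 => i _.
    by rewrite !mulr_ge0 ?ler0n // addr_ge0 // sqr_ge0.
  - by rewrite mulr_ge0 ?ler0n // addr_ge0 // !mulr_ge0 ?exprn_ge0 ?sqrtr_ge0 ?ler0n.
  - rewrite ler_wpM2l ?exprn_ge0 //.
    have -> : \prod_(i < n) (9%:R * (2 * h i * U i)%N%:R * (1 + (c1 * Q) ^+ 2)) =
       (9%:R * (1 + (c1 * Q) ^+ 2)) ^+ n * (2 ^+ n * B * W) :> RR.
      rewrite -prod_pairs_size natr_prod.
      have -> : (9%:R * (1 + (c1 * Q) ^+ 2)) ^+ n = \prod_(i < n) (9%:R * (1 + (c1 * Q) ^+ 2)).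
        by rewrite prodr_const card_ord.
      by rewrite -big_split; apply: eq_bigr => i _ /=; rewrite mulrAC.
    rewrite ler_wpM2r // lerXn2r ?nnegrE ?mulr_ge0 ?ler0n ?exprn_ge0 ?addr_ge0 ?sqr_ge0 //.
    rewrite /A -mulrA ler_wpM2l ?ler0n // [(c1 * Q) ^+ 2]exprMn [leRHS]mulrDl mul1r lerD2r.
    by rewrite exprn_ege1.
  rewrite prod_grid_size !natrM -/R !natrX -mulrA ler_wpM2l ?ler0n //.
  have VV : V <= q := le_trans VX Xq.
  have HJV := HJ m.+1 (ltn0Sn m).
  have := vinogradov_factor rE V1 VV XV X0 Xk sqq erefl d0 (ler0n RR (r ^ (r + r))) HJV.
  rewrite -[r%:R ^+ (r + r)]natrX; apply.
  by rewrite exprn_ge0 ?ler0n.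
have fin := cancel_moment s0 V0 B0 W0 VX Q0 G0 A0 (ler0n RR _) C20 sq0 BW main.
rewrite -k2 -/C5 in fin.
rewrite normcE_nm lecR (box_cardE HE) -/B -/s.
have e1 : (2 * r)%:R^-1 * (2 * r)%:R = 1 :> RR by rewrite mulVf // gt_eqF.
rewrite -(ler_pXn2r (_ : 0 < 2 * r)%N) ?muln_gt0 ?r0 ?nnegrE ?mulr_ge0 ?powR_ge0 //.
apply: le_trans fin _; rewrite le_eqVlt; apply/orP; left; apply/eqP.
have TC : (C5 `^ (2 * r)%:R^-1) ^+ (2 * r) = C5.
  by rewrite -powR_mulrn ?powR_ge0 // -powRrM e1 powRr1.
have TB : (B `^ (1 - 1 / r%:R)) ^+ (2 * r) = B ^+ (2 * r - 2).
  rewrite -powR_mulrn ?powR_ge0 // -powRrM -[RHS]powR_mulrn ?(ltW B0) //; congr (_ `^ _).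
  rewrite natrB; last by rewrite leq_pmulr.
  by rewrite natrM; field; rewrite gt_eqF.
(* Multiplied by 2r, the exponent (k + n)/(4 r k) becomes 1/2 + n/(2k), that is [sq] times [X ^+ n];
   the eps becomes [Q ^+ E]. *)
have Tq : (q `^ ((k + n%:R) / (4 * r%:R * k) + eps)) ^+ (2 * r) = Q ^+ E * X ^+ n * sq.
  rewrite /sq -powR12_sqrt ?(ltW q0) // /Q /X -!powR_mulrn ?powR_ge0 // -!powRrM.
  have qn : q != 0 by rewrite gt_eqF.
  rewrite -!powRD ?qn ?implybT //; congr (_ `^ _).
  have rn : (r%:R : RR) != 0 by rewrite gt_eqF.
  have En : (E%:R : RR) != 0 by rewrite gt_eqF.
  have kn1 : (kn%:R : RR) != 0 by rewrite gt_eqF.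
  rewrite /delta natrM kE.
  move: (E%:R : RR) En (r%:R : RR) rn (kn%:R : RR) kn1 => e en r' rn' k' kn'.
  by field; rewrite en rn' kn'.
by rewrite !exprMn TC TB Tq; ring.
Qed.
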